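(* Let $\Bbbk$ be an algebraically closed field of characteristic $0$ and $G$ a finite group. Let $g,h\in G$ and let $V=\bigoplus_{s\in\mathcal{O}_g}V_s$, $W=\bigoplus_{t\in\mathcal{O}_h}W_t$ be irreducible objects in ${}^G_G\mathcal{YD}$. If $\mathfrak{B}(V\oplus W)$ is finite-dimensional, then the following hold. (1) For all $s\in\mathcal{O}_g$ and $t\in\mathcal{O}_h$, $(st)^2=(ts)^2$. (2) There is at most one double coset $G^hxG^g$ in $G^h\backslash G/G^g$, $x\in G$, such that $(xgx^{-1})h\ne h(xgx^{-1})$. (3) For all $s\in\mathcal{O}_g$, $t\in\mathcal{O}_h$ with $st\ne ts$ there is an irreducible object $U=\bigoplus_{r\in\mathcal{O}_{st}}U_r\in{}^G_G\mathcal{YD}$ satisfying $q_U=-q_Vq_W$ and $\dim\mathfrak{B}(U)<\infty$.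
   Context: For $g\in G$, $\mathcal{O}_g$ is the conjugacy class and $G^g$ the centralizer of $g$ in $G$. ${}^G_G\mathcal{YD}$ is the category of (left) Yetter-Drinfeld modules over the group algebra $\Bbbk G$: $G$-graded vector spaces $U=\bigoplus_{s\in G}U_s$, $U_s=\{u\in U\mid\delta(u)=s\otimes u\}$, which are $G$-modules such that $h\cdot U_s=U_{hsh^{-1}}$ for all $h,s\in G$. It is braided with $c(x\otimes y)=s\cdot y\otimes x$ for $x$ of degree $s$. Every irreducible object $V$ has support a single conjugacy class $\mathcal{O}_g$, i.e. $V=\bigoplus_{s\in\mathcal{O}_g}V_s$ with $V_s\neq 0$, and there is a scalar $q_V\in\Bbbk^*$ such that $s\cdot v=q_Vv$ for all $v\in V_s$, $s\in\mathcal{O}_g$. For $U\in{}^G_G\mathcal{YD}$ the tensor algebra $T(U)$ is a braided Hopf algebra in which the elements of $U$ are primitive, and the Nichols algebra is $\mathfrak{B}(U)=T(U)/I_U$, where $I_U$ is the largest coideal of $T(U)$ contained in $\bigoplus_{n\ge2}U^{\otimes n}$. *)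

(* Defs.v *)
From HB Require Import structures.
From mathcomp Require Import all_boot all_order all_algebra all_fingroup.
From mathcomp Require Import finmap.
From mathcomp Require Import monalg.

Set Implicit Arguments.
Unset Strict Implicit.
Unset Printing Implicit Defensive.

Import GroupScope GRing.Theory.

Local Open Scope ring_scope.

(* Yetter-Drinfeld modules over the group algebra K[gT], of finite dimension.
   The coaction delta : U -> K[gT] (x) U is given by its components, that is
   delta u = \sum_s s (x) ydgr s u; the third and fourth axioms are the
   coassociativity and the counit axiom of delta. *)
Record ydModule (K : fieldType) (gT : finGroupType) := YDModule {
  yd_space :> vectType K;
  ydact : gT -> 'End(yd_space);
  ydgr : gT -> 'End(yd_space);
  ydact1 : ydact 1%g = \1%VF;
  ydactM : forall h k : gT, ydact (h * k)%g = (ydact h \o ydact k)%VF;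
  ydgrK : forall s t : gT,
    (ydgr s \o ydgr t)%VF = if s == t then ydgr t else 0;
  ydgr_sum : \sum_s ydgr s = \1%VF;
  ydgr_act : forall h s : gT,
    (ydact h @: limg (ydgr s))%VS = limg (ydgr (h * s * h^-1)%g)
}.

Arguments ydact {K gT} U h : rename.
Arguments ydgr {K gT} U s : rename.

Section YetterDrinfeld.

Context {K : fieldType} {gT : finGroupType}.
Implicit Types U V W : ydModule K gT.

Definition ydcomp U (s : gT) : {vspace U} := limg (ydgr U s).

Lemma ydcompP U s (u : U) : reflect (ydgr U s u = u) (u \in ydcomp U s).
Proof.
apply: (iffP idP) => [/memv_imgP[v _ ->]|<-]; last exact: memv_img (memvf _).
by rewrite -comp_lfunE ydgrK eqxx.
Qed.

Definition ydsupp U : {set gT} := [set s | ydcomp U s != 0%VS].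

Definition ydsub U (S : {vspace U}) : Prop :=
  forall h : gT, (ydact U h @: S <= S)%VS /\ (ydgr U h @: S <= S)%VS.

Definition ydirr U : Prop :=
  ({:U} != 0)%VS /\
  forall S : {vspace U}, ydsub S -> S = 0%VS \/ S = {:U}%VS.

Definition ydscalar U (q : K) : Prop :=
  forall (s : gT) (v : U), v \in ydcomp U s -> ydact U s v = q *: v.

Lemma ydgr_actE U h s (u : U) :
  ydact U h (ydgr U s u) = ydgr U (h * s * h^-1)%g (ydact U h u).
Proof.
have in_gr t v : ydact U h (ydgr U t v) \in ydcomp U (h * t * h^-1)%g.
  by rewrite /ydcomp -ydgr_act memv_img // memv_img ?memvf.
rewrite -[u in RHS]id_lfunE -(ydgr_sum U) sum_lfunE linear_sum linear_sum /=.
rewrite (bigD1 s) //= big1 ?addr0 => [|t neq_ts].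
  by rewrite (ydcompP _ _ (in_gr s u)).
rewrite -(ydcompP _ _ (in_gr t u)) -comp_lfunE ydgrK.
case: eqP => [/mulIg/mulgI st|_]; last by rewrite lfunE.
by rewrite st eqxx in neq_ts.
Qed.

Section DirectSum.

Context (V W : ydModule K gT).

Definition pair_end (f : 'End(V)) (g : 'End(W)) (p : V * W) : V * W :=
  (f p.1, g p.2).

Fact pair_end_linear f g : linear (pair_end f g).
Proof. by move=> a p q; rewrite /pair_end /= !linearP. Qed.

HB.instance Definition _ f g :=
  GRing.isLinear.Build K (V * W)%type (V * W)%type *:%R (pair_end f g)
    (pair_end_linear f g).

Definition pair_lfun f g : 'End((V * W)%type) := linfun (pair_end f g).

Lemma pair_lfunE f g (p : V * W) : pair_lfun f g p = (f p.1, g p.2).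
Proof. by rewrite lfunE. Qed.

Definition ydsum_act h := pair_lfun (ydact V h) (ydact W h).
Definition ydsum_gr s := pair_lfun (ydgr V s) (ydgr W s).

Fact ydsum_act1 : ydsum_act 1%g = \1%VF.
Proof.
by apply/lfunP=> -[v w]; rewrite pair_lfunE !ydact1 !id_lfunE.
Qed.

Fact ydsum_actM h k : ydsum_act (h * k)%g = (ydsum_act h \o ydsum_act k)%VF.
Proof.
by apply/lfunP=> -[v w]; rewrite comp_lfunE !pair_lfunE !ydactM !comp_lfunE.
Qed.

Fact ydsum_grK s t :
  (ydsum_gr s \o ydsum_gr t)%VF = if s == t then ydsum_gr t else 0.
Proof.
apply/lfunP=> -[v w]; rewrite comp_lfunE !pair_lfunE -!comp_lfunE !ydgrK /=.
by case: eqP; rewrite ?pair_lfunE ?lfunE //= !lfunE.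
Qed.

Fact ydsum_gr_sum : \sum_s ydsum_gr s = \1%VF.
Proof.
apply/lfunP=> -[v w]; rewrite sum_lfunE id_lfunE.
under eq_bigr do rewrite pair_lfunE /=.
rewrite -[v in RHS]id_lfunE -[w in RHS]id_lfunE -!ydgr_sum !sum_lfunE.
by elim/big_rec3: _ => // s p a _ _ ->.
Qed.

Fact ydsum_gr_act h s :
  (ydsum_act h @: limg (ydsum_gr s))%VS = limg (ydsum_gr (h * s * h^-1)%g).
Proof.
have actE k t p : ydsum_act k (ydsum_gr t p) =
    ydsum_gr (k * t * k^-1)%g (ydsum_act k p).
  by case: p => v w; rewrite !pair_lfunE /= !ydgr_actE.
apply/eqP; rewrite eqEsubv; apply/andP; split; apply/subvP=> u.
  case/memv_imgP=> _ /memv_imgP[p _ ->] ->.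
  by rewrite actE memv_img ?memvf.
case/memv_imgP=> p _ ->; apply/memv_imgP.
exists (ydsum_gr s (ydsum_act h^-1%g p)); first exact: memv_img (memvf _).
by rewrite actE -(comp_lfunE (ydsum_act h)) -ydsum_actM mulgV ydsum_act1 id_lfunE.
Qed.

Definition ydsum : ydModule K gT :=
  YDModule ydsum_act1 ydsum_actM ydsum_grK ydsum_gr_sum ydsum_gr_act.

End DirectSum.

Section LinearExtension.

Context {I : choiceType} {M : lmodType K} (f : I -> M).

Definition linext (x : {malg K[I]}) : M := \sum_(w <- msupp x) x@_w *: f w.

Lemma linextEw (d : {fset I}) (x : {malg K[I]}) :
  (msupp x `<=` d)%fset -> linext x = \sum_(w <- d) x@_w *: f w.
Proof.
move=> le_xd; rewrite /linext (big_fset_incl _ le_xd) // => w _ w_x.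
by rewrite mcoeff_outdom // scale0r.
Qed.

Fact linext_is_linear : linear linext.
Proof.
move=> a x y; pose d := (msupp x `|` msupp y `|` msupp (a *: x + y))%fset.
have [lx ly lxy] : [/\ msupp x `<=` d, msupp y `<=` d
    & msupp (a *: x + y) `<=` d]%fset.
  by split; apply/fsubsetP=> w; rewrite !inE => ->; rewrite ?orbT.
rewrite (linextEw lx) (linextEw ly) (linextEw lxy) scaler_sumr -big_split /=.
by apply: eq_bigr => w _; rewrite mcoeffD mcoeffZ scalerDl scalerA.
Qed.

HB.instance Definition _ :=
  GRing.isLinear.Build K {malg K[I]} M *:%R linext linext_is_linear.

Lemma linextU w : linext << w >> = f w.
Proof.
rewrite (@linextEw [fset w]%fset) ?msuppU_le // big_seq_fset1 mcoeffU eqxx.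
by rewrite scale1r.
Qed.

End LinearExtension.

Section Nichols.

Context (U : ydModule K gT).

(* The tensor algebra T(U), as the free algebra on a basis (e_i) of U: the
   word i1 ... in stands for e_i1 (x) ... (x) e_in. Likewise T(U) (x) T(U) has
   the pairs of words as a basis. *)
Notation word := {fmonom 'I_(\dim {:U})}.
Definition tensalg : lalgType K := {malg K[word]}.
Definition tensalg2 : lmodType K := {malg K[(word * word)%type]}.

Definition ebasis (i : 'I_(\dim {:U})) : U := (vbasis {:U})`_i.

Definition tens_gen (u : U) : tensalg :=
  \sum_i coord (vbasis {:U}) i u *: (<< fmu i >> : tensalg).

Definition tens (x y : tensalg) : tensalg2 :=
  \sum_(w <- msupp x) \sum_(w' <- msupp y)
    (x@_w * y@_w') *: (<< (w, w') >> : tensalg2).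

(* The Yetter-Drinfeld structure of T(U): the action is diagonal, and the
   degree of a product of homogeneous elements is the product of degrees. *)
Definition tensact (h : gT) : tensalg -> tensalg :=
  linext (fun w : word => \prod_(i <- w : seq _) tens_gen (ydact U h (ebasis i))).

Fixpoint word_gr (s : gT) (w : seq 'I_(\dim {:U})) : tensalg :=
  if w is i :: w' then
    \sum_r tens_gen (ydgr U r (ebasis i)) * word_gr (r^-1 * s)%g w'
  else (s == 1%g)%:R.

Definition tensgr (s : gT) : tensalg -> tensalg :=
  linext (fun w : word => word_gr s w).

(* The product of the braided tensor product algebra T(U) (x) T(U), that is
   (x (x) y)(x' (x) y') = x (s . x') (x) y y' for y homogeneous of degree s. *)
Definition braided_mul (z z' : tensalg2) : tensalg2 :=
  linext (fun p : word * word => linext (fun p' : word * word =>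
    \sum_s tens (<< p.1 >> * tensact s << p'.1 >>)
                (tensgr s << p.2 >> * << p'.2 >>)) z') z.

(* The algebra morphism T(U) -> T(U) (x) T(U) for which U is primitive. *)
Fixpoint word_comul (w : seq 'I_(\dim {:U})) : tensalg2 :=
  if w is i :: w' then
    braided_mul (tens << fmu i >> 1 + tens 1 << fmu i >>) (word_comul w')
  else tens 1 1.

Definition comul : tensalg -> tensalg2 :=
  linext (fun w : word => word_comul w).

Definition counit (x : tensalg) : K := x@_(mone : word).

Definition subspace (I : tensalg -> Prop) : Prop :=
  I 0 /\ forall (a : K) (x y : tensalg), I x -> I y -> I (a *: x + y).

Definition coideal (I : tensalg -> Prop) : Prop :=
  [/\ subspace I,
      forall x, I x -> counit x = 0
    & forall x, I x -> exists ps : seq (tensalg * tensalg),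
        (forall p, p \in ps -> I p.1 \/ I p.2) /\
        comul x = \sum_(p <- ps) tens p.1 p.2].

Definition deg_ge2 (x : tensalg) : Prop :=
  forall w : word, (size w < 2)%N -> x@_w = 0.

Definition nichols_ideal (x : tensalg) : Prop :=
  exists I : tensalg -> Prop,
    [/\ coideal I, forall y, I y -> deg_ge2 y & I x].

Lemma nichols_ideal_largest :
  [/\ coideal nichols_ideal, forall x, nichols_ideal x -> deg_ge2 x
    & forall I, coideal I -> (forall x, I x -> deg_ge2 x) ->
        forall x, I x -> nichols_ideal x].
Proof.
split; last by move=> I coI I2 x Ix; exists I.
  split.
  - split.
      exists (fun x => x = 0); split=> // [|_ -> w _]; last exact: mcoeff0.
      split=> [|_ ->|_ ->]; last 2 first.
      + exact: mcoeff0.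
      + by exists [::]; rewrite big_nil /comul linear0.
      by split=> // a _ _ -> ->; rewrite scaler0 addr0.
    move=> a x y [I [[[I0 IS] Ie Id] I2 Ix]] [J [[[J0 JS] Je Jd] J2 Jy]].
    exists (fun z => exists x' y', [/\ I x', J y' & z = x' + y']); split.
    + split.
      * split; first by exists 0, 0; rewrite addr0.
        move=> b _ _ [x1 [y1 [Ix1 Jy1 ->]]] [x2 [y2 [Ix2 Jy2 ->]]].
        exists (b *: x1 + x2), (b *: y1 + y2); split; [exact: IS|exact: JS|].
        by rewrite scalerDr addrACA.
      * move=> _ [x1 [y1 [Ix1 Jy1 ->]]].
        have [x0 y0] := (Ie _ Ix1, Je _ Jy1).
        by rewrite /counit mcoeffD [x1@__]x0 [y1@__]y0 addr0.
      * move=> _ [x1 [y1 [Ix1 Jy1 ->]]].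
        have [ps [psI dx]] := Id _ Ix1; have [qs [qsJ dy]] := Jd _ Jy1.
        exists (ps ++ qs); rewrite big_cat /comul linearD /= -dx -dy; split=> //.
        move=> p; rewrite mem_cat => /orP[/psI|/qsJ] [] Hp; [left|right|left|right].
        - by exists p.1, 0; rewrite addr0.
        - by exists p.2, 0; rewrite addr0.
        - by exists 0, p.1; rewrite add0r.
        - by exists 0, p.2; rewrite add0r.
    + move=> _ [x1 [y1 [Ix1 Jy1 ->]]] w lt_w.
      by rewrite mcoeffD (I2 _ Ix1) ?(J2 _ Jy1) ?addr0.
    + exists (a *: x), y; split=> //.
      by rewrite -[a *: x]addr0; apply: IS.
  - by move=> x [I [[_ Ie _] _ Ix]]; apply: Ie.
  - move=> x [I [[SI Ie Id] I2 Ix]]; have [ps [psI dx]] := Id _ Ix.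
    by exists ps; split=> // p /psI[] Ip; [left|right]; exists I; split.
by move=> x [I [_ I2 Ix]]; apply: I2.
Qed.

(* dim (T(U) / nichols_ideal) < oo *)
Definition nichols_findim : Prop :=
  exists bs : seq tensalg, forall x : tensalg,
    exists c : nat -> K,
      nichols_ideal (x - \sum_(i < size bs) c i *: bs`_i).

End Nichols.

End YetterDrinfeld.

(* Hence ydscalar determines the scalar q_U of an irreducible object U. *)
Lemma ydscalar_irr (K : closedFieldType) (gT : finGroupType)
  (U : ydModule K gT) : ydirr U ->
  exists q : K, [/\ q != 0, ydscalar U q & forall q', ydscalar U q' -> q' = q].
Proof.
case=> Unz Usimple; pose th : 'End(U) := \sum_s (ydact U s \o ydgr U s)%VF.
have inC s u : ydgr U s u \in ydcomp U s by rewrite memv_img ?memvf.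
have gr2 s t u : ydgr U s (ydgr U t u) = if s == t then ydgr U t u else 0.
  by rewrite -comp_lfunE ydgrK; case: ifP; rewrite ?lfunE.
have thE s u : u \in ydcomp U s -> th u = ydact U s u.
  move=> /ydcompP gu; rewrite sum_lfunE (bigD1 s) //= comp_lfunE gu.
  rewrite big1 ?addr0 // => t /negPf neq_ts.
  by rewrite comp_lfunE -gu gr2 neq_ts linear0.
have sumE u : \sum_s ydgr U s u = u by rewrite -sum_lfunE ydgr_sum id_lfunE.
have gr_act s u : ydact U s (ydgr U s u) = ydgr U s (ydact U s u).
  by rewrite ydgr_actE mulgK.
have th_act h u : th (ydact U h u) = ydact U h (th u).
  rewrite -[u]sumE !linear_sum; apply: eq_bigr => s _ /=.
  rewrite [in RHS](thE _ _ (inC s u)) ydgr_actE (thE _ _ (inC _ _)) -ydgr_actE.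
  by rewrite -!comp_lfunE -!ydactM mulgKV.
have th_gr s u : th (ydgr U s u) = ydgr U s (th u).
  rewrite -[u in RHS]sumE (linear_sum th) linear_sum /= (bigD1 s) //=.
  rewrite big1 ?addr0 => [|t /negPf neq_ts].
    by rewrite (thE _ _ (inC _ _)) gr_act gr2 eqxx.
  by rewrite (thE _ _ (inC _ _)) gr_act gr2 eq_sym neq_ts.
have [q qU] : exists q, passmx.leigenspace th q != 0%VS.
  pose e := vbasis {:U}; have be : basis_of {:U} e := vbasisP _.
  have /closed_rootP[q] : size (char_poly (passmx.mxof e e th)) != 1%N.
    by rewrite size_char_poly eqSS dimv_eq0.
  rewrite -eigenvalue_root_char => qe; exists q.
  by rewrite (passmx.leigenspaceE be) passmx.vsof_eq0.
have eigE u : (u \in passmx.leigenspace th q) = (th u == q *: u).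
  by rewrite memv_ker add_lfunE opp_lfunE scale_lfunE id_lfunE subr_eq0.
have eigU u : th u = q *: u.
  apply/eqP; rewrite -eigE.
  case: (Usimple (passmx.leigenspace th q)) => [h|q0|eqU]; last by rewrite eqU memvf.
    split; apply/subvP=> _ /memv_imgP[v qv ->]; rewrite eigE in qv.
      by rewrite eigE th_act (eqP qv) linearZ.
    by rewrite eigE th_gr (eqP qv) linearZ.
  by rewrite q0 eqxx in qU.
have qS : ydscalar U q by move=> s v Usv; rewrite -eigU (thE s).
have [s Us] : exists s, ydcomp U s != 0%VS.
  apply/existsP; apply: contraNT Unz; rewrite negb_exists => /forallP U0.
  apply/eqP/vspaceP=> u; rewrite memvf memv0 -[u]sumE big1 ?eqxx // => s _.
  by have := inC s u; rewrite (eqP (negbNE (U0 s))) memv0 => /eqP.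
have vnz : vpick (ydcomp U s) != 0 by rewrite vpick0.
have sv := qS _ _ (memv_pick (ydcomp U s)).
exists q; split=> // [|q' q'S].
  apply: contraNneq vnz => q0; rewrite q0 scale0r in sv.
  by rewrite -[vpick _]id_lfunE -(ydact1 U) -(mulVg s) ydactM comp_lfunE sv linear0.
apply/eqP; rewrite -subr_eq0; apply: contraNT vnz => qq'.
by rewrite -(can_eq (scalerK qq')) scaler0 scalerBl -sv -(q'S _ _ (memv_pick _)) subrr.
Qed.

(* Main.v *)
(* The Nichols algebra of U is the subalgebra generated by the letters inside
   the quantum shuffle algebra of functions on words in a homogeneous basis of
   U, so that finite dimension means that long products of letters vanish.

   Write A = W, C = V, and let K be the subalgebra of the Nichols algebra of
   A + C that is killed by the right derivatives along C.  It is generated by A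
   under the braided commutators with the letters of C.  Let Y be the part of K
   of degree 1 in A and of maximal degree m in C.  The reflection of the pair
   (A, C) is the pair (C^*, Y); it is again irreducible with finite-dimensional
   Nichols algebra, and K embeds into that Nichols algebra.

   The commutators [a, c] form a submodule Z of degree (1, 1) in (A, C).
   Iterated reflections change its degree (i, j) into (m i - j, i), and this
   process of Euclidean type stops with i = 0, when Z is embedded into an
   irreducible module U with finite-dimensional Nichols algebra.  The action of
   ts on the explicit element [a, c], for c of degree s and a of degree t, then
   yields the scalar of U and the relation (st)^2 = (ts)^2, and irreducibility
   makes G act transitively on the noncommuting pairs. *)
Require Import Defs.
From HB Require Import structures.
From mathcomp Require Import all_boot all_order all_algebra all_fingroup.
From mathcomp Require Import finmap monalg boolp functions zify.
Set Implicit Arguments.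
Unset Strict Implicit.
Unset Printing Implicit Defensive.
Import GroupScope GRing.Theory.
Local Open Scope ring_scope.

(** * Subspaces of function spaces *)

(** Why the process stops: let [D] bound [i q - j p] over all degrees (p, q) of nonzero monomials. A
    letter of C has degree (0, 1), so [i <= D]. An element of K stays nonzero when multiplied by a
    letter of C, so on K the bound improves to [D - i]; in the coordinates (m p - q, p) of the
    reflected pair this is a bound of the same kind for the degree (m i - j, i). Hence each
    reflection with [i > 0] lowers [D].

    A reflection applies to Z only while Z lies in K, which its degree alone does not ensure. The
    stronger condition [Good] on the words in the support does, and it passes to the reflected pair.

    The map from K to the reflected algebra is not defined on generators, where relations would have
    to be checked. K carries skew derivations with the twists of the letters of C^* and Y, and a
    function on words is determined by its iterated derivatives, so multiplicativity follows from
    the recursive form of the product. *)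

Section Subspaces.

Context {K : fieldType}.
Implicit Types V W : lmodType K.

Section Pointwise.
Context {T : Type}.
Implicit Types (a : K) (F H : T -> K^o) (w : T).
Lemma shZ a F w : (a *: F) w = a * F w. Proof. by []. Qed.
Lemma shD F H w : (F + H) w = F w + H w. Proof. by []. Qed.
Lemma shN F w : (- F) w = - F w. Proof. by []. Qed.
Lemma shL a F H w : (a *: F + H) w = a * F w + H w. Proof. by []. Qed.
End Pointwise.

(** Predicates rather than [{vspace _}], since the functions on all words form an
    infinite-dimensional space. *)
Definition lsub V (P : V -> Prop) : Prop :=
  P 0 /\ forall a x y, P x -> P y -> P (a *: x + y).

Inductive linspan V (X : V -> Prop) : V -> Prop :=
| span0 : linspan X 0
| spanP a x y : X x -> linspan X y -> linspan X (a *: x + y).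

Lemma lsubD V (P : V -> Prop) x y : lsub P -> P x -> P y -> P (x + y).
Proof. by case=> _ PL Px Py; rewrite -[x]scale1r; apply: PL. Qed.

Lemma lsubZ V (P : V -> Prop) a x : lsub P -> P x -> P (a *: x).
Proof. by case=> P0 PL Px; rewrite -[_ *: _]addr0; apply: PL. Qed.

Lemma lsubN V (P : V -> Prop) x : lsub P -> P x -> P (- x).
Proof. by move=> sP Px; rewrite -scaleN1r; apply: lsubZ. Qed.

Lemma lsubB V (P : V -> Prop) x y : lsub P -> P x -> P y -> P (x - y).
Proof. by move=> sP Px Py; apply: lsubD => //; apply: lsubN. Qed.

Lemma lsub_sum V (P : V -> Prop) (J : Type) (r : seq J) (p : pred J) F :
  lsub P -> (forall j, p j -> P (F j)) -> P (\sum_(j <- r | p j) F j).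
Proof.
move=> sP PF; elim/big_rec: _ => [|j x pj Px]; first by case: sP.
by apply: lsubD => //; apply: PF.
Qed.

Lemma span_lsub V (X : V -> Prop) : lsub (linspan X).
Proof.
split=> [|a x y]; first exact: span0.
elim=> [|b z t Xz _ IH] Sy; first by rewrite scaler0 add0r.
by rewrite scalerDr scalerA -addrA; apply: spanP => //; apply: IH.
Qed.

Lemma span_gen V (X : V -> Prop) x : X x -> linspan X x.
Proof. by move=> Xx; rewrite -[x]scale1r -[_ *: _]addr0; apply: spanP => //; left. Qed.

Lemma span_sub V (X P : V -> Prop) :
  lsub P -> (forall x, X x -> P x) -> forall x, linspan X x -> P x.
Proof. by move=> [P0 PL] XP x; elim=> // a y z /XP Py _; apply: PL. Qed.

Lemma lsub_preim V W (f : {linear V -> W}) (P : W -> Prop) :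
  lsub P -> lsub (fun x => P (f x)).
Proof.
by move=> [P0 PL]; split=> [|a x y Px Py]; rewrite ?linear0 // linearP; apply: PL.
Qed.

Lemma lsub_and V (P Q : V -> Prop) : lsub P -> lsub Q -> lsub (fun x => P x /\ Q x).
Proof.
move=> [P0 PL] [Q0 QL]; split=> // a x y [Px Qx] [Py Qy].
by split; [apply: PL|apply: QL].
Qed.

Lemma span_split V (X Y Z : V -> Prop) x :
  (forall z, X z -> Y z \/ Z z) -> linspan X x ->
  exists y z, [/\ x = y + z, linspan Y y & linspan Z z].
Proof.
move=> XYZ; elim=> [|a g t Xg _ [y [z [-> Yy Zz]]]].
  by exists 0, 0; rewrite addr0; split=> //; apply: span0.
have [Yg|Zg] := XYZ _ Xg.
  by exists (a *: g + y), z; rewrite addrA; split=> //; apply: spanP.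
by exists y, (a *: g + z); rewrite addrCA; split=> //; apply: spanP.
Qed.

(* A minimal set of coordinates determining the elements of [P] is the set of
   pivots of a reduced echelon basis. *)
Lemma echelon (E : finType) (P : (E -> K^o) -> Prop) : lsub P ->
  exists (T : {set E}) (y : E -> E -> K^o),
    [/\ forall e, e \in T -> P (y e),
        forall e e', e \in T -> e' \in T -> y e e' = (e == e')%:R
      & forall x, P x -> (forall e, e \in T -> x e = 0) -> x = 0].
Proof.
move=> sP; pose det (T : {set E}) :=
  forall x, P x -> (forall e, e \in T -> x e = 0) -> x = 0.
have [T [dT minT]] : exists T : {set E}, det T /\
    forall e, e \in T -> ~ det (T :\ e).
  have : exists T, det T by exists setT => x _ x0; apply/funext => e; apply: x0.
  case=> T; have [n] := ubnP #|T|; elim: n T => // n IH T leTn dT.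
  have [minT|] := pselect (forall e, e \in T -> ~ det (T :\ e)); first by exists T.
  move=> /existsNP[e /not_implyP[eT /contrapT dTe]]; apply: IH dTe.
  by move: leTn; rewrite (cardsD1 e) eT.
have /choice[y yP] : forall e, exists y, e \in T ->
    P y /\ forall e', e' \in T -> y e' = (e == e')%:R.
  move=> e; have [eT|] := boolP (e \in T); last by exists 0.
  have /existsNP[x /not_implyP[Px /not_implyP[x0 xn0]]] := minT _ eT.
  have xe : x e != 0.
    apply: contra_notN xn0 => /eqP xe; apply: dT => // e' e'T.
    by have [->//|ne] := eqVneq e' e; apply: x0; rewrite in_setD1 ne.
  exists ((x e)^-1 *: x) => _; split; first exact: lsubZ.
  move=> e' e'T; have [<-|ne] := eqVneq e e'; first exact: mulVf.
  have -> : ((x e)^-1 *: x) e' = (x e)^-1 * x e' by [].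
  by rewrite (x0 e') ?mulr0 ?(negPf ne) // in_setD1 eq_sym ne.
exists T, y; split=> // [e /yP[]//|e e' /yP[_ H] /H//].
Qed.

Lemma echelon_sum (E : finType) (P : (E -> K^o) -> Prop) (T : {set E})
    (y : E -> E -> K^o) : lsub P ->
  (forall e, e \in T -> P (y e)) ->
  (forall e e', e \in T -> e' \in T -> y e e' = (e == e')%:R) ->
  (forall x, P x -> (forall e, e \in T -> x e = 0) -> x = 0) ->
  forall x, P x -> x = \sum_(e in T) x e *: y e.
Proof.
move=> sP Py yE dT x Px; apply/eqP; rewrite -subr_eq0; apply/eqP/dT.
  by apply: lsubB => //; apply: lsub_sum => // e eT; apply: lsubZ => //; apply: Py.
move=> e eT; rewrite fct_sumE.
have -> : (x - (fun e' => \sum_(i in T) (x i *: y i) e')) e =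
  x e - \sum_(i in T) x i * y i e by [].
rewrite (bigD1 e) //= yE // eqxx mulr1 big1 ?addr0 ?subrr // => i /andP[iT ne].
by rewrite yE // (negPf ne) mulr0.
Qed.

(** On [P], a coordinate [e] that is not a pivot is a combination of the pivot coordinates; this
    relation is a functional that kills [P] and has coefficient 1 at [e]. Irreducibility is stated
    by functionals, and this lemma turns it into statements on subspaces. *)
Lemma lsub_full (E : finType) (P : (E -> K^o) -> Prop) : lsub P ->
  (forall f : E -> K, (forall u, P u -> \sum_e u e * f e = 0) -> forall e, f e = 0) ->
  forall u, P u.
Proof.
move=> sP annP; have [T [y [Py yE dT]]] := echelon sP.
have exp := echelon_sum sP Py yE dT.
have Tall e : e \in T.
  apply: contraT => eT; pose f i : K := if i == e then 1 else - (if i \in T then y i e else 0).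
  suff /annP/(_ e)/eqP : forall u, P u -> \sum_i u i * f i = 0 by rewrite /f eqxx oner_eq0.
  move=> u /exp uE; rewrite (bigD1 e) //= /f eqxx mulr1 {1}uE fct_sumE.
  rewrite [X in _ + X](bigID (mem T)) /= [X in _ + (_ + X)]big1 => [|i /andP[ie /negPf iT]].
    rewrite addr0 [X in _ + X](eq_bigl (mem T)) => [|i].
      rewrite -big_split big1 // => i iT /=.
      have /negPf -> : i != e by apply: contraNneq eT => <-.
      by rewrite iT mulrN; apply: subrr.
    by rewrite /= andbC; have [->|] := eqVneq i e; rewrite ?(negPf eT) ?andbT.
  by rewrite (negPf ie) iT oppr0 mulr0.
move=> u; have -> : u = \sum_(e in T) u e *: y e.
  apply/funext => e; rewrite fct_sumE (bigD1 e) //=.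
  have -> : (u e *: y e) e = u e * y e e by [].
  rewrite yE // eqxx mulr1 big1 ?addr0 // => i /andP[iT ne].
  have -> : (u i *: y i) e = u i * y i e by [].
  by rewrite yE // (negPf ne) mulr0.
by apply: lsub_sum => // e eT; apply: lsubZ => //; apply: Py.
Qed.

End Subspaces.

(** * The quantum shuffle algebra *)

(* A Yetter-Drinfeld module with a homogeneous basis indexed by [I]:
   [h . u_i = \sum_j co h i j u_j] with [u_i] of degree [dg i].  The colour
   [col] records a decomposition into two submodules. *)
Record ydData (K : fieldType) (gT : finGroupType) (I : finType) := YdData {
  dg : I -> gT;
  co : gT -> I -> I -> K;
  col : I -> bool;
  co1 : forall i j, co 1%g i j = (i == j)%:R;
  coM : forall h k i l, co (h * k)%g i l = \sum_j co k i j * co h j l;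
  coD : forall h i j, co h i j != 0 -> dg j = (h * dg i * h^-1)%g;
  coC : forall h i j, co h i j != 0 -> col i = col j
}.

Section Shuffle.

Context {K : fieldType} {gT : finGroupType} {I : finType} (N : ydData K gT I).

Local Notation Sh := (seq I -> K^o).
Local Notation dg := (dg N).
Local Notation co := (co N).
Implicit Types (F H x y z : Sh) (w v : seq I) (i j k c : I) (g h : gT).

(** The head of a list is the last tensor factor: [i :: w] stands for the tensor of [w] followed by
    [u_i]. So removing the head is a right derivative, and [wd] below multiplies degrees in reverse
    order. *)
Definition dr i F : Sh := fun w => F (i :: w).
Definition dl i F : Sh := fun w => F (rcons w i).

Fixpoint shact h F w : K^o :=
  if w is j :: w' then \sum_i co h i j * shact h (dr i F) w' else F [::].

(* The quantum shuffle product: [dr i] is a right skew derivation, that is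
   [dr i (F H) = F (dr i H) + (dr i F) (dg i . H)]. *)
Fixpoint mul F H w : K^o :=
  if w is i :: w' then mul F (dr i H) w' + mul (dr i F) (shact (dg i) H) w'
  else F [::] * H [::].

Local Notation "x ** y" := (mul x y) (at level 40, left associativity).

Definition shone : Sh := fun w => (w == [::])%:R.
Definition letter i : Sh := fun w => (w == [:: i])%:R.

Lemma coVK h i j : \sum_k co h i k * co h^-1 k j = (i == j)%:R.
Proof. by rewrite -coM mulVg co1. Qed.

Lemma coKV h i j : \sum_k co h^-1 i k * co h k j = (i == j)%:R.
Proof. by rewrite -coM mulgV co1. Qed.

Lemma sum_delta (V : lmodType K) (G : I -> V) i :
  \sum_j (j == i)%:R *: G j = G i.
Proof.
rewrite (bigD1 i) //= eqxx scale1r big1 ?addr0 // => j /negPf ->.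
exact: scale0r.
Qed.

Lemma sum_deltaV (V : lmodType K) (G : I -> V) i :
  \sum_j (i == j)%:R *: G j = G i.
Proof. by under eq_bigr do rewrite eq_sym; apply: sum_delta. Qed.

Lemma dr_sum i (J : Type) (r : seq J) (p : pred J) (G : J -> Sh) :
  dr i (\sum_(a <- r | p a) G a) = \sum_(a <- r | p a) dr i (G a).
Proof. by rewrite /dr !fct_sumE. Qed.

Fact act_linear h : linear (shact h).
Proof.
move=> a x y; apply/funext => w.
elim: w x y => [//|j w IH] x y; rewrite /= shL mulr_sumr -big_split.
apply: eq_bigr => i _; rewrite -[dr i (_ + _)]/(a *: dr i x + dr i y) IH.
by rewrite shL mulrDr mulrCA.
Qed.
HB.instance Definition _ h := GRing.isLinear.Build K Sh Sh *:%R (shact h) (act_linear h).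

Lemma act0 h : shact h 0 = 0. Proof. exact: linear0. Qed.
Lemma actD h F H : shact h (F + H) = shact h F + shact h H. Proof. exact: linearD. Qed.
Lemma actB h F H : shact h (F - H) = shact h F - shact h H. Proof. exact: linearB. Qed.
Lemma actZ h a F : shact h (a *: F) = a *: shact h F. Proof. exact: linearZ_LR. Qed.
Lemma act_sum h (J : Type) (r : seq J) (p : pred J) (G : J -> Sh) :
  shact h (\sum_(a <- r | p a) G a) = \sum_(a <- r | p a) shact h (G a).
Proof. exact: linear_sum. Qed.

Fact mul_linear F : linear (mul F).
Proof.
move=> a x y; apply/funext => w.
elim: w F x y => [|j w IH] F x y /=.
  by rewrite shL shL mulrDr mulrCA.
rewrite shL -[dr j (_ + _)]/(a *: dr j x + dr j y) linearP !IH.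
by rewrite !shL mulrDr addrACA.
Qed.
HB.instance Definition _ F := GRing.isLinear.Build K Sh Sh *:%R (mul F) (mul_linear F).

Definition mulr_of H F : Sh := F ** H.

Fact mulr_of_linear H : linear (mulr_of H).
Proof.
move=> a x y; apply/funext => w; rewrite /mulr_of.
elim: w H x y => [|j w IH] H x y /=.
  by rewrite shL shL mulrDl mulrA.
rewrite shL -[dr j (_ + _)]/(a *: dr j x + dr j y) !IH.
by rewrite !shL mulrDr addrACA.
Qed.
HB.instance Definition _ H :=
  GRing.isLinear.Build K Sh Sh *:%R (mulr_of H) (mulr_of_linear H).

Lemma shmul0 F : F ** 0 = 0. Proof. exact: linear0. Qed.
Lemma shmulDr F x y : F ** (x + y) = F ** x + F ** y. Proof. exact: linearD. Qed.
Lemma shmulBr F x y : F ** (x - y) = F ** x - F ** y. Proof. exact: linearB. Qed.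
Lemma shmulZr F a x : F ** (a *: x) = a *: (F ** x). Proof. exact: linearZ_LR. Qed.
Lemma shmul_sumr F (J : Type) (r : seq J) (p : pred J) (G : J -> Sh) :
  F ** (\sum_(a <- r | p a) G a) = \sum_(a <- r | p a) F ** G a.
Proof. exact: linear_sum. Qed.
Lemma mul0sh F : 0 ** F = 0. Proof. exact: (linear0 (mulr_of F)). Qed.
Lemma shmulDl F x y : (x + y) ** F = x ** F + y ** F.
Proof. exact: (linearD (mulr_of F)). Qed.
Lemma shmulBl F x y : (x - y) ** F = x ** F - y ** F.
Proof. exact: (linearB (mulr_of F)). Qed.
Lemma shmulZl F a x : (a *: x) ** F = a *: (x ** F).
Proof. exact: (linearZ_LR (mulr_of F)). Qed.
Lemma shmul_suml F (J : Type) (r : seq J) (p : pred J) (G : J -> Sh) :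
  (\sum_(a <- r | p a) G a) ** F = \sum_(a <- r | p a) G a ** F.
Proof. exact: (linear_sum (mulr_of F)). Qed.

Lemma dr_mul i F H : dr i (F ** H) = F ** dr i H + dr i F ** shact (dg i) H.
Proof. by []. Qed.

Lemma dr_act j h F : dr j (shact h F) = \sum_i co h i j *: shact h (dr i F).
Proof. by apply/funext => w; rewrite fct_sumE. Qed.

Lemma act1 F : shact 1%g F = F.
Proof.
apply/funext => w; elim: w F => //= j w IH F.
rewrite (eq_bigr (fun i => (i == j)%:R *: (dr i F w : K^o))) ?sum_delta // => i _.
by rewrite IH co1.
Qed.

Lemma actM h g F : shact (h * g)%g F = shact h (shact g F).
Proof.
apply/funext => w; elim: w F => //= j w IH F.
under eq_bigr do rewrite IH coM mulr_suml.
rewrite exchange_big /=; apply: eq_bigr => l _.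
rewrite dr_act act_sum fct_sumE mulr_sumr; apply: eq_bigr => i _.
by rewrite actZ shZ -mulrA mulrCA.
Qed.

Lemma actK h F : shact h^-1 (shact h F) = F.
Proof. by rewrite -actM mulVg act1. Qed.

Lemma actVK h F : shact h (shact h^-1 F) = F.
Proof. by rewrite -actM mulgV act1. Qed.

(** A function is determined by its constant term and its right derivatives, so identities between
    products are proved by induction on the word. Here the twists agree because
    [h . (dg i . x) = dg j . (h . x)] whenever [co h i j] is nonzero. *)
Lemma act_mul h F H : shact h (F ** H) = shact h F ** shact h H.
Proof.
apply/funext => w; elim: w F H => //= j w IH F H.
rewrite !dr_act shmul_sumr shmul_suml !fct_sumE -big_split /=.
apply: eq_bigr => i _; rewrite dr_mul actD shD !IH.
rewrite shmulZr shmulZl !shZ -mulrDr.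
have [->|nz] := eqVneq (co h i j) 0; first by rewrite !mul0r.
by rewrite -!actM (coD nz) mulgKV.
Qed.

Lemma shmulA F H E : F ** (H ** E) = F ** H ** E.
Proof.
apply/funext => w; elim: w F H E => [|j w IH] F H E /=; first by rewrite mulrA.
rewrite !dr_mul shmulDr shmulDl !shD !IH act_mul IH.
by rewrite addrA.
Qed.

Lemma dr_one i : dr i shone = 0. Proof. by []. Qed.
Lemma dl_one i : dl i shone = 0.
Proof. by apply/funext => w; rewrite /dl /shone -size_eq0 size_rcons. Qed.

Lemma dr_lt i j : dr i (letter j) = (i == j)%:R *: shone.
Proof.
apply/funext => w; rewrite /dr /letter shZ /shone eqseq_cons.
by case: eqP; rewrite ?mul1r ?mul0r.
Qed.

Lemma dl_lt i j : dl i (letter j) = (i == j)%:R *: shone.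
Proof.
apply/funext => w; rewrite /dl /letter shZ /shone -[[:: j]]/(rcons [::] j).
by rewrite eqseq_rcons; do 2!case: eqP; rewrite ?mul1r ?mul0r.
Qed.

Lemma act_one h : shact h shone = shone.
Proof. by apply/funext => -[|j w] //=; rewrite big1 // => i _; rewrite act0 mulr0. Qed.

Lemma mul1sh F : shone ** F = F.
Proof.
apply/funext => w; elim: w F => [|j w IH] F /=; first by rewrite mul1r.
by rewrite IH dr_one mul0sh addr0.
Qed.

Lemma shmul1 F : F ** shone = F.
Proof.
apply/funext => w; elim: w F => [|j w IH] F /=; first by rewrite mulr1.
by rewrite dr_one shmul0 act_one IH add0r.
Qed.

Lemma act_lt h i : shact h (letter i) = \sum_j co h i j *: letter j.
Proof.
apply/funext => -[|k w]; rewrite fct_sumE /=.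
  by rewrite big1 // => j _; rewrite shZ mulr0.
rewrite (eq_bigr (fun j => (j == i)%:R *: (co h j k * shone w : K^o))) => [|j _].
  rewrite sum_delta (eq_bigr (fun j => (k == j)%:R *: (co h i j * shone w : K^o))).
    by rewrite sum_deltaV.
  move=> j _; rewrite shZ -[letter j (k :: w)]/(dr k (letter j) w) dr_lt.
  by rewrite shZ mulrCA.
by rewrite dr_lt actZ act_one shZ mulrCA.
Qed.

Lemma dl_act j h F : dl j (shact h F) = \sum_i co h i j *: shact h (dl i F).
Proof.
apply/funext => w; elim: w F => [|k w IH] F; rewrite fct_sumE //.
rewrite /dl /=; under eq_bigr do rewrite -[shact h _ (rcons w j)]/(dl j (shact h _) w) IH.
rewrite [RHS](eq_bigr (fun i => \sum_l co h i j * (co h l k * shact h (dr l (dl i F)) w))).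
  rewrite exchange_big; apply: eq_bigr => l _; rewrite fct_sumE mulr_sumr.
  by apply: eq_bigr => i _; rewrite shZ mulrCA.
by move=> i _; rewrite shZ mulr_sumr.
Qed.

Fixpoint wd w : gT := if w is i :: w' then (wd w' * dg i)%g else 1%g.

Lemma wd_cat w v : wd (w ++ v) = (wd v * wd w)%g.
Proof. by elim: w => [|i w IH] /=; rewrite ?mulg1 // IH mulgA. Qed.

Lemma wd_rcons w i : wd (rcons w i) = (dg i * wd w)%g.
Proof. by rewrite -cats1 wd_cat /= mul1g. Qed.

Definition homdeg g F : Prop := forall w, F w != 0 -> wd w = g.

Lemma homG_lsub g : lsub (homdeg g).
Proof.
split=> [w|a x y hx hy w]; first by rewrite eqxx.
rewrite shL.
have [x0|/hx //] := eqVneq (x w) 0; have [y0|/hy //] := eqVneq (y w) 0.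
by rewrite x0 y0 mulr0 addr0 eqxx.
Qed.

Lemma homG_dr g i F : homdeg g F -> homdeg (g * (dg i)^-1)%g (dr i F).
Proof. by move=> hF w /hF <-; rewrite /= mulgK. Qed.

Lemma homG_dl g i F : homdeg g F -> homdeg ((dg i)^-1 * g)%g (dl i F).
Proof. by move=> hF w /hF <-; rewrite wd_rcons mulKg. Qed.

Lemma sum_neq0 (J : finType) (p : pred J) (G : J -> K^o) :
  \sum_(j | p j) G j != 0 -> exists2 j, p j & G j != 0.
Proof.
move=> nz; have /existsP[j /andP[pj Gj]] : [exists j, p j && (G j != 0)].
  apply: contraNT nz; rewrite negb_exists => /forallP G0; apply/eqP/big1 => j pj.
  by apply/eqP; have := G0 j; rewrite pj negbK.
by exists j.
Qed.

Lemma homG_act g h F : homdeg g F -> homdeg (h * g * h^-1)%g (shact h F).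
Proof.
move=> hF w; elim: w g F hF => [|j w IH] g F hF /=.
  by move=> /hF <-; rewrite /= mulg1 mulgV.
case/sum_neq0 => i _; rewrite mulf_eq0 negb_or => /andP[cij].
by move/(IH _ _ (homG_dr hF)) ->; rewrite (coD cij) !mulgA !mulgKV.
Qed.

Lemma homG_mul g h F H : homdeg g F -> homdeg h H -> homdeg (g * h)%g (F ** H).
Proof.
move=> hF hH w; elim: w g h F H hF hH => [|j w IH] g h F H hF hH /=.
  by rewrite mulf_eq0 negb_or => /andP[/hF <- /hH <-]; rewrite mulg1.
have [->|nz _] := eqVneq ((F ** dr j H) w) 0.
  rewrite add0r => /(IH _ _ _ _ (homG_dr hF) (homG_act hH)) ->.
  by rewrite !mulgA !mulgKV.
by rewrite (IH _ _ _ _ hF (homG_dr hH) nz) mulgA mulgKV.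
Qed.

Lemma homG_one : homdeg 1%g shone.
Proof. by move=> w; rewrite /shone; case: (w =P [::]) => [->|] //; rewrite eqxx. Qed.

Lemma homG_lt i : homdeg (dg i) (letter i).
Proof. by move=> w; rewrite /letter; case: (w =P [:: i]) => [->|]; rewrite ?eqxx //= mul1g. Qed.

(** The first tensor factor of a product comes from [F], or from [H] after being moved past all of
    [F], in which case the degree of [F] acts on it. *)
Lemma dl_mul g i F H : homdeg g F ->
  dl i (F ** H) = dl i F ** H + \sum_k co g k i *: (F ** dl k H).
Proof.
move=> hF; apply/funext => w; elim: w g F H hF => [|j w IH] g F H hF.
  rewrite /dl /= addrC fct_sumE; congr (_ + _).
  have [F0|/hF /= <-] := eqVneq (F [::]) 0.
    by rewrite F0 mul0r big1 // => k _; rewrite shZ /= F0 mul0r mulr0.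
  rewrite (eq_bigr (fun k => (k == i)%:R *: (F [::] * H [:: k] : K^o))) ?sum_delta //.
  by move=> k _; rewrite co1.
transitivity (dl i (F ** dr j H) w + dl i (dr j F ** shact (dg j) H) w); first by [].
rewrite (IH _ _ _ hF) (IH _ _ _ (homG_dr hF)) !shD !fct_sumE.
rewrite addrACA; congr (_ + _).
rewrite [RHS](eq_bigr (fun k => co g k i * (F ** dr j (dl k H)) w
   + co g k i * (dr j F ** shact (dg j) (dl k H)) w)); last first.
  by move=> k _; rewrite -mulrDr.
rewrite big_split; congr (_ + _).
rewrite [LHS](eq_bigr (fun k => \sum_l co (g * (dg j)^-1)%g k i *
    (co (dg j) l k * (dr j F ** shact (dg j) (dl l H)) w))) => [|k _].
  rewrite exchange_big; apply: eq_bigr => l _ /=.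
  rewrite -[g in RHS](mulgKV (dg j)) coM mulr_suml; apply: eq_bigr => k _.
  by rewrite mulrA (mulrC (co _ k i)).
rewrite shZ dl_act shmul_sumr fct_sumE mulr_sumr; apply: eq_bigr => l _.
by rewrite shmulZr.
Qed.

End Shuffle.

(** * The Nichols algebra, braided commutators and the kernel of the derivatives along C *)

Section Nilpotent.

Context {K : fieldType} {gT : finGroupType} {I : finType} (N : ydData K gT I).

Local Notation Sh := (seq I -> K^o).
Local Notation dg := (dg N).
Local Notation co := (co N).
Local Notation col := (col N).
Local Notation act := (shact N).
Local Notation wd := (wd N).
Local Notation homG := (homdeg N).
Local Notation one := (@shone K I).
Local Notation lt := (@letter K I).
Local Notation "x ** y" := (mul N x y) (at level 40, left associativity).
Implicit Types (F H x y z : Sh) (w v : seq I) (i j k c : I) (g h : gT).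

Definition countA w := count (predC col) w.
Definition countC w := count col w.

Lemma size_cAC w : size w = (countA w + countC w)%N.
Proof. by rewrite addnC count_predC. Qed.

Lemma cA_map w v : map col w = map col v -> countA w = countA v.
Proof. by move=> e; have := count_map col negb w; rewrite e count_map. Qed.

Lemma cC_map w v : map col w = map col v -> countC w = countC v.
Proof. by move=> e; have := count_map col id w; rewrite e count_map. Qed.

Lemma act_supp h F w : act h F w != 0 -> exists2 v, F v != 0 & map col v = map col w.
Proof.
elim: w F => [|j w IH] F /=; first by exists [::].
case/sum_neq0 => i _; rewrite mulf_eq0 negb_or => /andP[cij /IH[v Fv vw]].
by exists (i :: v) => //=; rewrite (coC cij) vw.
Qed.

Lemma add_neq0 (a b : K^o) : a + b != 0 -> a != 0 \/ b != 0.
Proof.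
have [-> nz|] := eqVneq a 0; last by left.
by right; rewrite add0r in nz.
Qed.

Lemma span_nz (X : Sh -> Prop) F w :
  linspan X F -> F w != 0 -> exists2 H, X H & H w != 0.
Proof.
elim=> [|a H x XH _ IH]; first by rewrite eqxx.
rewrite shL => /add_neq0[|/IH //].
by rewrite mulf_eq0 negb_or => /andP[_ nz]; exists H.
Qed.

Lemma mul_supp F H w : (F ** H) w != 0 -> exists u v,
  [/\ F u != 0, H v != 0, countA w = (countA u + countA v)%N & countC w = (countC u + countC v)%N].
Proof.
elim: w F H => [|j w IH] F H /=.
  by rewrite mulf_eq0 negb_or => /andP[? ?]; exists [::], [::].
case/add_neq0 => /IH[u [v [Fu Hv eA eC]]].
  by exists u, (j :: v); split=> //; rewrite /countA /countC /= -/(countA _) -/(countC _) (eA, eC) addnCA.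
have [v' Hv' ev] := act_supp Hv.
exists (j :: u), v'; rewrite (cA_map ev) (cC_map ev).
by split=> //; rewrite /countA /countC /= -/(countA _) -/(countC _) (eA, eC) addnA.
Qed.

Fixpoint monom v : Sh := if v is i :: v' then lt i ** monom v' else one.

Lemma mono_cat u v : monom (u ++ v) = monom u ** monom v.
Proof. by elim: u => [|i u IH] /=; rewrite ?mul1sh // IH shmulA. Qed.

Lemma mono_rcons u i : monom (rcons u i) = monom u ** lt i.
Proof. by rewrite -cats1 mono_cat /= shmul1. Qed.

Lemma lt_supp i w : lt i w != 0 -> w = [:: i].
Proof. by rewrite /lt; case: (w =P [:: i]) => //; rewrite eqxx. Qed.

Lemma one_supp w : one w != 0 -> w = [::].
Proof. by rewrite /one; case: (w =P [::]) => //; rewrite eqxx. Qed.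

Lemma mono_supp v w : monom v w != 0 -> countA w = countA v /\ countC w = countC v.
Proof.
elim: v w => [|i v IH] w /=; first by move/one_supp ->.
case/mul_supp => _ [u [/lt_supp -> /IH[eA eC] -> ->]].
by rewrite eA eC /countA /countC /= !addn0.
Qed.

Lemma mono_homG v : homG (foldr (fun i g => dg i * g)%g 1%g v) (monom v).
Proof. by elim: v => [|i v IH] /=; [apply: homG_one|apply/homG_mul/IH/homG_lt]. Qed.

Definition nicholsB : Sh -> Prop := linspan (fun x => exists v, x = monom v).

Definition nil_at (L : nat) : Prop := forall v, (L <= size v)%N -> monom v = 0.

Lemma inB_lsub : lsub nicholsB. Proof. exact: span_lsub. Qed.
Lemma inB_mono v : nicholsB (monom v). Proof. by apply: span_gen; exists v. Qed.
Lemma inB_one : nicholsB one. Proof. exact: (inB_mono [::]). Qed.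
Lemma inB_lt i : nicholsB (lt i). Proof. by rewrite -[lt i](shmul1 N); apply: (inB_mono [:: i]). Qed.

Lemma inB_mul x y : nicholsB x -> nicholsB y -> nicholsB (x ** y).
Proof.
move=> Bx By; apply: (@span_sub _ _ _ (fun x => nicholsB (x ** y)) _ _ _ Bx).
  exact: (lsub_preim (mulr_of N y) inB_lsub).
move=> _ [u ->]; apply: (@span_sub _ _ _ (fun y => nicholsB (monom u ** y)) _ _ _ By).
  exact: (lsub_preim (mul N (monom u)) inB_lsub).
by move=> _ [v ->]; rewrite -mono_cat; apply: inB_mono.
Qed.

Lemma inB_act h x : nicholsB x -> nicholsB (act h x).
Proof.
move=> Bx; pattern x; apply: span_sub Bx => [|_ [v ->]]; first exact: (lsub_preim (act h) inB_lsub).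
elim: v => [|i v IH] /=; first by rewrite act_one; apply: inB_one.
rewrite act_mul act_lt; apply: inB_mul => //; apply: lsub_sum inB_lsub _ => j _.
by apply: lsubZ inB_lsub _; apply: inB_lt.
Qed.

Fact dr_linear i : linear (@dr K I i). Proof. by []. Qed.
HB.instance Definition _ i := GRing.isLinear.Build K Sh Sh *:%R (@dr K I i) (dr_linear i).
Fact dl_linear i : linear (@dl K I i). Proof. by []. Qed.
HB.instance Definition _ i := GRing.isLinear.Build K Sh Sh *:%R (@dl K I i) (dl_linear i).

Lemma inB_dr i x : nicholsB x -> nicholsB (dr i x).
Proof.
move=> Bx; pattern x; apply: span_sub Bx => [|_ [v ->]]; first exact: (lsub_preim (dr i) inB_lsub).
elim: v => [|j v IH] /=; first exact: inB_lsub.1.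
rewrite dr_mul dr_lt shmulZl mul1sh; apply: lsubD inB_lsub _ _.
  exact/inB_mul/IH/inB_lt.
by apply: lsubZ inB_lsub _; apply/inB_act/inB_mono.
Qed.

Lemma inB_dl i x : nicholsB x -> nicholsB (dl i x).
Proof.
move=> Bx; pattern x; apply: span_sub Bx => [|_ [v ->]]; first exact: (lsub_preim (dl i) inB_lsub).
elim: v => [|j v IH] /= in i *; first by rewrite dl_one; exact: inB_lsub.1.
rewrite (dl_mul _ _ (@homG_lt _ _ _ N j)) dl_lt shmulZl mul1sh; apply: lsubD inB_lsub _ _.
  by apply: lsubZ inB_lsub _; apply: inB_mono.
apply: lsub_sum inB_lsub _ => k _; by apply: lsubZ inB_lsub _; apply: inB_mul (IH _); apply: inB_lt.
Qed.

Definition drw w F : Sh := fun w' => F (w ++ w').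
Definition dlw w F : Sh := fun w' => F (w' ++ w).

Lemma inB_drw w x : nicholsB x -> nicholsB (drw w x).
Proof. by elim: w x => //= i w IH x Bx; apply: (IH (dr i x)); apply: inB_dr. Qed.

Lemma inB_supp L x w : nil_at L -> nicholsB x -> x w != 0 -> (size w < L)%N.
Proof.
move=> nL Bx; apply: contraNT; rewrite -leqNgt => Lw; apply/eqP.
elim: Bx => // a _ y [v ->] _ IH; rewrite shL IH addr0.
have [->|/mono_supp[eA eC]] := eqVneq (monom v w) 0; first exact: mulr0.
by rewrite nL ?mulr0 // size_cAC -eA -eC -size_cAC.
Qed.

Definition ty w := (wd w, countA w, countC w).
Definition restr t F : Sh := fun w => if ty w == t then F w else 0.

Fact res_linear t : linear (restr t).
Proof. by move=> a x y; apply/funext => w; rewrite shL /restr; case: eqP; rewrite ?mulr0 ?addr0. Qed.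
HB.instance Definition _ t := GRing.isLinear.Build K Sh Sh *:%R (restr t) (res_linear t).

Lemma res_supp t F w : restr t F w != 0 -> F w != 0 /\ ty w = t.
Proof. by rewrite /restr; case: (ty w =P t) => //; rewrite eqxx. Qed.

Lemma inB_res t x : nicholsB x -> nicholsB (restr t x).
Proof.
move=> Bx; pattern x; apply: span_sub Bx => [|_ [v ->]]; first exact: (lsub_preim (restr t) inB_lsub).
have [e|ne] := eqVneq (foldr (fun i g => dg i * g)%g 1%g v, countA v, countC v) t.
  have -> : restr t (monom v) = monom v; last exact: inB_mono.
  apply/funext => w; rewrite /restr; case: eqP => // ne; apply/eqP.
  rewrite eq_sym; apply: contra_notT ne => nz; rewrite -e /ty.
  by have [-> ->] := mono_supp nz; rewrite (mono_homG nz).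
have -> : restr t (monom v) = 0; last exact: inB_lsub.1.
apply/funext => w; rewrite /restr; case: eqP => // e; apply/eqP.
apply: contraNT ne => nz; rewrite -e /ty.
by have [-> ->] := mono_supp nz; rewrite (mono_homG nz).
Qed.

(** The commutator for the inverse braiding, which sends [x (x) c] to [c (x) (dg c)^-1 . x]. With
    this choice the right derivatives along C of the two terms cancel when [x] is killed along C,
    see [kC_Rc]. *)
Definition adC c x : Sh := x ** lt c - lt c ** act (dg c)^-1 x.

Fact Rc_linear c : linear (adC c).
Proof.
move=> a x y; rewrite /adC shmulDl shmulZl actD actZ shmulDr shmulZr.
by rewrite scalerBr opprD addrACA.
Qed.
HB.instance Definition _ c := GRing.isLinear.Build K Sh Sh *:%R (adC c) (Rc_linear c).

Lemma RcD c x y : adC c (x + y) = adC c x + adC c y. Proof. exact: linearD. Qed.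

(** This is the Leibniz rule [dr_mul] with [(dg c)^-1] in place of [dg c]: [adC c] behaves like a
    right derivative along a letter of degree [(dg c)^-1]. Here the dual C^* of the reflected pair
    originates. *)
Lemma Rc_mul c x y : adC c (x ** y) = x ** adC c y + adC c x ** act (dg c)^-1 y.
Proof.
by rewrite /adC shmulBr shmulBl act_mul !shmulA addrA subrK.
Qed.

Lemma Rc_act h c x : act h (adC c x) = \sum_j co h c j *: adC j (act h x).
Proof.
rewrite /adC actB !act_mul act_lt shmul_sumr shmul_suml -sumrB.
apply: eq_bigr => j _; rewrite shmulZr shmulZl -scalerBr.
have [->|/coD dj] := eqVneq (co h c j) 0; first by rewrite !scale0r.
by rewrite -!actM dj !invMg invgK mulgA mulgKV.
Qed.

Lemma Rc_one c : adC c one = 0.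
Proof. by rewrite /adC act_one mul1sh shmul1 subrr. Qed.

(** Left derivatives and commutators commute up to terms without derivatives, as in a Drinfeld
    double. [orb_Rc] uses this for stability, and [Phi_dl] turns it into commutators with letters of
    C^*. *)
Lemma dl_Rc g i c x : homG g x ->
  dl i (adC c x) = adC c (dl i x) + co g c i *: x - (i == c)%:R *: act (dg c)^-1 x.
Proof.
move=> hx; rewrite /adC linearB /= (dl_mul _ _ hx) (dl_mul _ _ (@homG_lt _ _ _ N c)).
rewrite dl_lt shmulZl mul1sh.
rewrite (eq_bigr (fun k => (k == c)%:R *: (co g k i *: x))) => [|k _]; last first.
  rewrite dl_lt eq_sym shmulZr shmul1 !scalerA mulrC eq_sym.
  by rewrite eq_sym [c == k]eq_sym.
rewrite sum_delta (eq_bigr (fun k => \sum_l (co (dg c)^-1 l k * co (dg c) k i) *: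
    (lt c ** act (dg c)^-1 (dl l x)))) => [|k _]; last first.
  rewrite dl_act shmul_sumr scaler_sumr; apply: eq_bigr => l _.
  by rewrite shmulZr scalerA mulrC.
rewrite exchange_big (eq_bigr (fun l => (l == i)%:R *: (lt c ** act (dg c)^-1 (dl l x)))).
  by rewrite sum_delta opprD [- _ - _]addrC addrA; congr (_ - _); rewrite addrAC.
by move=> l _; rewrite -scaler_suml coKV.
Qed.

Definition kC x : Prop := forall c, col c -> dr c x = 0.

Lemma kC_lsub : lsub kC.
Proof.
split=> [c _ //|a x y kx ky c /[dup] /kx ex /ky ey].
by rewrite linearP /= ex ey scaler0 addr0.
Qed.

Lemma kC_act h x : kC x -> kC (act h x).
Proof.
move=> kx c Cc; rewrite dr_act big1 // => i _.
have [->|/coC ci] := eqVneq (co h i c) 0; first exact: scale0r.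
by rewrite kx ?act0 ?scaler0 // ci.
Qed.

Lemma kC_mul x y : kC x -> kC y -> kC (x ** y).
Proof.
by move=> kx ky c Cc; rewrite dr_mul kx // ky // mul0sh shmul0 addr0.
Qed.

Lemma kC_Rc c x : kC x -> kC (adC c x).
Proof.
move=> kx j Cj; rewrite /adC linearB /= !dr_mul kx // (kC_act _ kx) // !dr_lt.
rewrite mul0sh shmul0 addr0 add0r shmulZr shmul1 shmulZl mul1sh.
by have [->|_] := eqVneq j c; rewrite ?actVK ?scale0r subrr.
Qed.

Lemma kC_dl i x : kC x -> kC (dl i x).
Proof.
move=> kx c Cc; have := kx c Cc; rewrite /dr /dl => e.
by apply/funext => w; rewrite -[RHS](congr1 (fun F => F (rcons w i)) e).
Qed.

Lemma kC_res t x : kC x -> kC (restr t x).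
Proof.
move=> kx c Cc; apply/funext => w; rewrite /dr /restr; case: eqP => // _.
exact: (congr1 (fun F => F w) (kx c Cc)).
Qed.

Lemma kC_lt i : ~~ col i -> kC (lt i).
Proof.
by move=> Ai c Cc; rewrite dr_lt; have [e|_] := eqVneq c i; [rewrite -e Cc in Ai|exact: scale0r].
Qed.

Definition inK x : Prop := nicholsB x /\ kC x.

Lemma inK_lsub : lsub inK. Proof. exact: lsub_and inB_lsub kC_lsub. Qed.
Lemma inK_one : inK one. Proof. by split=> // ; exact: inB_one. Qed.
Lemma inK_mul x y : inK x -> inK y -> inK (x ** y).
Proof. by move=> [? ?] [? ?]; split; [apply: inB_mul|apply: kC_mul]. Qed.
Lemma inK_act h x : inK x -> inK (act h x).
Proof. by move=> [? ?]; split; [apply: inB_act|apply: kC_act]. Qed.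
Lemma inK_Rc c x : inK x -> inK (adC c x).
Proof.
move=> [Bx kx]; split; last exact: kC_Rc.
by apply: lsubB inB_lsub _ _; apply: inB_mul; rewrite ?inB_lt //; [apply: inB_lt|apply: inB_lt|apply: inB_act].
Qed.
Lemma inK_dl i x : inK x -> inK (dl i x).
Proof. by move=> [? ?]; split; [apply: inB_dl|apply: kC_dl]. Qed.
Lemma inK_res t x : inK x -> inK (restr t x).
Proof. by move=> [? ?]; split; [apply: inB_res|apply: kC_res]. Qed.
Lemma inK_lt i : ~~ col i -> inK (lt i).
Proof. by move=> ?; split; [apply: inB_lt|apply: kC_lt]. Qed.

Lemma inK_dlw w x : inK x -> inK (dlw w x).
Proof.
elim/last_ind: w x => [|w i IH] x Kx; first by rewrite /dlw; have -> : (fun w' => x (w' ++ [::])) = x by apply/funext => w; rewrite cats0.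
have -> : dlw (rcons w i) x = dlw w (dl i x); last exact/IH/inK_dl.
by apply/funext => w'; rewrite /dlw /dl rcons_cat.
Qed.

End Nilpotent.

(** * The subalgebra of coinvariants *)

Section Coinvariants.

Context {K : fieldType} {gT : finGroupType} {I : finType} (N : ydData K gT I).

Local Notation Sh := (seq I -> K^o).
Local Notation dg := (dg N).
Local Notation co := (co N).
Local Notation col := (col N).
Local Notation act := (shact N).
Local Notation cA := (countA N).
Local Notation cC := (countC N).
Local Notation mono := (monom N).
Local Notation inB := (nicholsB N).
Local Notation inK := (inK N).
Local Notation kC := (kC N).
Local Notation Rc := (adC N).
Local Notation res := (restr N).
Local Notation one := (@shone K I).
Local Notation lt := (@letter K I).
Local Notation "x ** y" := (mul N x y) (at level 40, left associativity).
Implicit Types (F H x y z : Sh) (w v : seq I) (i j c : I) (g h : gT).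

(* Equivalent to irreducibility of the submodule of colour [b]: no nonzero
   functional vanishes on the submodule generated by a nonzero vector;
   in this form it obviously passes to the dual module. *)
Definition irr (b : bool) : Prop := forall u f : I -> K,
  (forall i, u i != 0 -> col i = b) -> (forall i, f i != 0 -> col i = b) ->
  (exists i, u i != 0) -> (exists i, f i != 0) ->
  exists h s, \sum_i \sum_j (if dg i == s then u i else 0) * co h i j * f j != 0.

(* This turns out to be all of [inK], see [inK_Kh]. *)
Inductive Kh : Sh -> Prop :=
| Kh0 : Kh 0
| Kh1 : Kh one
| KhL a x y : Kh x -> Kh y -> Kh (a *: x + y)
| KhA i x : ~~ col i -> Kh x -> Kh (lt i ** x)
| KhR c x : col c -> Kh x -> Kh (Rc c x).

Lemma Kh_lsub : lsub Kh. Proof. by split; [apply: Kh0|apply: KhL]. Qed.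

Lemma Kh_inK x : Kh x -> inK x.
Proof.
elim=> [||a y z _ Ky _ Kz|i y Ai _ Ky|c y _ _ Ky].
- exact: (inK_lsub N).1.
- exact: inK_one.
- exact: (inK_lsub N).2.
- by apply: inK_mul => //; apply: inK_lt.
- exact: inK_Rc.
Qed.

Lemma Kh_act h x : Kh x -> Kh (act h x).
Proof.
elim=> [||a y z _ Ky _ Kz|i y Ai _ Ky|c y Cc _ Ky].
- by rewrite act0; apply: Kh0.
- by rewrite act_one; apply: Kh1.
- by rewrite actD actZ; apply: KhL.
- rewrite act_mul act_lt shmul_suml; apply: lsub_sum Kh_lsub _ => j _; rewrite shmulZl.
  have [->|/coC ij] := eqVneq (co h i j) 0; first by rewrite scale0r; apply: Kh0.
  by apply: lsubZ Kh_lsub _; apply: KhA Ky; rewrite -ij.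
- rewrite Rc_act; apply: lsub_sum Kh_lsub _ => j _.
  have [->|/coC ij] := eqVneq (co h c j) 0; first by rewrite scale0r; apply: Kh0.
  by apply: lsubZ Kh_lsub _; apply: KhR Ky; rewrite -ij.
Qed.

(** Letters of C move to the right by [c k = k' c - Rc c k'] with [k' = dg c . k], so the Nichols
    algebra is [Kh] times the monomials in C. *)
Lemma inB_Kh x : inB x ->
  linspan (fun z => exists k v, [/\ Kh k, all col v & z = k ** mono v]) x.
Proof.
set X := fun z => _; have sX := span_lsub X.
move=> Bx; pattern x; apply: span_sub Bx => // _ [v ->].
elim: v => [|i v IH] /=.
  by apply: span_gen; exists one, [::]; split; rewrite ?mul1sh //; apply: Kh1.
have lX : lsub (fun y => linspan X (lt i ** y)) by apply: (lsub_preim (mul N (lt i))).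
apply: (span_sub lX _ IH) => _ [k [u [Kk Cu ->]]]; rewrite shmulA.
have [Ci|Ai] := boolP (col i); last by apply: span_gen; exists (lt i ** k), u; split=> //; apply: KhA.
have -> : lt i ** k = act (dg i) k ** lt i - Rc i (act (dg i) k).
  by rewrite /adC actK opprB addrC subrK.
rewrite shmulBl -shmulA; apply: lsubB sX _ _; apply: span_gen.
  by exists (act (dg i) k), (i :: u); split; rewrite //= ?Ci //; apply: Kh_act.
by exists (Rc i (act (dg i) k)), u; split=> //; apply: KhR Ci _; apply: Kh_act.
Qed.

Lemma drw_mul k w x : kC k -> all col w -> drw w (k ** x) = k ** drw w x.
Proof.
move=> kk; elim: w x => [//|c w IH] x /= /andP[Cc Cw].
have -> : drw (c :: w) (k ** x) = drw w (dr c (k ** x)) by [].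
by rewrite dr_mul kk // mul0sh addr0 IH.
Qed.

Lemma mono_size v w : mono v w != 0 -> size w = size v.
Proof. by case/mono_supp => eA eC; rewrite (size_cAC N) eA eC -size_cAC. Qed.

Lemma drw_mono_lt v w : (size v < size w)%N -> drw w (mono v) = 0.
Proof.
move=> lt_vw; apply/funext => w'; apply/eqP; apply: contraLR lt_vw => /mono_size.
by rewrite size_cat -leqNgt => <-; apply: leq_addr.
Qed.

Lemma drw_mono_eq v w : size v = size w -> drw w (mono v) = mono v w *: one.
Proof.
move=> e; apply/funext => w'; rewrite shZ /shone; have [->|nz] := eqVneq w' [::].
  by rewrite /drw cats0 mulr1.
rewrite mulr0; apply/eqP; apply: contraNT nz => /mono_size.
by rewrite size_cat e -[RHS]addn0 => /addnI/size0nil ->.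
Qed.

Definition ind w : Sh := fun v => (v == w)%:R.

Fact drw_linear w : linear (@drw K I w). Proof. by []. Qed.
HB.instance Definition _ w := GRing.isLinear.Build K Sh Sh *:%R (@drw K I w) (drw_linear w).

Lemma mono_ind v : all col v ->
  mono v = \sum_(w : (size v).-tuple I | all col w) mono v w *: ind w.
Proof.
move=> Cv; apply/funext => u; rewrite fct_sumE.
have [u0|nz] := eqVneq (mono v u) 0.
  rewrite u0 big1 // => w _; rewrite shZ /ind; have [<-|_] := eqVneq u w; rewrite ?u0 ?mul0r //.
  exact: mulr0.
have su := mono_size nz; pose w := tcast su (in_tuple u).
have wu : tval w = u by rewrite val_tcast.
have Cu : all col u.
  have [/eqP eA _] := mono_supp nz; rewrite all_count.
  by rewrite (size_cAC N) -[X in X == _]add0n eqn_add2r eq_sym (eqP eA) /countA -leqn0 leqNgt -has_count -all_predC (eq_all (fun i => negbK _)).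
rewrite (bigD1 w) ?wu //= big1 ?addr0 => [|w' /andP[_ ne]].
  by rewrite shZ /ind ?wu eqxx mulr1.
rewrite shZ /ind; case: eqP => [e|_]; last exact: mulr0.
by case/eqP: ne; apply: val_inj; rewrite /= wu -e.
Qed.

(* The length [n] part of an element of [Kh ** linspan (mono v)] is recovered from
   its iterated derivatives along words of length [n]. *)
Lemma free_ind n x :
  linspan (fun z => exists k v, [/\ Kh k, all col v, size v = n & z = k ** mono v]) x ->
  x = \sum_(w : n.-tuple I | all col w) drw w x ** ind w.
Proof.
move=> Sx; pattern x; apply: span_sub Sx => [|_ [k [v [Kk Cv <- ->]]]].
  split=> [|a y z {1}-> {1}->].
    by rewrite big1 // => w _; rewrite linear0 mul0sh.
  rewrite scaler_sumr -big_split; apply: eq_bigr => w _ /=.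
  by rewrite linearP shmulDl shmulZl.
transitivity (k ** \sum_(w : (size v).-tuple I | all col w) mono v w *: ind w).
  by rewrite -mono_ind.
rewrite shmul_sumr; apply: eq_bigr => w Cw.
rewrite (drw_mul _ (Kh_inK Kk).2 Cw) drw_mono_eq ?size_tuple //.
by rewrite !shmulZr shmulZl shmul1.
Qed.

(** Derivatives along C-words of the maximal length see only the top part [y], and for positive
    length they vanish on [x]. By [free_ind] they determine [y], so [y = 0] and the length goes
    down. *)
Lemma kC_Kh n x :
  linspan (fun z => exists k v, [/\ Kh k, all col v, (size v < n)%N & z = k ** mono v]) x ->
  kC x -> Kh x.
Proof.
elim: n x => [|n IH] x Sx kx.
  by pattern x; apply: span_sub Sx => [|_ [k [v []]]//]; apply: Kh_lsub.
case: (span_split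
   (Y := fun z => exists k v, [/\ Kh k, all col v, size v = n & z = k ** mono v])
   (Z := fun z => exists k v, [/\ Kh k, all col v, (size v < n)%N & z = k ** mono v]) _ Sx).  move=> _ [k [v [Kk Cv sv ->]]]; move: sv; rewrite ltnS leq_eqVlt.
  by case/orP => [/eqP sv|sv]; [left|right]; exists k, v.
move=> y [z [xE Sy Sz]].
have [n0|n_gt0] := posnP n.
  have z0 : z = 0.
    pattern z; apply: span_sub Sz => [|? [k [v []]]]; last by rewrite n0.
    by split=> // a u t -> ->; rewrite scaler0 addr0.
  rewrite xE z0 addr0; pattern y; apply: span_sub Sy => [|? [k [v [Kk _ /eqP]]]].
    exact: Kh_lsub.
  by rewrite n0 => /nilP -> ->; rewrite shmul1.
suff y0 : y = 0 by apply: IH => //; move: Sz; rewrite xE y0 add0r.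
rewrite (free_ind Sy) big1 // => w Cw.
have -> : drw w y = drw w x - drw w z by rewrite xE linearD addrK.
have -> : drw w z = 0.
  pattern z; apply: span_sub Sz => [|_ [k [v [Kk Cv sv ->]]]].
    by split=> [|a u t eu et]; rewrite ?linear0 // linearP /= eu et scaler0 addr0.
  by rewrite (drw_mul _ (Kh_inK Kk).2 Cw) drw_mono_lt ?shmul0 // size_tuple.
have -> : drw w x = 0; last by rewrite subr0 mul0sh.
move: w Cw; rewrite -(prednK n_gt0) => w; rewrite (tuple_eta w) /= => /andP[Cc _].
by apply/funext => w'; apply: (congr1 (fun F => F (_ ++ w')) (kx _ Cc)).
Qed.

Lemma inK_Kh x : inK x -> Kh x.
Proof.
move=> [/inB_Kh Sx kx].
suff [n Sn] : exists n, linspan (fun z => exists k v,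
    [/\ Kh k, all col v, (size v < n)%N & z = k ** mono v]) x by apply: kC_Kh Sn kx.
elim: Sx => [|a _ t [k [v [Kk Cv ->]]] _ [n Sn]]; first by exists 0; apply: span0.
exists (maxn n (size v).+1); apply: (span_lsub _).2.
  by apply: span_gen; exists k, v; rewrite leq_maxr.
pattern t; apply: span_sub Sn => [|_ [k' [v' [Kk' Cv' lt_v' ->]]]]; first exact: span_lsub.
by apply: span_gen; exists k', v'; rewrite leq_max lt_v'.
Qed.

Lemma kC_deg0 x : kC x -> (forall w, x w != 0 -> cA w = 0%N) -> x = x [::] *: one.
Proof.
move=> kx x0; apply/funext => -[|i w]; rewrite shZ /shone; first by rewrite mulr1.
rewrite mulr0; have [Ci|Ai] := boolP (col i); first exact: (congr1 (fun F => F w) (kx i Ci)).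
by apply/eqP; apply: contraTT isT => /x0; rewrite /countA /= Ai.
Qed.

Definition pA n F : Sh := fun w => if cA w == n then F w else 0.

Lemma pA_supp n F w : pA n F w != 0 -> F w != 0 /\ cA w = n.
Proof. by rewrite /pA; case: (cA w =P n) => //; rewrite eqxx. Qed.

Lemma pA_id n x : (forall w, x w != 0 -> cA w = n) -> pA n x = x.
Proof.
move=> xn; apply/funext => w; rewrite /pA; case: (cA w =P n) => // ne.
by apply/esym/eqP; apply: contra_notT ne => /xn.
Qed.

Lemma pA_eq n x y z : x = y + z -> (forall w, y w != 0 -> cA w = n) ->
  (forall w, z w != 0 -> cA w != n) -> pA n x = y.
Proof.
move=> -> yn zn; apply/funext => w; rewrite /pA; case: (cA w =P n) => [e|ne].
  rewrite shD; have [->|/zn] := eqVneq (z w) 0; first by rewrite addr0.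
  by rewrite e eqxx.
by apply/esym/eqP; apply: contra_notT ne => /yn.
Qed.

Lemma pA_split n x : x = pA n x + (x - pA n x). Proof. by rewrite addrC subrK. Qed.

Lemma pAC_supp n x w : (x - pA n x) w != 0 -> x w != 0 /\ cA w != n.
Proof.
rewrite shD shN /pA; case: (cA w =P n) => [_|]; first by rewrite subrr eqxx.
by rewrite oppr0 addr0.
Qed.

Lemma pA_lt n a x : ~~ col a -> pA n.+1 (lt a ** x) = lt a ** pA n x.
Proof.
move=> Aa; have c1 : cA [:: a] = 1%N by rewrite /countA /= Aa.
apply: (@pA_eq _ _ _ (lt a ** (x - pA n x))) => [|w|w].
- by rewrite -shmulDr -pA_split.
- by case/mul_supp => _ [v [/lt_supp -> /pA_supp[_ vn] -> _]]; rewrite c1 vn.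
- by case/mul_supp => _ [v [/lt_supp -> /pAC_supp[_ vn] -> _]]; rewrite c1.
Qed.

Lemma Rc_supp c x w : Rc c x w != 0 -> exists v,
  [/\ x v != 0, cA w = (cA v + cA [:: c])%N & cC w = (cC v + cC [:: c])%N].
Proof.
rewrite /adC shD shN => /add_neq0[|].
  by case/mul_supp => v [u [xv /lt_supp -> eA eC]]; exists v.
rewrite oppr_eq0 => /mul_supp[u [v [/lt_supp -> /act_supp[v' xv' e] eA eC]]].
by exists v'; rewrite xv' eA eC (cA_map e) (cC_map e); split; rewrite // addnC.
Qed.

Lemma pA_Rc n c x : col c -> pA n (Rc c x) = Rc c (pA n x).
Proof.
move=> Cc; have c0 : cA [:: c] = 0%N by rewrite /countA /= Cc.
apply: (@pA_eq _ _ _ (Rc c (x - pA n x))) => [|w|w].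
- by rewrite -RcD -pA_split.
- by case/Rc_supp => v [/pA_supp[_ vn] -> _]; rewrite c0 addn0.
- by case/Rc_supp => v [/pAC_supp[_ vn] -> _]; rewrite c0 addn0.
Qed.

Lemma kC_pA n x : kC x -> kC (pA n x).
Proof.
move=> kx c Cc; apply/funext => w; rewrite /dr /pA; case: eqP => // _.
exact: (congr1 (fun F => F w) (kx c Cc)).
Qed.

Definition deg1 x : Prop := forall w, x w != 0 -> cA w = 1%N.

(** [dl i x] is again killed along C and has degree 0 in A, hence is a multiple of 1. *)
Lemma dl_deg1 i x w : kC x -> deg1 x -> ~~ col i -> dl i x w != 0 -> w = [::].
Proof.
move=> kx d1 Ai nz; have kd := kC_dl i kx.
suff d0 v : dl i x v != 0 -> cA v = 0%N.
  by move: nz; rewrite (kC_deg0 kd d0) shZ mulf_eq0 negb_or => /andP[_ /one_supp].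
by move/d1; rewrite /countA -cats1 count_cat /= Ai addn1 => -[].
Qed.

(** * Simplicity of the part of K of degree 1 in A *)

Section Generation.

Hypothesis irrA : irr false.
Variable T : Sh -> Prop.
Hypotheses (sT : lsub T) (TK : forall x, T x -> inK x /\ deg1 x).
Hypothesis TR : forall c x, col c -> T x -> T (Rc c x).
Hypothesis Tact : forall h x, T x -> T (act h x).

Lemma letters_K1 : (forall a, ~~ col a -> T (lt a)) ->
  forall x, inK x -> deg1 x -> T x.
Proof.
move=> Ta x Kx d1; rewrite -(pA_id d1); elim: {x Kx d1}(inK_Kh Kx) => [||a y z _ Ty _ Tz|i y Ai Ky _|c y Cc _ Ty].
- have -> : pA 1 0 = 0 by apply/funext => w; rewrite /pA; case: ifP.
  exact: sT.1.
- have -> : pA 1 one = 0; last exact: sT.1.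
  apply/funext => w; rewrite /pA; case: eqP => // e; apply/eqP.
  by apply: contraTT isT => /one_supp w0; rewrite w0 in e.
- have -> : pA 1 (a *: y + z) = a *: pA 1 y + pA 1 z; last exact: sT.2.
  by apply/funext => w; rewrite shL /pA; case: eqP; rewrite ?mulr0 ?addr0.
- rewrite pA_lt // (kC_deg0 (kC_pA 0 (Kh_inK Ky).2)) => [|w /pA_supp[]//].
  by rewrite shmulZr shmul1; apply: lsubZ sT _; apply: Ta.
- by rewrite pA_Rc //; apply: TR.
Qed.

Hypothesis Tdl : forall c x, col c -> T x -> T (dl c x).
Hypothesis Tres : forall t x, T x -> T (res t x).
Hypothesis Tnz : exists2 x, T x & x <> 0.

(** Left derivatives along C shorten a word of the support from the end of the list; once a letter
    of A is met there, [dl_deg1] leaves nothing before it. *)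
Lemma exists_letter : exists2 x, T x & exists2 a, ~~ col a & x [:: a] != 0.
Proof.
have [x Tx nz] := Tnz.
have [w xw] : exists w, x w != 0.
  apply: contrapT => x0; apply: nz; apply/funext => w; apply/eqP.
  by apply: contra_notT x0 => xw; exists w.
move: x Tx {nz} xw; elim/last_ind: w => [|w i IH] x Tx xw.
  by have := (TK Tx).2 _ xw.
have [Ci|Ai] := boolP (col i); first by apply: IH (Tdl Ci Tx) xw.
have [[_ kx] d1] := TK Tx; exists x => //; exists i => //.
by move: (xw); rewrite (dl_deg1 kx d1 Ai xw).
Qed.

(** The grading isolates the linear part of the element from [exists_letter], and irreducibility of
    A spreads it over all letters of A. *)
Lemma T_letters a : ~~ col a -> T (lt a).
Proof.
have [x Tx [b Ab xb]] := exists_letter.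
pose u i : K := if col i then 0 else x [:: i].
pose P (k : I -> K^o) := T (\sum_(i | ~~ col i) k i *: lt i).
have sP : lsub P.
  split=> [|r y z Py Pz]; rewrite /P.
    by rewrite big1 => [|i _]; [apply: sT.1|apply: scale0r].
  rewrite (_ : \sum_(i | _) _ = r *: (\sum_(i | ~~ col i) y i *: lt i)
    + \sum_(i | ~~ col i) z i *: lt i); first exact: sT.2.
  by rewrite scaler_sumr -big_split; apply: eq_bigr => i _; rewrite /= scalerA -scalerDl.
suff Pall k : P k.
  move=> Aa; have := Pall (fun i => (i == a)%:R); rewrite /P (bigD1 a) //= eqxx scale1r.
  by rewrite big1 ?addr0 // => i /andP[_ /negPf ->]; apply: scale0r.
apply: (lsub_full sP) => {}k annk e; apply/eqP; have [Ce|Ae] := boolP (col e).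
  have /annk : P (fun i => (i == e)%:R).
    rewrite /P big1 => [|i Ai]; first exact: sT.1.
    by have [ie|_] := eqVneq i e; [rewrite ie Ce in Ai|apply: scale0r].
  rewrite (bigD1 e) //= eqxx mul1r big1 ?addr0 => [->//|i /negPf ->].
  by rewrite mul0r.
apply: contraTT isT => ke; pose f i := if col i then 0 else k i.
have [i|i|||h [s /eqP[]]] := irrA (u := u) (f := f).
- by rewrite /u; case: ifP; rewrite ?eqxx.
- by rewrite /f; case: ifP; rewrite ?eqxx.
- by exists b; rewrite /u (negPf Ab).
- by exists e; rewrite /f (negPf Ae).
(* The coefficients of [h . x_s], where [x_s] is the part of [x] consisting of letters of A of
   degree [s]. *)
pose kk j : K^o := \sum_i (if dg i == s then u i else 0) * co h i j.
have kkC j : col j -> kk j = 0.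
  move=> Cj; rewrite /kk big1 // => i _; rewrite /u.
  have [->|/coC ij] := eqVneq (co h i j) 0; first by rewrite mulr0.
  by rewrite ij Cj; case: ifP; rewrite mul0r.
have xE : \sum_(i | ~~ col i) (if dg i == s then u i else 0) *: lt i = res (s, 1%N, 0%N) x.
  apply/funext => w; rewrite fct_sumE /restr.
  have [[i wi]|nw] := pselect (exists i, w = [:: i]); last first.
    rewrite big1 => [|i _]; last first.
      rewrite shZ; have [->|/lt_supp e1] := eqVneq (lt i w) 0; first by rewrite mulr0.
      by case: nw; exists i.
    case: ifP => // /eqP[_ eA eC].
    have := size_cAC N w; rewrite eA eC; case: (w) nw => [|i []] // nw _.
    by case: nw; exists i.
  rewrite wi /ty /= mul1g /countA /countC /=.
  have [Ci|Ai] := boolP (col i).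
    rewrite !xpair_eqE /= andbF big1 // => j Aj; rewrite shZ.
    have [->|/lt_supp[e1]] := eqVneq (lt j [:: i]) 0; first by rewrite mulr0.
    by rewrite -e1 Ci in Aj.
  rewrite (bigD1 i) //= big1 ?addr0 => [|j /andP[_ ne]].
    rewrite shZ /letter eqxx mulr1 /u (negPf Ai) !xpair_eqE /= !andbT.
    by [].
  rewrite shZ; have [->|/lt_supp[e1]] := eqVneq (lt j [:: i]) 0; first by rewrite mulr0.
  by rewrite e1 eqxx in ne.
have Pkk : P kk.
  have := Tact h (Tres (s, 1%N, 0%N) Tx); rewrite -xE act_sum /P; congr T.
  under eq_bigr do rewrite actZ act_lt scaler_sumr.
  rewrite exchange_big [LHS](bigID col) /= big1 ?add0r => [|j Cj]; last first.
    rewrite big1 // => i Ai; have [->|/coC ij] := eqVneq (co h i j) 0.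
      by rewrite scale0r scaler0.
    by rewrite ij Cj in Ai.
  apply: eq_bigr => j Aj; rewrite /kk scaler_suml [RHS](bigID col) /= [X in _ = X + _]big1.
    by rewrite add0r; apply: eq_bigr => i _; rewrite scalerA.
  by move=> i Ci; rewrite /u Ci; case: ifP; rewrite mul0r scale0r.
rewrite exchange_big; transitivity (\sum_j kk j * k j); last exact: annk.
apply: eq_bigr => j _ /=.
rewrite /f; case: ifP => Cj; first by rewrite kkC // mul0r big1 // => i _; rewrite mulr0.
by rewrite /kk mulr_suml.
Qed.

(** Simplicity: a nonzero [T] stable under commutators and left derivatives along C, under the group
    and under the grading must contain A, hence everything that commutators generate from A. It is
    applied through [orb_full]. *)
Lemma K1_sub x : inK x -> deg1 x -> T x.
Proof. exact: letters_K1 T_letters x. Qed.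

End Generation.

End Coinvariants.

(** * Skew derivatives in higher degree *)

Section Degrees.

Context {K : fieldType} {gT : finGroupType} {I : finType} (N : ydData K gT I).

Local Notation Sh := (seq I -> K^o).
Local Notation dg := (dg N).
Local Notation co := (co N).
Local Notation col := (col N).
Local Notation act := (shact N).
Local Notation wd := (wd N).
Local Notation homG := (homdeg N).
Local Notation cA := (countA N).
Local Notation cC := (countC N).
Local Notation inK := (inK N).
Local Notation Rc := (adC N).
Local Notation res := (restr N).
Local Notation deg1 := (deg1 N).
Local Notation one := (@shone K I).
Local Notation lt := (@letter K I).
Local Notation "x ** y" := (mul N x y) (at level 40, left associativity).
Implicit Types (F H x y z : Sh) (w v : seq I) (i j c : I) (g h : gT).

Definition homC p q F : Prop := forall w, F w != 0 -> cA w = p /\ cC w = q.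

Lemma homC_lsub p q : lsub (homC p q).
Proof.
split=> [w|a x y hx hy w]; first by rewrite eqxx.
rewrite shL => /add_neq0[|/hy //].
by rewrite mulf_eq0 negb_or => /andP[_ /hx].
Qed.

Lemma homC_mul p q p' q' x y :
  homC p q x -> homC p' q' y -> homC (p + p') (q + q') (x ** y).
Proof. by move=> hx hy w /mul_supp[u [v [/hx[<- <-] /hy[<- <-] -> ->]]]. Qed.

Lemma homC_act h p q F : homC p q F -> homC p q (act h F).
Proof. by move=> hF w /act_supp[v /hF[<- <-] e]; rewrite (cA_map e) (cC_map e). Qed.

Lemma homC_Rc c p q x : col c -> homC p q x -> homC p q.+1 (Rc c x).
Proof.
move=> Cc hx w /Rc_supp[v [/hx[-> ->] -> ->]].
by rewrite /countA /countC /= Cc /= !addn0 addn1.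
Qed.

Lemma homC_res t p q x : homC p q x -> homC p q (res t x).
Proof. by move=> hx w /res_supp[/hx]. Qed.

Lemma homC_dl c p q x : col c -> homC p q x -> homC p q.-1 (dl c x).
Proof.
move=> Cc hx w /hx; rewrite /countA /countC -cats1 !count_cat /= Cc /= !addn0 addn1.
by case=> -> <-.
Qed.

Lemma homG_res t x : homG t.1.1 (res t x).
Proof. by move=> w /res_supp[_ <-]. Qed.

Lemma homG_Rc g c x : homG g x -> homG (g * dg c)%g (Rc c x).
Proof.
move=> hx; apply: lsubB (homG_lsub N _) _ _; first exact: homG_mul hx (@homG_lt _ _ _ N c).
have := homG_mul (@homG_lt _ _ _ N c) (@homG_act _ _ _ N g (dg c)^-1%g x hx).
by rewrite !mulgA mulgV mul1g invgK.
Qed.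

Lemma homG_dlw g w x : homG g x -> homG ((wd w)^-1 * g)%g (dlw w x).
Proof. by move=> hx w' /hx <-; rewrite wd_cat mulKg. Qed.

Lemma homG_drw g w x : homG g x -> homG (g * (wd w)^-1)%g (drw w x).
Proof. by move=> hx w' /hx <-; rewrite wd_cat mulgK. Qed.

Lemma dlw_cons i w x : dlw (i :: w) x = dl i (dlw w x).
Proof. by apply/funext => v; rewrite /dlw /dl cat_rcons. Qed.

Lemma dlw_nil x : dlw [::] x = x.
Proof. by apply/funext => v; rewrite /dlw cats0. Qed.

Lemma act_dl h i x : act h (dl i x) = \sum_k co h^-1 k i *: dl k (act h x).
Proof.
rewrite -{1}[x](actK N h) dl_act act_sum; apply: eq_bigr => k _.
by rewrite actZ actVK.
Qed.

(** The sum is a coproduct of [F], which for functions on words is deconcatenation, and the group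
    acts diagonally on it. Only words with the colours of [w] are constrained, because [rR_act]
    knows the splitting for words of degree (1, m) only. *)
Lemma drw_act h F (J : Type) (r : seq J) (P Q : J -> Sh) w :
  (forall v w', map col v = map col w -> F (v ++ w') = \sum_(a <- r) P a w' * Q a v) ->
  drw w (act h F) = \sum_(a <- r) act h (Q a) w *: act h (P a).
Proof.
elim: w F Q => [|j w IH] F Q FE.
  have -> : F = \sum_(a <- r) Q a [::] *: P a.
    apply/funext => w'; rewrite fct_sumE (FE [::]) //; apply: eq_bigr => a _.
    by rewrite shZ mulrC.
  rewrite -[LHS]/(act h _) act_sum; apply: eq_bigr => a _.
  by rewrite actZ.
have -> : drw (j :: w) (act h F) = drw w (dr j (act h F)) by [].
rewrite dr_act linear_sum /=.
rewrite (eq_bigr (fun i => \sum_(a <- r) (co h i j * act h (dr i (Q a)) w) *: act h (P a))).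
  by rewrite exchange_big; apply: eq_bigr => a _ /=; rewrite scaler_suml.
move=> i _; rewrite linearZ_LR /=; have [->|/coC ij] := eqVneq (co h i j) 0.
  by rewrite scale0r big1 // => a _; rewrite mul0r scale0r.
rewrite (IH _ (fun a => dr i (Q a))) => [|v w' ev].
  by rewrite scaler_sumr; apply: eq_bigr => a _; rewrite scalerA.
by rewrite /dr -cat_cons FE //= ij ev.
Qed.

(** This is [(i (x) 1 + 1 (x) i)(P (x) Q)] in the braided tensor product: [P] is the first factor,
    read by the tail [w'], and [dg i] acts on it when the letter passes to the second factor. *)
Lemma drw_ltmul i F (J : Type) (r : seq J) (P Q : J -> Sh) w w' :
  (forall v v', F (v ++ v') = \sum_(a <- r) P a v' * Q a v) ->
  (lt i ** F) (w ++ w') = \sum_(a <- r) ((lt i ** P a) w' * Q a w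
    + act (dg i) (P a) w' * (lt i ** Q a) w).
Proof.
elim: w F Q => [|j w IH] F Q FE.
  have -> : F = \sum_(a <- r) Q a [::] *: P a.
    apply/funext => v; rewrite fct_sumE -[v]/([::] ++ v) FE; apply: eq_bigr => a _.
    by rewrite shZ mulrC.
  rewrite shmul_sumr fct_sumE; apply: eq_bigr => a _.
  by rewrite shmulZr shZ /= mul0r mulr0 addr0 mulrC.
transitivity ((lt i ** dr j F) (w ++ w') + (j == i)%:R * drw w (act (dg j) F) w').
  by rewrite /= dr_lt shmulZl mul1sh.
rewrite (IH _ (fun a => dr j (Q a))) => [|v v']; last by rewrite /dr -cat_cons FE.
rewrite (@drw_act (dg j) F _ r P Q w) // fct_sumE mulr_sumr -big_split.
apply: eq_bigr => a _ /=; rewrite dr_lt shmulZl mul1sh !shZ mulrDr addrA; congr (_ + _).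
by case: (j =P i) => [->|_]; rewrite ?mul0r ?mulr0 // !mul1r mulrC.
Qed.

Lemma dr_act_lt g i c : dr i (act g (lt c)) = co g c i *: one.
Proof.
rewrite act_lt dr_sum (bigD1 i) //= big1 ?addr0 => [|j /negPf ne].
  by rewrite linearZ_LR /= dr_lt eqxx scale1r.
by rewrite linearZ_LR /= dr_lt eq_sym ne scale0r scaler0.
Qed.

(** * Left derivatives spanning the degree 1 part *)

Section Orbit.

Variable G0 : Sh -> Prop.
Hypothesis G0K : forall x, G0 x -> inK x.
Hypothesis G0act : forall h x, G0 x -> G0 (act h x).
Hypothesis G0R : forall c x, col c -> G0 x -> G0 (Rc c x).
Hypothesis G0h : forall x, G0 x -> exists g q p, homG g x /\ homC p q x.

Definition orb n : Sh -> Prop :=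
  linspan (fun z => exists w x, [/\ G0 x, cA w = n & z = dlw w x]).

Lemma orb_lsub n : lsub (orb n). Proof. exact: span_lsub. Qed.

Lemma orb_gen n w x : G0 x -> cA w = n -> orb n (dlw w x).
Proof. by move=> Gx wn; apply: span_gen; exists w, x. Qed.

Lemma orb_dl n i z : orb n z -> orb (n + ~~ col i) (dl i z).
Proof.
move=> Oz; pattern z; apply: span_sub Oz => [|_ [w [x [Gx <- ->]]]].
  exact: (lsub_preim (dl i) (orb_lsub _)).
by rewrite -dlw_cons; apply: orb_gen => //; rewrite /countA /= addnC.
Qed.

Lemma orb_act n h z : orb n z -> orb n (act h z).
Proof.
move=> Oz; pattern z; apply: span_sub Oz => [|_ [w [x [Gx <- ->]]]].
  exact: (lsub_preim (act h) (orb_lsub _)).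
elim: w => [|i w IH]; first by rewrite dlw_nil -[act h x]dlw_nil; apply: orb_gen => //; apply: G0act.
rewrite dlw_cons act_dl; apply: lsub_sum (orb_lsub _) _ => k _.
have [->|/coC ki] := eqVneq (co h^-1 k i) 0; first by rewrite scale0r; apply: (orb_lsub _).1.
by apply: lsubZ (orb_lsub _) _; rewrite [countA _ _]addnC -[predC _ i]/(~~ col i) -ki; apply: orb_dl.
Qed.

Lemma orb_K n z : orb n z -> inK z.
Proof.
move=> Oz; pattern z; apply: span_sub Oz => [|_ [w [x [Gx _ ->]]]]; first exact: inK_lsub.
exact/inK_dlw/G0K.
Qed.

Lemma orb_Rc n c z : col c -> orb n z -> orb n (Rc c z).
Proof.
move=> Cc Oz; pattern z; apply: span_sub Oz => [|_ [w [x [Gx <- ->]]]].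
  exact: (lsub_preim (Rc c) (orb_lsub _)).
have [g [_ [_ [hx _]]]] := G0h Gx.
elim: w => [|i w IH]; first by rewrite dlw_nil -[Rc c x]dlw_nil; apply: orb_gen => //; apply: G0R.
have Ow := @orb_gen (cA w) w x Gx erefl.
have -> : Rc c (dlw (i :: w) x) = dl i (Rc c (dlw w x)) -
    (co ((wd w)^-1 * g) c i *: dlw w x - (i == c)%:R *: act (dg c)^-1 (dlw w x)).
  by rewrite dlw_cons (dl_Rc _ _ (homG_dlw hx)) opprB addrA subrK addrK.
have -> : cA (i :: w) = (cA w + ~~ col i)%N by rewrite [countA _ _]addnC.
apply: lsubB (orb_lsub _) _ _; first exact: orb_dl.
apply: lsubB (orb_lsub _) _ _.
  have [->|/coC ci] := eqVneq (co ((wd w)^-1 * g)%g c i) 0.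
    by rewrite scale0r; apply: (orb_lsub _).1.
  by rewrite -ci Cc addn0; apply: lsubZ (orb_lsub _) Ow.
have [->|_] := eqVneq i c; last by rewrite scale0r; apply: (orb_lsub _).1.
by rewrite Cc addn0; apply: lsubZ (orb_lsub _) _; apply: orb_act.
Qed.

Lemma orb_res n t z : orb n z -> orb n (res t z).
Proof.
move=> Oz; pattern z; apply: span_sub Oz => [|_ [w [x [Gx <- ->]]]].
  exact: (lsub_preim (res t) (orb_lsub _)).
have [g [q [p [hx hc]]]] := G0h Gx.
have [[w' /res_supp[xw' tw']]|no] := pselect (exists w', res t (dlw w x) w' != 0).
  have -> : res t (dlw w x) = dlw w x; last exact: orb_gen.
  apply/funext => v; rewrite /restr; case: eqP => // ne; apply/esym/eqP.
  apply: contra_notT ne => xv; rewrite -tw' /ty.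
  have := hc _ xv; have := hc _ xw'; have := hx _ xv; have := hx _ xw'.
  rewrite !wd_cat /countA /countC !count_cat => <- /mulgI -> [<- <-] [].
  by move=> /addIn -> /addIn ->.
have -> : res t (dlw w x) = 0; last exact: (orb_lsub _).1.
by apply/funext => v; apply/eqP; apply: contra_notT no => nz; exists v.
Qed.

(** A family of degree [n + 1] in A is brought down to degree 1 by left derivatives of degree [n],
    and there simplicity applies. So a single nonzero element in higher degree gives access to the
    whole degree 1 part. *)
Lemma orb_full n : irr N false ->
  (forall x w, G0 x -> x w != 0 -> cA w = n.+1) -> (exists2 x, G0 x & x <> 0) ->
  forall z, inK z -> deg1 z -> orb n z.
Proof.
move=> irrA G0n [x Gx nz] z Kz dz; apply: (K1_sub irrA (orb_lsub n)) Kz dz.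
- move=> {}z Oz; split; first exact: orb_K Oz.
  pattern z; apply: span_sub Oz => [|_ [w [x' [Gx' wn ->]]]].
    split=> [v|a s t hs ht v]; first by rewrite eqxx.
    rewrite shL => /add_neq0[|/ht //].
    by rewrite mulf_eq0 negb_or => /andP[_ /hs].
  by move=> v /(G0n _ _ Gx'); rewrite /countA count_cat -wn -add1n => /addIn.
- by move=> c {}z; apply: orb_Rc.
- by move=> h {}z; apply: orb_act.
- by move=> c {}z Cc /(orb_dl c); rewrite Cc addn0.
- by move=> t {}z; apply: orb_res.
have [w xw] : exists w, x w != 0.
  apply: contrapT => no; apply: nz; apply/funext => w; apply/eqP.
  by apply: contra_notT no => xw; exists w.
(* A word of the support begins with a letter of A, since [x] is killed along C; the left derivative
   along the rest of the word keeps this letter. *)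
case: w xw => [|a v] xw; first by have := G0n _ _ Gx xw.
have Aa : ~~ col a.
  by apply/negP => Ca; have [_ /(_ a Ca)/(congr1 (fun F => F v))/eqP] := G0K Gx; rewrite (negPf xw).
exists (dlw v x); first by apply: orb_gen => //; have := G0n _ _ Gx xw; rewrite /countA /= Aa => -[].
by move=> /(congr1 (fun F => F [:: a]))/eqP; rewrite (negPf xw).
Qed.

End Orbit.

End Degrees.

(** * Reflections *)

Section Extremal.

Context {K : fieldType} {gT : finGroupType} {I : finType} (N : ydData K gT I).

Local Notation Sh := (seq I -> K^o).
Local Notation col := (col N).
Local Notation wd := (wd N).
Local Notation inK := (inK N).
Local Notation homG := (homdeg N).
Local Notation homC := (homC N).
Implicit Types (x y z : Sh).

Lemma homC_size p q x (w : seq I) : homC p q x -> x w != 0 -> size w = (p + q)%N.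
Proof. by move=> hx /hx[<- <-]; apply: size_cAC. Qed.

Lemma max_deg L : nil_at N L -> (exists a, ~~ col a) -> exists m,
  (exists x, [/\ inK x, homC 1 m x & x <> 0]) /\
  forall n x, (m < n)%N -> inK x -> homC 1 n x -> x = 0.
Proof.
move=> nL [a Aa]; pose pr n := `[< exists x, [/\ inK x, homC 1 n x & x <> 0] >].
have ex : exists n, pr n.
  exists 0; apply/asboolP; exists (@letter K I a); split; first exact: inK_lt.
    by move=> w /lt_supp ->; rewrite /countA /countC /= Aa (negPf Aa).
  move=> /(congr1 (fun F => F [:: a])) /eqP; rewrite /letter eqxx.
  by apply/negP; rewrite oner_eq0.
have bd n : pr n -> (n <= L)%N.
  move/asboolP => [x [[Bx _] hx nz]]; have [w xw] : exists w, x w != 0.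
    apply: contrapT => no; apply: nz; apply/funext => w; apply/eqP.
    by apply: contra_notT no => xw; exists w.
  have := inB_supp nL Bx xw; rewrite (homC_size hx xw) => /ltnW.
  exact: leq_trans.
have [m /asboolP mP mmax] := ex_maxnP ex bd; exists m; split=> // n x mn Kx hx.
apply: contrapT => nz; have /mmax : pr n by apply/asboolP; exists x.
by rewrite leqNgt mn.
Qed.

Lemma extremal_basis m : exists (T : {set m.+1.-tuple I}) (y : m.+1.-tuple I -> Sh),
  [/\ forall t, t \in T -> [/\ inK (y t), homC 1 m (y t) & homG (wd t) (y t)],
      forall t t', t \in T -> t' \in T -> y t t' = (t == t')%:R
    & forall x, inK x -> homC 1 m x -> x = \sum_(t in T) x t *: y t].
Proof.
pose P (k : m.+1.-tuple I -> K^o) :=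
  exists x, [/\ inK x, homC 1 m x & forall e : m.+1.-tuple I, k e = x e].
have sP : lsub P.
  split; first by exists 0; split=> //; [apply: (inK_lsub N).1|apply: (homC_lsub N _ _).1].
  move=> a k k' [x [Kx hx kx]] [x' [Kx' hx' kx']]; exists (a *: x + x'); split.
  - exact: (inK_lsub N).2.
  - exact: (homC_lsub N _ _).2.
  - by move=> e; rewrite !shL kx kx'.
have [T [y0 [Py0 y0E dT]]] := echelon sP.
have /choice[y1 y1P] : forall e, exists x, e \in T ->
    [/\ inK x, homC 1 m x & forall e' : m.+1.-tuple I, y0 e e' = x e'].
  by move=> e; have [/Py0[x xP]|_] := boolP (e \in T); [exists x|exists 0].
(* Cutting down to one degree keeps the values at the pivots: those at pivots other than [e] are
   zero anyway, and [e] itself has the chosen degree. *)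
pose y (e : m.+1.-tuple I) := restr N (wd e, 1%N, m) (y1 e).
have yP t : t \in T -> [/\ inK (y t), homC 1 m (y t) & homG (wd t) (y t)].
  case/y1P => Ky hy _; split; [exact: inK_res|exact: homC_res|exact: homG_res].
have yE t t' : t \in T -> t' \in T -> y t t' = (t == t')%:R.
  move=> tT t'T; rewrite /y /restr /ty; have [_ hy ye] := y1P _ tT.
  rewrite -ye y0E //; have [<-|_] := eqVneq t t'; last by case: ifP.
  have /hy[-> ->] : y1 t t != 0 by rewrite -ye y0E // eqxx oner_eq0.
  by rewrite eqxx.
exists T, y; split=> // x Kx hx.
pose z := x - \sum_(t in T) x t *: y t.
suff : z = 0 by move/eqP; rewrite subr_eq0 => /eqP.
have Kz : inK z.
  apply: lsubB (inK_lsub N) Kx _; apply: lsub_sum (inK_lsub N) _ => t /yP[Ky _ _].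
  exact: lsubZ (inK_lsub N) Ky.
have hz : homC 1 m z.
  apply: lsubB (homC_lsub N _ _) hx _; apply: lsub_sum (homC_lsub N _ _) _ => t /yP[_ hy _].
  exact: lsubZ (homC_lsub N _ _) hy.
have z0 : (fun e : m.+1.-tuple I => z e) = 0.
  apply: dT => [|t tT]; first by exists z.
  rewrite /z shD shN fct_sumE (bigD1 t) //= shZ yE // eqxx mulr1 big1 ?addr0 ?subrr //.
  by move=> t' /andP[t'T /negPf ne]; rewrite shZ yE // ne mulr0.
apply/funext => w; apply/eqP; apply: contraTT isT => zw.
have /eqP sw := homC_size hz zw.
by rewrite -[w]/(tval (Tuple sw)) -[z _]/((fun e : m.+1.-tuple I => z e) (Tuple sw)) z0 eqxx in zw.
Qed.

End Extremal.

(** * The reflected pair and the map [Phi] *)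

Section Reflection.

Context {K : fieldType} {gT : finGroupType} {I : finType} (N : ydData K gT I).

Local Notation Sh := (seq I -> K^o).
Local Notation dg := (dg N).
Local Notation co := (co N).
Local Notation col := (col N).
Local Notation act := (shact N).
Local Notation wd := (wd N).
Local Notation homG := (homdeg N).
Local Notation homC := (homC N).
Local Notation cA := (countA N).
Local Notation cC := (countC N).
Local Notation inK := (inK N).
Local Notation kC := (kC N).
Local Notation Rc := (adC N).
Local Notation one := (@shone K I).
Local Notation "x ** y" := (mul N x y) (at level 40, left associativity).
Implicit Types (x z : Sh) (g h : gT).

Variables (m : nat) (T : {set m.+1.-tuple I}) (y : m.+1.-tuple I -> Sh).
Hypothesis mmax : forall n x, (m < n)%N -> inK x -> homC 1 n x -> x = 0.
Hypothesis yP : forall t, t \in T -> [/\ inK (y t), homC 1 m (y t) & homG (wd t) (y t)].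
Hypothesis yE : forall t t', t \in T -> t' \in T -> y t t' = (t == t')%:R.
Hypothesis ysum : forall x, inK x -> homC 1 m x -> x = \sum_(t in T) x t *: y t.

(* The reflected pair is C^* + Y, where the functions [y t], [t \in T], are a
   basis of the extremal part Y of degree (1, m) dual to the words [t]. *)
Definition rI : finType := ({c | c \in col} + {t | t \in T})%type.

Lemma ysumE x : inK x -> homC 1 m x ->
  x = \sum_(t : {t | t \in T}) x (val t) *: y (val t).
Proof. by move=> Kx hx; rewrite {1}(ysum Kx hx) big_sub. Qed.

Definition rdg (i : rI) : gT :=
  match i with inl c => (dg (val c))^-1%g | inr t => wd (val t) end.

Definition rco h (i j : rI) : K :=
  match i, j with
  | inl c, inl d => co h^-1%g (val d) (val c)
  | inr t, inr t' => act h (y (val t)) (val t')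
  | _, _ => 0
  end.

(** The halves exchange roles: Y is the new C, and C^* the new A. *)
Definition rcol (i : rI) : bool := if i is inr _ then true else false.

Fact rco1 i j : rco 1%g i j = (i == j)%:R.
Proof.
case: i j => [c|t] [d|t'] //=; first by rewrite invg1 co1 eq_sym.
by rewrite act1 yE ?(valP t) ?(valP t').
Qed.

Lemma sum_col h d (G : I -> K) : col d ->
  \sum_(k : {c | c \in col}) G (val k) * co h (val k) d = \sum_k G k * co h k d.
Proof.
move=> Cd; rewrite -(big_sub (mem col) (fun k => G k * co h k d)).
rewrite [RHS](bigID (mem col)) /= [X in _ + X]big1 ?addr0 // => k; rewrite -topredE /= => Ak.
have [->|/coC kd] := eqVneq (co h k d) 0; first by rewrite mulr0.
by rewrite kd Cd in Ak.
Qed.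

Lemma act_y h t : t \in T ->
  act h (y t) = \sum_(t' : {t | t \in T}) act h (y t) (val t') *: y (val t').
Proof.
by move=> tT; have [Ky hy _] := yP tT; apply: ysumE; [apply: inK_act|apply: homC_act].
Qed.

Fact rcoM h k i l : rco (h * k)%g i l = \sum_j rco k i j * rco h j l.
Proof.
rewrite big_sumType /=; case: i l => [c|t] [d|t'] /=; last 1 first.
- rewrite big1 ?add0r => [|c _]; last by rewrite mul0r.
  rewrite actM {1}(act_y k (valP t)) act_sum fct_sumE; apply: eq_bigr => s _.
  by rewrite actZ shZ.
- rewrite [X in _ + X]big1 ?addr0 => [|s _]; last by rewrite mul0r.
  rewrite invMg coM; have := sum_col k^-1%g (fun j => co h^-1%g (val d) j) (valP c).
  by move=> <-; apply: eq_bigr => j _; rewrite mulrC.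
- by rewrite !big1 ?addr0 // => j _; rewrite ?mul0r ?mulr0.
- by rewrite !big1 ?addr0 // => j _; rewrite ?mul0r ?mulr0.
Qed.

Fact rcoD h i j : rco h i j != 0 -> rdg j = (h * rdg i * h^-1)%g.
Proof.
case: i j => [c|t] [d|t'] /=; rewrite ?eqxx //.
  by move/coD ->; rewrite !invMg !invgK mulKVg mulgK.
have [_ _ hy] := yP (valP t).
by apply: homG_act hy _.
Qed.

Fact rcoC h i j : rco h i j != 0 -> rcol i = rcol j.
Proof. by case: i j => [c|t] [d|t'] /=; rewrite ?eqxx. Qed.

Definition rN : ydData K gT rI := YdData rco1 rcoM rcoD rcoC.

Local Notation act' := (shact rN).
Local Notation homG' := (homdeg rN).
Local Notation cA' := (countA rN).
Local Notation cC' := (countC rN).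
Local Notation "x *' y" := (mul rN x y) (at level 40, left associativity).

Definition rR (i : rI) x : Sh :=
  match i with inl c => Rc (val c) x | inr t => drw (val t) x end.

Fact rR_linear i : linear (rR i).
Proof. by case: i => [c|t] a x z //=; rewrite linearP. Qed.
HB.instance Definition _ i := GRing.isLinear.Build K Sh Sh *:%R (rR i) (rR_linear i).

(* [Phi x] lists the constant terms of the iterated images of [x] under the
   right derivatives of the reflected algebra: along C^* these are the braided
   commutators [Rc], and along Y the iterated derivatives in the words [t]. *)
Fixpoint Phi x (w : seq rI) : K^o :=
  if w is i :: w' then Phi (rR i x) w' else x [::].

Fact Phi_linear : linear Phi.
Proof.
move=> a x z; apply/funext => w; elim: w x z => [//|i w IH] x z.
by rewrite [LHS]/= linearP IH.
Qed.
HB.instance Definition _ :=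
  GRing.isLinear.Build K Sh (seq rI -> K^o) *:%R Phi Phi_linear.

Lemma Phi0 : Phi 0 = 0. Proof. exact: linear0. Qed.
Lemma PhiD x z : Phi (x + z) = Phi x + Phi z. Proof. exact: linearD. Qed.
Lemma PhiB x z : Phi (x - z) = Phi x - Phi z. Proof. exact: linearB. Qed.
Lemma PhiZ a x : Phi (a *: x) = a *: Phi x. Proof. exact: linearZ_LR. Qed.
Lemma Phi_sum (J : Type) (r : seq J) (p : pred J) (G : J -> Sh) :
  Phi (\sum_(a <- r | p a) G a) = \sum_(a <- r | p a) Phi (G a).
Proof. exact: linear_sum. Qed.

Lemma dr_Phi i x : dr i (Phi x) = Phi (rR i x). Proof. by []. Qed.

(** The right derivative along [w], evaluated at [w'], is the value at [w] of the left derivative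
    along [w']. The latter stays in K, and its part of degree (1, n) vanishes by maximality of [m].
    The same exchange yields [drw_eq] from the basis [y]. *)
Lemma drw_gt x w n : inK x -> cA w = 1%N -> cC w = n -> (m < n)%N -> drw w x = 0.
Proof.
move=> Kx wA wC mn; apply/funext => w'.
have /mmax : inK (restr N (wd w, 1%N, n) (dlw w' x)) by apply/inK_res/inK_dlw.
move/(_ n mn); have h : homC 1 n (restr N (wd w, 1%N, n) (dlw w' x)).
  by move=> v /res_supp[_ [_ -> ->]].
by move/(_ h)/(congr1 (fun F => F w)); rewrite /restr /ty wA wC eqxx.
Qed.

Lemma drw_eq x w : inK x -> cA w = 1%N -> cC w = m ->
  drw w x = \sum_(t : {t | t \in T}) y (val t) w *: drw (val t) x.
Proof.
move=> Kx wA wC; apply/funext => w'; rewrite fct_sumE.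
pose z := restr N (wd w, 1%N, m) (dlw w' x).
have Kz : inK z by apply/inK_res/inK_dlw.
have hz : homC 1 m z by move=> v /res_supp[_ [_ -> ->]].
have -> : drw w x w' = z w by rewrite /z /restr /ty wA wC eqxx.
rewrite (ysumE Kz hz) fct_sumE; apply: eq_bigr => t _; rewrite !shZ mulrC.
have [->|nz] := eqVneq (y (val t) w) 0; first by rewrite !mul0r.
have [_ hy /(_ _ nz) gy] := yP (valP t); congr (_ * _).
have /hy[tA tC] : y (val t) (val t) != 0 by rewrite (yE (valP t) (valP t)) eqxx oner_eq0.
by rewrite /z /restr /ty -gy tA tC eqxx.
Qed.

Lemma T_cnt t : t \in T -> cA t = 1%N /\ cC t = m.
Proof.
move=> tT; have [_ hy _] := yP tT; apply: hy.
by rewrite yE // eqxx oner_eq0.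
Qed.

Lemma T_shape t : t \in T -> exists a w, [/\ tval t = a :: w, ~~ col a & all col w].
Proof.
move=> tT; have [[_ ky] _ _] := yP tT.
have nz : y t t != 0 by rewrite yE // eqxx oner_eq0.
case: t tT nz ky => -[|a w] //= sz tT nz ky; exists a, w.
have Aa : ~~ col a.
  by apply/negP => Ca; rewrite -[y _ _]/(dr a _ w) ky // eqxx in nz.
split=> //; have [] := T_cnt tT; rewrite /countA /= Aa => -[cw] _.
by rewrite all_count -(count_predC col w) -[count (predC col) w]/(0 + _)%N cw addn0.
Qed.

(** A derivative along C after one along [t] is a derivative along a word of degree (1, m + 1),
    hence zero. *)
Lemma inK_rR i x : inK x -> inK (rR i x).
Proof.
case: i => [c|t] Kx /=; first exact: inK_Rc.
have [Bx _] := Kx; split; first exact: inB_drw.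
move=> c Cc; have -> : dr c (drw (val t) x) = drw (rcons (val t) c) x.
  by apply/funext => w; rewrite /dr /drw cat_rcons.
have [tA tC] := T_cnt (valP t).
apply: (@drw_gt _ _ m.+1) => //.
  by rewrite /countA -cats1 count_cat /= Cc /= !addn0.
by rewrite /countC -cats1 count_cat /= Cc /= addn0 addn1; congr _.+1.
Qed.

Lemma rR_act h x j : inK x -> rR j (act h x) = \sum_i rco h i j *: act h (rR i x).
Proof.
move=> Kx; rewrite big_sumType /=; case: j => [d|t'] /=; last first.
  rewrite big1 ?add0r => [|c _]; last exact: scale0r.
  have [tA tC] := T_cnt (valP t').
  apply: (@drw_act _ _ _ _ _ _ _ _ (fun t : {t | t \in T} => drw (val t) x)) => v w' ev.
  have := drw_eq Kx (etrans (cA_map ev) tA) (etrans (cC_map ev) tC).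
  move/(congr1 (fun F => F w')); rewrite fct_sumE /drw => ->.
  by apply: eq_bigr => t _; rewrite shZ mulrC.
rewrite [X in _ + X]big1 ?addr0 => [|t _]; last exact: scale0r.
rewrite -(big_sub (mem col) (fun c => co h^-1%g (val d) c *: act h (Rc c x))).
transitivity (\sum_c co h^-1%g (val d) c *: act h (Rc c x)); last first.
  rewrite [LHS](bigID (mem col)) /= [X in _ + X]big1 ?addr0 // => c; rewrite -topredE /= => Ac.
  have [->|/coC dc] := eqVneq (co h^-1%g (val d) c) 0; first by rewrite scale0r.
  by have := valP d; rewrite /= -topredE /= dc (negPf Ac).
rewrite (eq_bigr (fun c => \sum_k (co h^-1%g (val d) c * co h c k) *: Rc k (act h x))).
  rewrite exchange_big (eq_bigr (fun k => (val d == k)%:R *: Rc k (act h x))).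
    by rewrite sum_deltaV.
  by move=> k _; rewrite -scaler_suml coKV.
by move=> c _; rewrite Rc_act scaler_sumr; apply: eq_bigr => k _; rewrite scalerA.
Qed.

Lemma Phi_act h x : inK x -> Phi (act h x) = act' h (Phi x).
Proof.
move=> Kx; apply/funext => w; elim: w x Kx => [//|j w IH] x Kx.
rewrite [LHS]/= (rR_act _ _ Kx) linear_sum fct_sumE /=; apply: eq_bigr => i _.
by rewrite linearZ_LR /= shZ IH //; apply: inK_rR.
Qed.

Lemma drw_kC_mul x z w : kC z -> all col w ->
  drw w (x ** z) = drw w x ** act (wd w) z.
Proof.
elim: w x z => [|c w IH] x z kz /=; first by rewrite act1.
case/andP => Cc Cw; have -> : drw (c :: w) (x ** z) = drw w (dr c (x ** z)) by [].
by rewrite dr_mul kz // shmul0 add0r IH ?actM //; apply: kC_act.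
Qed.

(** A word [t] is a letter of A followed by letters of C. The derivative along A gives two terms,
    each with one factor killed along C, so the remaining derivatives fall entirely on the other
    factor. *)
Lemma rR_mul i x z : inK x -> inK z ->
  rR i (x ** z) = x ** rR i z + rR i x ** act (rdg i) z.
Proof.
move=> [_ kx] [_ kz]; case: i => [c|t] /=; first exact: Rc_mul.
have [a [w [-> Aa Cw]]] := T_shape (valP t).
have -> : drw (a :: w) (x ** z) = drw w (x ** dr a z + dr a x ** act (dg a) z) by [].
rewrite linearD /= drw_mul // drw_kC_mul //; last exact: kC_act.
by rewrite actM.
Qed.

Lemma Phi_mul x z : inK x -> inK z -> Phi (x ** z) = Phi x *' Phi z.
Proof.
move=> Kx Kz; apply/funext => w; elim: w x z Kx Kz => [//|i w IH] x z Kx Kz.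
rewrite [LHS]/= rR_mul // linearD /= shD !IH //; try exact: inK_rR; last exact: inK_act.
by rewrite Phi_act.
Qed.

Lemma Phi_one : Phi one = @shone K rI.
Proof.
apply/funext => -[//|i w] /=.
have -> : rR i one = 0; last by rewrite linear0.
by case: i => [c|t] /=; [apply: Rc_one|have [a [v [-> _ _]]] := T_shape (valP t)].
Qed.

(** [adC] raises the degree to (1, m + 1) and so kills [y t], while the derivative along [t'] reads
    off a coefficient. *)
Lemma Phi_y (t : {t | t \in T}) : Phi (y (val t)) = @letter K rI (inr t).
Proof.
have [Ky hy _] := yP (valP t).
apply/funext => -[|[c|t'] w].
- rewrite /=; apply/eqP; apply: contraTT isT => /hy[]; by [].
- rewrite /= (_ : Rc (val c) _ = 0) ?linear0 //.
  by apply: (mmax (ltnSn m)); [apply: inK_Rc|apply: homC_Rc (valP c) hy].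
- have -> : @letter K rI (inr t) (inr t' :: w) = (t == t')%:R * shone w.
    rewrite /letter /shone eqseq_cons eq_sym -[inr t == _]/(t == t').
    by case: (t == t'); rewrite ?mul1r ?mul0r.
  suff e : drw (val t') (y (val t)) = (t == t')%:R *: one.
    by rewrite /= e linearZ_LR /= Phi_one.
  apply/funext => w'; rewrite shZ /shone /drw.
  have [->|nw] := eqVneq w' [::]; first by rewrite cats0 (yE (valP t) (valP t')) mulr1.
  rewrite mulr0; apply/eqP; apply: contraNT nw => /(homC_size hy).
  by rewrite size_cat size_tuple -[RHS]addn0 => /addnI/size0nil ->.
Qed.

Lemma homG_rR g i x : homG g x -> homG (g * (rdg i)^-1)%g (rR i x).
Proof.
by case: i => [c|t] hx /=; [rewrite invgK; apply: homG_Rc|apply: homG_drw].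
Qed.

Lemma Phi_homG g x : homG g x -> homG' g (Phi x).
Proof.
move=> hx w; elim: w g x hx => [|i w IH] g x hx /=; first exact: hx.
by move/(IH _ _ (@homG_rR _ i _ hx)) ->; rewrite mulgKV.
Qed.

(** A letter of C^* raises the degree in C by 1, a letter of Y removes (1, m), and at the end only
    the constant term counts. So (p, q) becomes (m p - q, p), written without subtraction. *)
Lemma Phi_homC p q x (w : seq rI) : homC p q x -> Phi x w != 0 ->
  cC' w = p /\ (cA' w + q = m * p)%N.
Proof.
elim: w p q x => [|[c|t] w IH] p q x hx /=.
- by case/hx => <- <-; rewrite muln0.
- by case/(IH _ _ _ (homC_Rc (valP c) hx)) => <- <-; rewrite addnS.
move=> nz; have [v xv] : exists v, drw (val t) x v != 0.
  apply: contrapT => no; move: nz; rewrite (_ : drw _ x = 0) ?linear0 ?eqxx //.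
  by apply/funext => v; apply/eqP; apply: contra_notT no => nz; exists v.
have [tA tC] := T_cnt (valP t).
have hd : homC (cA v) (cC v) (drw (val t) x).
  move=> u /hx; have := hx _ xv; rewrite /countA /countC !count_cat => -[<- <-] [].
  by move=> /addnI -> /addnI ->.
have [eC eA] := IH _ _ _ hd nz; have [<- <-] := hx _ xv.
rewrite /countA /countC !count_cat !/(countA _ _) /= in tA tC eC eA *.
by rewrite eC [count _ (tval _)]tA [count col (tval _)]tC add1n mulnS addnCA add0n eA.
Qed.

Lemma dr_cross i c g x :
  dr i (letter (inl c) *' Phi x - Phi x *' act' g^-1 (letter (inl c))) =
  letter (inl c) *' Phi (rR i x)
    - Phi (rR i x) *' act' (g * (rdg i)^-1)^-1 (letter (inl c))
    + ((i == inl c)%:R *: act' (rdg i) (Phi x) - rco g^-1 (inl c) i *: Phi x).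
Proof.
rewrite linearB /= !dr_mul dr_lt dr_act_lt !dr_Phi shmulZl mul1sh shmulZr shmul1.
by rewrite -actM invMg invgK [X in _ - X]addrC opprD addrACA.
Qed.

(** Both sides have the same right derivatives: along C^* the extra terms of [dl_Rc] match those of
    [dr_cross], and along Y left and right derivatives commute. *)
Lemma Phi_dl g c x : inK x -> homG g x ->
  Phi (dl (val c) x) = letter (inl c) *' Phi x - Phi x *' act' g^-1 (letter (inl c)).
Proof.
move=> Kx hx; apply/funext => w; elim: w g x Kx hx => [|i w IH] g x Kx hx.
  rewrite shD shN /= mul0r mulr0 subr0.
  by case: Kx => _ /(_ _ (valP c))/(congr1 (fun F => F [::])).
rewrite -[RHS]/(dr i _ w) dr_cross shD -(IH _ _ (inK_rR i Kx) (homG_rR hx)).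
rewrite [LHS]/=; case: i => [d|t] /=.
  have -> : Rc (val d) (dl (val c) x) = dl (val c) (Rc (val d) x)
      - (co g (val d) (val c) *: x - (val c == val d)%:R *: act (dg (val d))^-1 x).
    by rewrite (dl_Rc _ _ hx) opprB addrA subrK addrK.
  rewrite !PhiB !PhiZ opprB Phi_act // invgK.
  by rewrite -[inl d == _]/(d == c) [d == c]eq_sym.
rewrite mulr0n !scale0r subrr addr0; congr (Phi _ w).
by apply/funext => v; rewrite /drw /dl rcons_cat.
Qed.

End Reflection.

(** * Image and injectivity of [Phi], irreducibility of the reflected pair *)

Section ReflectionTheory.

Context {K : fieldType} {gT : finGroupType} {I : finType} (N : ydData K gT I).

Local Notation Sh := (seq I -> K^o).
Local Notation dg := (dg N).
Local Notation co := (co N).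
Local Notation col := (col N).
Local Notation act := (shact N).
Local Notation wd := (wd N).
Local Notation homG := (homdeg N).
Local Notation homC := (homC N).
Local Notation inK := (inK N).
Local Notation Rc := (adC N).
Local Notation "x ** y" := (mul N x y) (at level 40, left associativity).
Implicit Types (x z : Sh) (g h : gT).

Variables (m : nat) (T : {set m.+1.-tuple I}) (y : m.+1.-tuple I -> Sh).
Hypothesis mmax : forall n x, (m < n)%N -> inK x -> homC 1 n x -> x = 0.
Hypothesis yP : forall t, t \in T -> [/\ inK (y t), homC 1 m (y t) & homG (wd t) (y t)].
Hypothesis yE : forall t t', t \in T -> t' \in T -> y t t' = (t == t')%:R.
Hypothesis ysum : forall x, inK x -> homC 1 m x -> x = \sum_(t in T) x t *: y t.

Local Notation rI := (rI N T).
Local Notation N' := (rN yP yE ysum).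
Local Notation Phi := (@Phi _ _ _ N m T).
Local Notation inB' := (nicholsB N').
Local Notation "x *' y" := (mul N' x y) (at level 40, left associativity).

Hypothesis irrA : irr N false.
Hypothesis Tnz : exists t, t \in T.

Definition topX x : Prop := [/\ inK x, homC 1 m x & exists g, homG g x].

Lemma topX_act h x : topX x -> topX (act h x).
Proof.
case=> Kx hx [g gx]; split; [exact: inK_act|exact: homC_act|].
by exists (h * g * h^-1)%g; apply: homG_act.
Qed.

Lemma topX_Rc c x : col c -> topX x -> topX (Rc c x).
Proof.
move=> Cc [Kx hx [g gx]]; have -> : Rc c x = 0.
  by apply: (mmax (ltnSn m)); [apply: inK_Rc|apply: homC_Rc].
split; [exact: (inK_lsub N).1|exact: (homC_lsub N _ _).1|exists g; exact: (homG_lsub N _).1].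
Qed.

Lemma K1_topX z : inK z -> deg1 N z -> orb N topX 0 z.
Proof.
apply: orb_full => //.
- by move=> x [].
- exact: topX_act.
- exact: topX_Rc.
- by move=> x [_ hx [g gx]]; exists g, m, 1%N.
- by move=> x w [_ hx _] /hx[].
have [t tT] := Tnz; have [Ky hy gy] := yP tT; exists (y t).
  by split=> //; exists (wd t).
by move/(congr1 (fun F : Sh => F t))/eqP; rewrite yE // eqxx oner_eq0.
Qed.

(** By simplicity the degree 1 part arises from the extremal part by left derivatives along C. [Phi]
    sends the extremal part to combinations of letters, and turns these derivatives into commutators
    with letters of C^*. *)
Lemma Phi_K1 z : inK z -> deg1 N z -> inB' (Phi z).
Proof.
move=> Kz dz; have Oz := K1_topX Kz dz.
pattern z; apply: span_sub Oz => [|_ [w [x [[Kx hx [g gx]] w0 ->]]]].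
  exact: (lsub_preim Phi (inB_lsub N')).
elim: w w0 => [_|c w IH].
  rewrite dlw_nil (ysumE ysum Kx hx) Phi_sum; apply: lsub_sum (inB_lsub _) _ => t _.
  by rewrite PhiZ (Phi_y mmax yP yE); apply: lsubZ (inB_lsub _) _; apply: inB_lt.
rewrite /countA /= => /eqP; rewrite addn_eq0 => /andP[Cc /eqP w0].
have {}Cc : c \in col by move: Cc; rewrite eqb0 negbK.
rewrite dlw_cons -[c]/(val (exist (fun c => c \in col) c Cc)).
rewrite (Phi_dl mmax yP yE ysum _ (inK_dlw _ Kx) (homG_dlw gx)).
apply: lsubB (inB_lsub _) _ _; first by apply: inB_mul; [apply: inB_lt|apply: IH].
by apply: inB_mul; [apply: IH|apply/inB_act/inB_lt].
Qed.

Lemma Phi_inB x : inK x -> inB' (Phi x).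
Proof.
move/inK_Kh; elim=> [||a u z _ Bu _ Bz|a u Aa /Kh_inK Ku Bu|c u Cc _ Bu].
- by rewrite Phi0; apply: (inB_lsub _).1.
- by rewrite (Phi_one yP yE); apply: inB_one.
- by rewrite PhiD PhiZ; apply: (inB_lsub _).2.
- rewrite (Phi_mul mmax yP yE ysum) //; last exact: inK_lt.
  apply: inB_mul Bu; apply: Phi_K1; first exact: inK_lt.
  by move=> w /lt_supp ->; rewrite /countA /= Aa.
- have := inB_dr (inl (exist (fun c => c \in col) c Cc)) Bu.
  by rewrite dr_Phi.
Qed.

(** If the kernel had a nonzero element of degree [n + 1] in A, left derivatives of such elements
    would span the degree 1 part and produce [y t]. Their values at [t] are values of right
    derivatives along [t], which lie in the kernel in degree [n] and vanish by induction; but [y t]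
    has value 1 at [t]. *)
Lemma Phi_inj n g q x : inK x -> homG g x -> homC n q x -> Phi x = 0 -> x = 0.
Proof.
elim: n g q x => [|n IH] g q x Kx gx hx Px0.
  rewrite (kC_deg0 Kx.2) => [|w /hx[]//].
  by have := congr1 (fun F => F [::]) Px0; rewrite /= => ->; rewrite scale0r.
pose G0 z := [/\ inK z, Phi z = 0 & exists g q, homG g z /\ homC n.+1 q z].
apply: contrapT => nz; have [t tT] := Tnz; have [Ky hy gy] := yP tT.
have : orb N G0 n (y t).
  apply: orb_full => //; last by move=> w /hy[].
  - by move=> z [].
  - move=> h z [Kz Pz [g' [q' [gz hz]]]]; split; first exact: inK_act.
      by rewrite (Phi_act mmax yP yE ysum) // Pz act0.
    by exists (h * g' * h^-1)%g, q'; split; [apply: homG_act|apply: homC_act].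
  - move=> c z Cc [Kz Pz [g' [q' [gz hz]]]]; split; first exact: inK_Rc.
      by rewrite -[Phi _]/(dr (inl (exist (fun c => c \in col) c Cc) : rI) (Phi z)) Pz.
    by exists (g' * dg c)%g, q'.+1; split; [apply: homG_Rc|apply: homC_Rc].
  - by move=> z [_ _ [g' [q' [gz hz]]]]; exists g', q', n.+1.
  - by move=> z w [_ _ [g' [q' [gz hz]]]] /hz[].
  - by exists x => //; split=> //; exists g, q.
suff vt z : orb N G0 n z -> z t = 0.
  by move/vt/eqP; rewrite yE // eqxx oner_eq0.
move=> Oz; pattern z; apply: span_sub Oz => [|_ [w [u [[Ku Pu [g' [q' [gu hu]]]] wn ->]]]].
  by split=> // a s r; rewrite shL => -> ->; rewrite mulr0 addr0.
rewrite -[LHS]/(drw t u w) (IH (g' * (wd t)^-1)%g (q' - m)%N (drw t u)) //.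
- by have := inK_rR mmax yP yE (inr (exist (fun t => t \in T) t tT)) Ku.
- exact: homG_drw.
- have [tA tC] := T_cnt yP yE tT; move=> v /hu; rewrite /countA /countC !count_cat.
  by rewrite [count _ (tval t)]tA [count col (tval t)]tC add1n => -[[->] <-]; rewrite addKn.
by rewrite -[Phi _]/(dr (inr (exist (fun t => t \in T) t tT) : rI) (Phi u)) Pu.
Qed.

(** Suppose that [f] kills all translates of the components of [x]. By simplicity, left derivatives
    of these produce [y t1]. A left derivative along a nonempty word is too short to have values on
    words of length [m + 1], so [f] kills [y t1] as well, against the choice of [t1]. *)
Lemma irr_rN_true : irr N' true.
Proof.
move=> u f uC fC [i0 ui0] [j0 fj0].
case: i0 ui0 => [c /uC//|t0] ut0; case: j0 fj0 => [c /fC//|t1] ft1.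
pose x : Sh := \sum_(t : {t | t \in T}) u (inr t) *: y (val t).
have xt (t : {t | t \in T}) : x (val t) = u (inr t).
  rewrite /x fct_sumE (bigD1 t) //= shZ yE ?(valP t) // eqxx mulr1 big1 ?addr0 // => s ne.
  rewrite shZ yE ?(valP t) ?(valP s) // (_ : (val s == val t) = false) ?mulr0 //.
  by apply: contraNF ne => /eqP/val_inj ->.
have Kx : inK x.
  by apply: lsub_sum (inK_lsub N) _ => t _; apply: lsubZ (inK_lsub N) _; case: (yP (valP t)).
have hx : homC 1 m x.
  by apply: lsub_sum (homC_lsub N _ _) _ => t _; apply: lsubZ (homC_lsub N _ _) _; case: (yP (valP t)).
pose G0 z := exists h s, z = act h (restr N (s, 1%N, m) x).
have G0top z : G0 z -> topX z.
  move=> [h [s ->]]; apply: topX_act; split; [exact: inK_res|exact: homC_res|].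
  by exists s; apply: homG_res.
apply: contrapT => no; have f0 h s :
    \sum_(t : {t | t \in T}) act h (restr N (s, 1%N, m) x) (val t) * f (inr t) = 0.
  apply: contrapT => nz; apply: no; exists h, s; apply/eqP; apply: contra_not nz => e; rewrite -[RHS]e {e}.
  rewrite [RHS]big_sumType /= [X in _ = X + _]big1 ?add0r => [|c _]; last first.
    rewrite (_ : u (inl c) = 0) ?big1 // => [j _|]; first by case: ifP; rewrite !mul0r.
    by apply/eqP; apply: contraTT isT => /uC.
  have -> : restr N (s, 1%N, m) x =
      \sum_(r : {t | t \in T}) (if wd (val r) == s then u (inr r) else 0) *: y (val r).
    rewrite /x linear_sum; apply: eq_bigr => r _; rewrite linearZ_LR /=.
    have [_ hy gy] := yP (valP r); have [<-|ne] := eqVneq (wd (val r)) s.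
      congr (_ *: _); apply/funext => w; rewrite /restr /ty.
      have [->|nz'] := eqVneq (y (val r) w) 0; first by case: ifP.
      by have [-> ->] := hy _ nz'; rewrite (gy _ nz') eqxx.
    rewrite scale0r (_ : restr _ _ _ = 0) ?scaler0 //; apply/funext => w; apply/eqP.
    by apply: contraTT isT => /res_supp[/gy gw [/eqP]]; rewrite gw (negPf ne).
  rewrite [RHS]exchange_big /= [RHS]big_sumType /= [X in _ = X + _]big1 ?add0r; last first.
    by move=> c _; rewrite big1 // => r _; rewrite mulr0 mul0r.
  apply: eq_bigr => t _; rewrite -mulr_suml; congr (_ * _).
  by rewrite act_sum fct_sumE; apply: eq_bigr => r _; rewrite actZ.
have xE : x = \sum_(s : gT) restr N (s, 1%N, m) x.
  apply/funext => w; rewrite fct_sumE (bigD1 (wd w)) //= big1 ?addr0 => [|s ne].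
    rewrite /restr /ty; have [->|/hx[-> ->]] := eqVneq (x w) 0; first by case: ifP.
    by rewrite eqxx.
  by rewrite /restr /ty !xpair_eqE eq_sym (negPf ne).
have [s xs] : exists s, restr N (s, 1%N, m) x <> 0.
  apply: contrapT => no'; case/eqP: ut0; rewrite -xt xE big1 // => s _.
  by apply: contrapT => nz; apply: no'; exists s.
(* Zero is adjoined because [adC c] kills the extremal part and the family has to be stable under
   it. *)
have : orb N (fun z => G0 z \/ z = 0) 0 (y (val t1)).
  have [Ky hy gy] := yP (valP t1).
  apply: orb_full => //; last by move=> w /hy[].
  - by move=> z [/G0top[]//|->]; apply: (inK_lsub N).1.
  - move=> h z [[h' [s' ->]]|->]; last by right; rewrite act0.
    by left; exists (h * h')%g, s'; rewrite actM.
  - move=> c z Cc [/G0top[Kz hz _]|->]; right; last by rewrite linear0.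
    by apply: (mmax (ltnSn m)); [apply: inK_Rc|apply: homC_Rc].
  - move=> z [/G0top[_ hz [g gz]]|->]; first by exists g, m, 1%N.
    by exists 1%g, m, 1%N; split; [apply: (homG_lsub N _).1|apply: (homC_lsub N _ _).1].
  - by move=> z w [/G0top[_ hz _] /hz[]//|->]; rewrite eqxx.
  - exists (restr N (s, 1%N, m) x) => //; left.
    by exists 1%g, s; rewrite act1.
have /= vt z : orb N (fun z => G0 z \/ z = 0) 0 z ->
    \sum_(t : {t | t \in T}) z (val t) * f (inr t) = 0.
  move=> Oz; pattern z; apply: span_sub Oz => [|_ [w [u' [Gu _ ->]]]].
    split=> [|a p r hp hr]; first by rewrite big1 // => t _; rewrite mul0r.
    rewrite (eq_bigr (fun t : {t | t \in T} =>
      a * (p (val t) * f (inr t)) + r (val t) * f (inr t))) => [|t _].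
      by rewrite big_split -mulr_sumr /= hp hr mulr0 addr0.
    by rewrite shL mulrDl mulrA.
  case: Gu => [Gu|->]; last by rewrite big1 // => t _; apply: mul0r.
  case: w => [|i w]; first by case: Gu => h [s' ->]; rewrite dlw_nil.
  have [_ hu _] := G0top _ Gu; rewrite big1 // => t _.
  rewrite /dlw (_ : u' _ = 0) ?mul0r //; apply/eqP; apply: contraTT isT => /(homC_size hu).
  by rewrite size_cat size_tuple -[RHS]addn0 => /addnI.
move/vt/eqP; rewrite (bigD1 t1) //= big1 ?addr0 => [|t ne].
  by rewrite yE ?(valP t1) // eqxx mul1r (negPf ft1).
rewrite yE ?(valP t1) ?(valP t) // (_ : (val t1 == val t) = false) ?mul0r //.
by apply: contraNF ne => /eqP/val_inj ->.
Qed.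

(** A functional on C^* is a vector of C and conversely, so [u] and [f] change places. The action is
    contragredient, whence [h^-1]; the letters that [f] is carried to have degree [h s h^-1] in C,
    hence the inverse degree in C^*. *)
Lemma irr_rN_false : irr N true -> irr N' false.
Proof.
move=> irrC u f uC fC [i0 ui0] [j0 fj0].
have ur t : u (inr t) = 0 by apply/eqP; apply: contraTT isT => /uC.
have fr t : f (inr t) = 0 by apply/eqP; apply: contraTT isT => /fC.
pose ext (k : rI -> K) c : K := oapp (fun c' => k (inl c')) 0 (insub c).
have extE (k : rI -> K) (c : {c | c \in col}) : ext k (val c) = k (inl c).
  by rewrite /ext valK.
have extC (k : rI -> K) c : ext k c != 0 -> col c = true.
  by rewrite /ext; case: insubP => [c' + _ _|]; rewrite ?eqxx.
have ext0 k c : ~~ col c -> ext k c = 0.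
  by move=> Ac; apply/eqP; apply: contraNT Ac => /extC.
have sumE (G : I -> K) : (forall c, ~~ col c -> G c = 0) ->
    \sum_c G c = \sum_(c : {c | c \in col}) G (val c).
  move=> G0; rewrite -(big_sub (mem col) G) [LHS](bigID (mem col)) /=.
  by rewrite [X in _ + X]big1 ?addr0 // => c /G0.
have [||||h [s nz]] := irrC (ext f) (ext u); try by move=> c /extC.
- by case: j0 fj0 => [c fc|t]; rewrite ?fr ?eqxx //; exists (val c); rewrite extE.
- by case: i0 ui0 => [c uc|t]; rewrite ?ur ?eqxx //; exists (val c); rewrite extE.
exists h^-1%g, (h * s * h^-1)^-1%g; apply: contra_neq nz => e; rewrite -[RHS]e.
rewrite sumE => [|c Ac]; last first.
  by rewrite big1 // => j _; rewrite ext0 //; case: ifP; rewrite !mul0r.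
rewrite [RHS]exchange_big /= [RHS]big_sumType /= [X in _ = _ + X]big1 ?addr0; last first.
  by move=> t _; rewrite big1 // => i _; rewrite fr mulr0.
apply: eq_bigr => d _; rewrite sumE => [|c Ac]; last by rewrite (ext0 u c) ?mulr0.
rewrite [RHS]big_sumType /= [X in _ = _ + X]big1 ?addr0; last first.
  by move=> t _; rewrite mulr0 mul0r.
apply: eq_bigr => c _; rewrite !extE invgK.
have [->|/coD cd] := eqVneq (co h (val d) (val c)) 0; first by rewrite !mulr0 !mul0r.
rewrite (inj_eq invg_inj) cd (inj_eq (mulIg _)) (inj_eq (mulgI _)).
by case: (_ =P s) => _; rewrite ?mul0r // [LHS]mulrC mulrA mulrAC.
Qed.

End ReflectionTheory.

(** * Nilpotency of the reflected algebra *)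

Section ReflectionFinite.

Context {K : fieldType} {gT : finGroupType} {I : finType} (N : ydData K gT I).

Local Notation Sh := (seq I -> K^o).
Local Notation dg := (dg N).
Local Notation co := (co N).
Local Notation col := (col N).
Local Notation act := (shact N).
Local Notation wd := (wd N).
Local Notation homG := (homdeg N).
Local Notation homC := (homC N).
Local Notation inK := (inK N).
Local Notation mono := (monom N).
Local Notation one := (@shone K I).
Local Notation lt := (@letter K I).
Local Notation "x ** y" := (mul N x y) (at level 40, left associativity).
Implicit Types (x z : Sh) (g h : gT).

Variables (m : nat) (T : {set m.+1.-tuple I}) (y : m.+1.-tuple I -> Sh).
Hypothesis mmax : forall n x, (m < n)%N -> inK x -> homC 1 n x -> x = 0.
Hypothesis yP : forall t, t \in T -> [/\ inK (y t), homC 1 m (y t) & homG (wd t) (y t)].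
Hypothesis yE : forall t t', t \in T -> t' \in T -> y t t' = (t == t')%:R.
Hypothesis ysum : forall x, inK x -> homC 1 m x -> x = \sum_(t in T) x t *: y t.

Local Notation rI := (rI N T).
Local Notation N' := (rN yP yE ysum).
Local Notation Phi := (@Phi _ _ _ N m T).
Local Notation act' := (shact N').
Local Notation cA' := (countA N').
Local Notation cC' := (countC N').
Local Notation inB' := (nicholsB N').
Local Notation mono' := (monom N').
Local Notation lt' := (@letter K rI).
Local Notation CI := ({c | c \in col}).
Local Notation inlw := (map (inl : CI -> rI)).
Local Notation "x *' y" := (mul N' x y) (at level 40, left associativity).
Implicit Types (F G : seq rI -> K^o) (u v : seq CI).

(** The factorisation of the reflected Nichols algebra into the image of K and the Nichols algebra
    of C^*. Homogeneity of [k] is recorded for [Phi_dl] and for counting degrees. *)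
Definition PhiKB : (seq rI -> K^o) -> Prop :=
  linspan (fun F => exists k u, [/\ inK k, exists g, homG g k,
    exists p q, homC p q k & F = Phi k *' mono' (inlw u)]).

Lemma inB_PhiKB F : inB' F -> PhiKB F.
Proof.
have sS : lsub PhiKB by apply: span_lsub.
move=> BF; pattern F; apply: span_sub BF => // _ [v ->].
elim: v => [|i v IH] /=.
  apply: span_gen; exists one, [::]; rewrite (Phi_one yP yE) mul1sh; split=> //.
  - exact: inK_one.
  - by exists 1%g; apply: homG_one.
  - by exists 0%N, 0%N => w /one_supp ->.
have lS : lsub (fun F => PhiKB (lt' i *' F)) by apply: (lsub_preim (mul N' (lt' i))).
apply: (span_sub lS _ IH) => _ [k [u [Kk [g gk] [p [q hk]] ->]]]; rewrite shmulA.
case: i {IH lS} => [c|t].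
  (* A letter of C^* moves to the right of [Phi k] at the cost of a left derivative, which stays in
     K. *)
  have -> : lt' (inl c) *' Phi k =
      Phi (dl (val c) k) + Phi k *' act' g^-1 (lt' (inl c)).
    by rewrite (Phi_dl mmax yP yE ysum _ Kk gk) subrK.
  rewrite shmulDl; apply: lsubD (sS) _ _.
    apply: span_gen; exists (dl (val c) k), u; split=> //; first exact: inK_dl.
      by exists ((dg (val c))^-1 * g)%g; apply: homG_dl.
    by exists p, q.-1; apply: homC_dl (valP c) hk.
  rewrite act_lt shmul_sumr shmul_suml; apply: lsub_sum (sS) _ => -[d|t] _.
    rewrite shmulZr shmulZl -shmulA; apply: lsubZ (sS) _.
    apply: span_gen; exists k, (d :: u); split=> //; first by exists g.
    by exists p, q.
  by rewrite shmulZr shmulZl /= scale0r; apply: sS.1.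
have [Ky hy gy] := yP (valP t).
rewrite -(Phi_y mmax yP yE) -(Phi_mul mmax yP yE ysum) //.
apply: span_gen; exists (y (val t) ** k), u; split=> //; first exact: inK_mul.
  by exists (wd (val t) * g)%g; apply: homG_mul.
by exists (1 + p)%N, (m + q)%N; apply: homC_mul.
Qed.

Definition strip (w : seq rI) : seq I :=
  pmap (fun i : rI => if i is inl c then Some (val c) else None) w.
(** The pairing of the word [s] in C^*, prefixed by [e], with [w]. The prefix is there for the
    induction: a derivative along C^* lengthens it, see [dr_pairing]. *)
Definition pairing (e w : seq I) : seq rI -> K^o := fun s => mono (e ++ strip s) w.

Lemma strip_inlw u : strip (inlw u) = map val u.
Proof. by elim: u => //= c u ->. Qed.

Lemma dr_pairing e w d : dr (inl d) (pairing e w) = pairing (rcons e (val d)) w.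
Proof. by apply/funext => v; rewrite /dr /pairing /= cat_rcons. Qed.

Lemma act_pairing h e w v :
  act' h^-1 (pairing e w) (inlw v) = (mono e ** act h (mono (map val v))) w.
Proof.
elim: v e => [|d v IH] e; first by rewrite /= act_one shmul1 /pairing cats0.
rewrite /= big_sumType /= [X in _ + X]big1 ?addr0 => [|t _]; last by rewrite mul0r.
rewrite act_mul act_lt shmul_suml shmul_sumr fct_sumE.
rewrite [RHS](bigID (mem col)) /= [X in _ = _ + X]big1 ?addr0; last first.
  move=> c Ac; have [->|/coC dc] := eqVneq (co h (val d) c) 0.
    by rewrite shmulZl scale0r shmul0.
  by have := valP d; rewrite /= -topredE /= dc -[col c]/(c \in col) (negPf Ac).
rewrite (big_sub (mem col)
  (fun c => (mono e ** (co h (val d) c *: lt c ** act h (mono (map val v)))) w)).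
apply: eq_bigr => c _; rewrite invgK dr_pairing IH mono_rcons.
by rewrite shmulZl shmulZr shmulA.
Qed.

Lemma lt_pairing e i w v :
  (mono e ** dr (val i) (mono (map val v))) w = (lt' (inl i) *' pairing e w) (inlw v).
Proof.
elim: v e => [|d v IH] e; first by rewrite /= dr_one shmul0 mul0r.
transitivity ((mono (rcons e (val d)) ** dr (val i) (mono (map val v))) w
    + (val i == val d)%:R * (mono e ** act (dg (val i)) (mono (map val v))) w).
  by rewrite /= dr_mul dr_lt shmulZl mul1sh shmulDr shmulZr shD shZ shmulA mono_rcons.
rewrite -[RHS]/(dr (inl d) _ (inlw v)) dr_mul dr_pairing shD -IH dr_lt shmulZl mul1sh.
rewrite shZ act_pairing -[inl d == inl i]/(d == i) [d == i]eq_sym val_eqE; congr (_ + _).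
by case: (i =P d) => [->|_]; rewrite ?mul0r.
Qed.

Lemma agree_act h F G v : (forall v, F (inlw v) = G (inlw v)) ->
  act' h F (inlw v) = act' h G (inlw v).
Proof.
elim: v F G => [|d v IH] F G FG /=; first exact: (FG [::]).
apply: eq_bigr => -[c|t] _; last by rewrite !mul0r.
by congr (_ * _); apply: IH => u; apply: (FG (c :: u)).
Qed.

Lemma agree_lt i F G v : (forall v, F (inlw v) = G (inlw v)) ->
  (lt' i *' F) (inlw v) = (lt' i *' G) (inlw v).
Proof.
elim: v F G => [|d v IH] F G FG /=; first by rewrite -(FG [::]).
rewrite (IH (dr (inl d) F) (dr (inl d) G)) => [|u]; last exact: (FG (d :: u)).
by rewrite !dr_lt !shmulZl !mul1sh !shZ (agree_act _ _ FG).
Qed.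

(** The quantum symmetriser of C^* is the transpose of that of C, because left multiplication by a
    dual letter is adjoint to a right derivative. So long monomials in C^* vanish along with those
    in C. *)
Lemma dual_mono u v : mono' (inlw u) (inlw v) = mono (map val v) (map val u).
Proof.
elim: u v => [|i u IH] v /=; first by case: v => [|c v] //=; rewrite mul0r.
rewrite (@agree_lt _ _ (pairing [::] (map val u))) => [|v'].
  by rewrite -lt_pairing mul1sh.
by rewrite IH /pairing strip_inlw.
Qed.

Lemma cC_inlw u : cC' (inlw u) = 0%N.
Proof. by elim: u. Qed.

Lemma cA_inlw u : cA' (inlw u) = size u.
Proof. by elim: u => //= c u <-. Qed.

Lemma cC_inlwP w : cC' w = 0%N -> exists v, w = inlw v.
Proof.
elim: w => [|[c|t] w IH] //; first by exists [::].
by rewrite /countC /= add0n => /IH[v ->]; exists (c :: v).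
Qed.

Lemma mono_inlw_nil L u : nil_at N L -> (L <= size u)%N -> mono' (inlw u) = 0.
Proof.
move=> nL Lu; apply/funext => w; apply/eqP; apply: contraTT isT => nz.
have [_] := mono_supp nz; rewrite cC_inlw => /cC_inlwP[v wv].
move: (nz); rewrite wv dual_mono nL ?eqxx // size_map.
by have := mono_size nz; rewrite wv !size_map => ->.
Qed.

(** Degrees in the factorisation [inB_PhiKB]: [s] has the degree of some [Phi k] times a monomial of
    length [n] in C^*. It serves for nilpotency and, in [ladder], for the decrease of [D]. *)
Lemma mono_rN (s : seq rI) : mono' s <> 0 -> exists k p q n,
  [/\ inK k, homC p q k, k <> 0, cC' s = p /\ (cA' s + q = m * p + n)%N
    & forall L, nil_at N L -> (n < L)%N].
Proof.
move=> nz; have [w vw] : exists w, mono' s w != 0.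
  apply: contrapT => no; apply: nz; apply/funext => w; apply/eqP.
  by apply: contra_notT no => xw; exists w.
have [_ [k [u [Kk gk [p [q hk]] ->]]]] := span_nz (inB_PhiKB (inB_mono N' s)) vw.
case/mul_supp => w1 [w2 [P1 M2 eA eC]]; have [<- <-] := mono_supp vw.
have [C1 A1] := Phi_homC yP yE ysum hk P1; have [A2 C2] := mono_supp M2.
exists k, p, q, (size u); split=> //.
- by move=> k0; move: P1; rewrite k0 Phi0 eqxx.
- rewrite eC C1 C2 cC_inlw addn0; split=> //.
  by rewrite eA A2 cA_inlw addnAC A1.
move=> L nL; rewrite ltnNge; apply/negP => /(mono_inlw_nil nL) M0.
by rewrite M0 eqxx in M2.
Qed.

(** For [k] of degree (p, q) one has [p + q < L] and [n < L], and the length is [p + (m p - q + n)],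
    which is less than [(m + 2) L]. *)
Lemma nil_rN L : nil_at N L -> nil_at N' (m.+2 * L).
Proof.
move=> nL v; apply: contraTeq => /eqP/mono_rN[k [p [q [n [[Bk _] hk nz [eC eA] nP]]]]].
have [w kw] : exists w, k w != 0.
  apply: contrapT => no; apply: nz; apply/funext => w; apply/eqP.
  by apply: contra_notT no => xw; exists w.
have := inB_supp nL Bk kw; rewrite (homC_size hk kw) => pL.
have nL' := nP _ nL.
rewrite -ltnNge (size_cAC N') eC.
have : (m * p <= m * L)%N by rewrite leq_mul2l; lia.
lia.
Qed.

End ReflectionFinite.

(** * Iterated reflections *)

(* All suffixes of a word of colours have nonnegative weight, where the letters
   of [C] weigh [i] and those of [A] weigh [- j].  The words
   of degree [(i, j)] in [(A, C)] have weight zero, hence begin with a letter of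
   [A] if [0 < i]: a function supported on them is killed by the right
   derivatives along [C]. *)
Fixpoint goodc (i j : nat) (s : seq bool) : bool :=
  if s is _ :: s' then (j * count negb s <= i * count id s)%N && goodc i j s' else true.

Lemma goodc_head i j s : goodc i j s -> (j * count negb s <= i * count id s)%N.
Proof. by case: s => [|b s] /=; [rewrite muln0|case/andP]. Qed.

Lemma goodc_suffix i j s s' : goodc i j (s ++ s') -> goodc i j s'.
Proof. by elim: s => //= b s IH /andP[_ /IH]. Qed.

Lemma goodc_ins i j a b : goodc i j (a ++ b) -> goodc i j (a ++ true :: b).
Proof.
elim: a => [|x a IH] /=; first by move=> gb; have := goodc_head gb; rewrite gb andbT; lia.
case/andP => h /IH ->; rewrite andbT; move: h.
by rewrite !count_cat /=; lia.
Qed.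

Section Ladder.

Context {K : fieldType} {gT : finGroupType}.

Section Step.

Context {I : finType} (N : ydData K gT I).

Local Notation Sh := (seq I -> K^o).
Local Notation col := (col N).
Local Notation act := (shact N).
Local Notation wd := (wd N).
Local Notation homG := (homdeg N).
Local Notation homC := (homC N).
Local Notation cA := (countA N).
Local Notation cC := (countC N).
Local Notation inB := (nicholsB N).
Local Notation kC := (kC N).
Local Notation Rc := (adC N).
Local Notation mono := (monom N).
Local Notation lt := (@letter K I).
Local Notation "x ** y" := (mul N x y) (at level 40, left associativity).
Implicit Types (x z : Sh) (g h : gT).

Definition Good i j x : Prop := forall w, x w != 0 -> goodc i j (map col w).

Lemma cAE w : cA w = count negb (map col w). Proof. by rewrite count_map. Qed.
Lemma cCE w : cC w = count id (map col w). Proof. by rewrite count_map. Qed.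

Lemma ltmul_ins c x w : col c -> (lt c ** x) w != 0 -> exists v a b,
  [/\ x v != 0, map col v = a ++ b & map col w = a ++ true :: b].
Proof.
move=> Cc; elim: w x => [|j w IH] x /=; first by rewrite mul0r eqxx.
case/add_neq0 => [/IH[v [a [b [xv va wa]]]]|].
  by exists (j :: v), (col j :: a), b; rewrite /= va wa.
rewrite dr_lt shmulZl mul1sh shZ mulf_eq0 negb_or.
have [->|_] := eqVneq j c; last by rewrite eqxx.
by move=> /andP[_ /act_supp[v xv e]]; exists v, [::], (map col v); rewrite e Cc.
Qed.

Lemma mullt_ins c x w : col c -> (x ** lt c) w != 0 -> exists v a b,
  [/\ x v != 0, map col v = a ++ b & map col w = a ++ true :: b].
Proof.
elim: w x c => [|j w IH] x c Cc /=; first by rewrite mulr0 eqxx.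
case/add_neq0.
  rewrite dr_lt shmulZr shmul1 shZ mulf_eq0 negb_or.
  have [->|_] := eqVneq j c; last by rewrite eqxx.
  by move=> /andP[_ xw]; exists w, [::], (map col w); rewrite Cc.
rewrite act_lt shmul_sumr fct_sumE => /sum_neq0[k _].
rewrite shmulZr shZ mulf_eq0 negb_or => /andP[/coC ck].
rewrite ck in Cc => /(IH _ _ Cc)[v [a [b [xv va wa]]]].
by exists (j :: v), (col j :: a), b; rewrite /= va wa.
Qed.

Lemma Good_act i j h x : Good i j x -> Good i j (act h x).
Proof. by move=> gx w /act_supp[v /gx + <-]. Qed.

Lemma Good_Rc i j c x : col c -> Good i j x -> Good i j (Rc c x).
Proof.
move=> Cc gx w; rewrite /adC shD shN => /add_neq0[|].
  by case/(mullt_ins Cc) => v [a [b [/gx]]] /[swap] -> + ->; apply: goodc_ins.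
rewrite oppr_eq0 => /(ltmul_ins Cc)[v [a [b [/(Good_act gx)]]]] /[swap] -> + ->.
exact: goodc_ins.
Qed.

Lemma Good_drw i j w x : Good i j x -> Good i j (drw w x).
Proof. by move=> gx v /gx; rewrite map_cat => /goodc_suffix. Qed.

Lemma homC_drw p q w v x : homC p q x -> drw w x v != 0 -> homC (cA v) (cC v) (drw w x).
Proof.
move=> hx xv u /hx; have := hx _ xv; rewrite /countA /countC !count_cat => -[<- <-] [].
by move=> /addnI -> /addnI ->.
Qed.

Lemma nz_ex x : x <> 0 -> exists w, x w != 0.
Proof.
move=> nz; apply: contrapT => no; apply: nz; apply/funext => w; apply/eqP.
by apply: contra_notT no => xw; exists w.
Qed.

Definition resG g x : Sh := fun w => if wd w == g then x w else 0.

Fact resG_linear g : linear (resG g).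
Proof. by move=> a x z; apply/funext => w; rewrite shL /resG; case: eqP; rewrite ?mulr0 ?addr0. Qed.
HB.instance Definition _ g := GRing.isLinear.Build K Sh Sh *:%R (resG g) (resG_linear g).

Lemma resG_sum x : x = \sum_g resG g x.
Proof.
apply/funext => w; rewrite fct_sumE (bigD1 (wd w)) //= big1 ?addr0 => [|g ne].
  by rewrite /resG eqxx.
by rewrite /resG eq_sym (negPf ne).
Qed.

Lemma homG_resG g x : homG g (resG g x).
Proof. by move=> w; rewrite /resG; case: (wd w =P g) => //; rewrite eqxx. Qed.

Lemma resG_id g h x : homG h x -> resG g x = if g == h then x else 0.
Proof.
move=> hx; apply/funext => w; rewrite /resG.
have [x0|/hx ->] := eqVneq (x w) 0; first by rewrite x0; do 2!case: ifP.
by rewrite eq_sym; case: eqP.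
Qed.

Lemma inB_mono_ex p q x : inB x -> homC p q x -> x <> 0 ->
  exists v, [/\ mono v <> 0, cA v = p & cC v = q].
Proof.
move=> Bx hx /nz_ex[w xw]; have [_ [v ->] vw] := span_nz Bx xw; exists v.
have [<- <-] := mono_supp vw; have [-> ->] := hx _ xw; split=> // v0.
by rewrite v0 eqxx in vw.
Qed.

Lemma mullt_nz c x : kC x -> col c -> x <> 0 -> x ** lt c <> 0.
Proof.
move=> kx Cc nz /(congr1 (dr c)); rewrite dr_mul kx // mul0sh addr0 dr_lt eqxx.
by rewrite scale1r shmul1.
Qed.

End Step.

Section PhiGood.

Context {I : finType} (N : ydData K gT I).
Local Notation Sh := (seq I -> K^o).
Variables (m : nat) (T : {set m.+1.-tuple I}) (y : m.+1.-tuple I -> Sh).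
Hypothesis mmax : forall n x, (m < n)%N -> inK N x -> homC N 1 n x -> x = 0.
Hypothesis yP :
  forall t, t \in T -> [/\ inK N (y t), homC N 1 m (y t) & homdeg N (wd N t) (y t)].
Hypothesis yE : forall t t', t \in T -> t' \in T -> y t t' = (t == t')%:R.
Hypothesis ysum : forall x, inK N x -> homC N 1 m x -> x = \sum_(t in T) x t *: y t.
Local Notation N' := (rN yP yE ysum).

(** For [i' = m i - j] the inequality [i (m p - q) <= i' p] amounts to [j p <= i q], the weight
    condition for full words of [x]. Proper suffixes are full words for the derivatives [rR e x],
    which are good again. *)
Lemma Phi_good i j i' p q (x : Sh) : (i' + j = m * i)%N ->
  inK N x -> homC N p q x -> Good N i j x -> Good N' i' i (Phi (N := N) (T := T) x).
Proof.
move=> iE Kx hx gx w; elim: w p q x Kx hx gx => [//|e w IH] p q x Kx hx gx nz.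
have -> : goodc i' i (map (col N') (e :: w)) =
    (i * countA N' (e :: w) <= i' * countC N' (e :: w))%N && goodc i' i (map (col N') w).
  by rewrite cAE cCE.
apply/andP; split.
  have [-> aE] := Phi_homC yP yE ysum hx nz.
  have [|v xv] := @nz_ex _ x; first by move=> x0; move: nz; rewrite x0 Phi0 eqxx.
  have [vA vC] := hx _ xv; have := goodc_head (gx _ xv).
  by rewrite -cAE -cCE vA vC => g; nia.
have Kr := inK_rR mmax yP yE e Kx.
case: e nz Kr => [c|t] nz Kr.
  exact: (IH _ _ _ Kr (homC_Rc (valP c) hx) (Good_Rc (valP c) gx)).
have [|v rv] := @nz_ex _ (drw (val t) x).
  by move=> r0; move: nz; rewrite /= r0 Phi0 eqxx.
exact: (IH _ _ _ Kr (homC_drw hx rv) (Good_drw gx)).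
Qed.

End PhiGood.

(** [Z] is carried along as an arbitrary graded stable subspace, so that its image under [Phi] can
    take its place; [theta] retains only the action and the degrees. Coprimality makes the last
    degree (0, 1), that of the letters of C. *)
Theorem ladder D : forall (I : finType) (N : ydData K gT I) i j L,
  nil_at N L -> irr N false -> irr N true ->
  (exists a, ~~ col N a) -> (exists c, col N c) -> coprime i j ->
  (forall v, monom N v <> 0 -> (i * countC N v <= j * countA N v + D)%N) ->
  forall Z : (seq I -> K^o) -> Prop, lsub Z ->
  (forall x, Z x -> [/\ nicholsB N x, homC N i j x & Good N i j x]) ->
  (forall h x, Z x -> Z (shact N h x)) -> (forall g x, Z x -> Z (resG N g x)) ->
  (exists2 x, Z x & x <> 0) ->
  exists (J : finType) (M : ydData K gT J) (L' : nat)
      (theta : {linear (seq I -> K^o) -> (J -> K^o)}),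
    [/\ nil_at M L', irr M true
      & forall x, Z x -> [/\ theta x = 0 -> x = 0,
          forall k, theta x k != 0 -> col M k,
          forall h k, theta (shact N h x) k = \sum_l theta x l * co M h l k
        & forall g k, homdeg N g x -> theta x k != 0 -> dg M k = g]].
Proof.
have [n] := ubnP D; elim: n D => // n IH D ltDn I N i j L nL irrA irrC hA hC cop bd.
move=> Z sZ ZP Zact ZG Znz.
have [i0|i_gt0] := posnP i.
  have j1 : j = 1%N by move: cop; rewrite i0 /coprime gcd0n => /eqP.
  (* In degree (0, 1) the elements are combinations of letters of C, and [theta] reads the
     coefficients. *)
  pose theta (x : seq I -> K^o) : I -> K^o := fun k => x [:: k].
  have lin : linear theta by [].
  pose B := GRing.isLinear.Build K _ _ *:%R theta lin.
  pose thetaL : {linear (seq I -> K^o) -> (I -> K^o)} := HB.pack theta B.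
  exists I, N, L, thetaL; split=> // x Zx; have [_ hx _] := ZP x Zx.
  have xc w : x w != 0 -> exists2 k, w = [:: k] & col N k.
    move=> /hx[]; rewrite i0 j1; case: w => [|k [|l w]] //.
      by rewrite /countA /countC /=; case: (boolP (col N k)) => // Ck _ _; exists k.
    move=> a c; have := size_cAC N [:: k, l & w].
    by rewrite a c.
  split=> [x0|k /xc[_ [->]]//|h k|g k hg].
  - apply: contrapT => /nz_ex[w /[dup] /xc[k -> _]].
    by move: (congr1 (fun F => F k) x0) => /= e; rewrite -[x _]/(theta x k) e eqxx.
  - by rewrite /= /theta; apply: eq_bigr => l _; rewrite mulrC.
  - by move=> /hg; rewrite /= mul1g.
have ZK x : Z x -> inK N x.
  move=> /ZP[Bx hx gx]; split=> // c Cc; apply/funext => w; apply/eqP.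
  apply: contraTT isT => nz; have [] := hx _ nz; have := gx _ nz.
  rewrite /= Cc add0n => /andP[_ /goodc_head]; rewrite -cAE -cCE.
  by rewrite /countA /countC /= => + e1 e2; rewrite add0n in e1; rewrite e1 -e2; nia.
have [m [[x1 [Kx1 hx1 nx1]] mmax]] := max_deg nL hA.
have [T [y [yP yE ysum]]] := extremal_basis N m.
have Tnz : exists t, t \in T.
  apply: contrapT => no; apply: nx1; rewrite (ysum _ Kx1 hx1) big1 // => t tT.
  by case: no; exists t.
have PhiG g x : Z x -> resG (rN yP yE ysum) g (Phi (N := N) (T := T) x) = Phi (resG N g x).
  move=> Zx; rewrite {1}(resG_sum N x) Phi_sum linear_sum /= (bigD1 g) //= big1 ?addr0.
    by rewrite (resG_id _ (Phi_homG yP yE ysum (@homG_resG _ N _ _))) eqxx.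
  move=> h /negPf ne.
  by rewrite (resG_id _ (Phi_homG yP yE ysum (@homG_resG _ N _ _))) eq_sym ne.
(* [Phi_inj] is about homogeneous elements, so elements of [Z] are split into components, which lie
   in [Z] again. *)
have Phi0_Z x : Z x -> Phi (N := N) (T := T) x = 0 -> x = 0.
  move=> Zx P0; rewrite (resG_sum N x) big1 // => g _.
  have Zg := ZG g x Zx; have [_ hg _] := ZP _ Zg.
  apply: (Phi_inj mmax yP yE ysum irrA Tnz (ZK _ Zg) (@homG_resG _ N g x) hg).
  by rewrite -PhiG // P0 linear0.
have [x0 Zx0 nz0] := Znz.
have /nz_ex[w0 nzw0] : Phi (N := N) (T := T) x0 <> 0 by move/(Phi0_Z _ Zx0).
have [_ hx0 _] := ZP _ Zx0; have [wC wA] := Phi_homC yP yE ysum hx0 nzw0.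
(* The nonzero value [Phi x0 w0] shows [j <= m i], so [i'] is [m i - j] without truncation. *)
set i' := countA _ w0 in wA.
have [c Cc] := hC.
have iD : (i <= D)%N.
  have := bd [:: c]; rewrite /= shmul1 /countA /countC /= Cc /= !addn0 muln1 muln0 add0n; apply.
  by move/(congr1 (fun F : seq I -> K^o => F [:: c]))/eqP; rewrite /letter eqxx oner_eq0.
have ltD' : (D - i < n)%N by lia.
have cop' : coprime i' i.
  have d1 : (gcdn i' i %| i')%N := dvdn_gcdl _ _.
  have d2 : (gcdn i' i %| i)%N := dvdn_gcdr _ _.
  have d3 : (gcdn i' i %| j)%N by rewrite -(dvdn_addr _ d1) wA dvdn_mull.
  by rewrite /coprime -dvdn1 -(eqP cop) dvdn_gcd d2 d3.
(* The old bound is applied not to the element [k] of degree (p, q) behind [v], but to [k c] of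
   degree (p, q + 1); this gains [i]. *)
have bd' v : monom (rN yP yE ysum) v <> 0 ->
    (i' * countC (rN yP yE ysum) v <= i * countA (rN yP yE ysum) v + (D - i))%N.
  case/(mono_rN mmax) => k [p [q [r [[Bk kk] hk nk [eC eA] _]]]].
  have : mul N k (letter c) <> 0 by apply: mullt_nz.
  have hkc : homC N (p + 0) (q + 1) (mul N k (letter c)).
    by apply: homC_mul hk _ => w /lt_supp ->; rewrite /countA /countC /= Cc.
  case/(inB_mono_ex (inB_mul Bk (inB_lt N c)) hkc) => u [/bd bu uA uC].
  rewrite uA uC addn0 in bu; rewrite eC; nia.
pose Z' F := exists2 x, Z x & F = Phi (N := N) (T := T) x.
have Z'P F : Z' F -> [/\ nicholsB (rN yP yE ysum) F, homC (rN yP yE ysum) i' i F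
    & Good (rN yP yE ysum) i' i F].
  case=> x Zx ->; have [Bx hx gx] := ZP _ Zx; split.
  - exact: (Phi_inB mmax yP yE ysum irrA Tnz (ZK _ Zx)).
  - move=> w /(Phi_homC yP yE ysum hx)[-> e]; split=> //.
    by apply: (@addIn j); rewrite e.
  exact: (Phi_good mmax yP yE ysum wA (ZK _ Zx) hx gx).
have [J [M [L' [theta [nM irrM thP]]]]] : exists (J : finType) (M : ydData K gT J) (L' : nat)
      (theta : {linear (seq (rI N T) -> K^o) -> (J -> K^o)}),
    [/\ nil_at M L', irr M true
      & forall x, Z' x -> [/\ theta x = 0 -> x = 0,
          forall k, theta x k != 0 -> col M k,
          forall h k, theta (shact (rN yP yE ysum) h x) k = \sum_l theta x l * co M h l k
        & forall g k, homdeg (rN yP yE ysum) g x -> theta x k != 0 -> dg M k = g]].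
  apply: (IH _ ltD' _ (rN yP yE ysum) i' i _ (nil_rN mmax yP yE ysum nL)) => //.
  - exact: irr_rN_false.
  - exact: irr_rN_true.
  - by exists (inl (exist (fun c => c \in col N) c Cc)).
  - by have [t tT] := Tnz; exists (inr (exist (fun t => t \in T) t tT)).
  - split=> [|a _ _ [x Zx ->] [z Zz ->]]; first by exists 0; rewrite ?Phi0 //; apply: sZ.1.
    by exists (a *: x + z); rewrite ?PhiD ?PhiZ //; apply: sZ.2.
  - move=> h _ [x Zx ->]; exists (shact N h x); first exact: Zact.
    by rewrite (Phi_act mmax yP yE ysum) //; apply: ZK.
  - by move=> g _ [x Zx ->]; exists (resG N g x); [apply: ZG|rewrite PhiG].
  - by exists (Phi (N := N) (T := T) x0); [exists x0|move/(Phi0_Z _ Zx0)].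
exists J, M, L', (theta \o Phi (N := N) (T := T)); split=> // x Zx.
have [th0 thC tha thG] := thP (Phi x) (ex_intro2 _ _ _ Zx erefl).
split=> [/th0/(Phi0_Z _ Zx)//|//|h k|g k hx].
  by rewrite /= (Phi_act mmax yP yE ysum) ?tha //; apply: ZK.
by apply: thG; apply: (Phi_homG yP yE ysum hx).
Qed.

End Ladder.

(** * Nichols algebras inside quantum shuffle algebras *)

Record homBasis (K : fieldType) (gT : finGroupType) (U : ydModule K gT) (I : finType) :=
  HomBasis {
  hb : I -> U;
  hcf : {linear U -> (I -> K^o)};
  hdg : I -> gT;
  hb_sum : forall x, x = \sum_i hcf x i *: hb i;
  hcf_b : forall i j, hcf (hb i) j = (i == j)%:R;
  hgr : forall s i, ydgr U s (hb i) = if s == hdg i then hb i else 0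
}.

Section DataOfBasis.

Context {K : fieldType} {gT : finGroupType} {U : ydModule K gT} {I : finType}.
Variables (B : homBasis U I) (colf : I -> bool).

Local Notation b := (hb B).
Local Notation cf := (hcf B).
Local Notation dgf := (hdg B).

Definition bco h i j : K := cf (ydact U h (b i)) j.

Hypothesis colP : forall h i j, bco h i j != 0 -> colf i = colf j.

Lemma ydact_b h i : ydact U h (b i) = \sum_j bco h i j *: b j.
Proof. exact: hb_sum. Qed.

Lemma hcf_gr s x j : cf (ydgr U s x) j = if s == dgf j then cf x j else 0.
Proof.
have cfZ a i : cf (ydgr U s (a *: b i)) j = a * cf (ydgr U s (b i)) j.
  by rewrite !linearZ_LR.
rewrite [x in LHS](hb_sum B) linear_sum (bigD1 j) //= linearD /= shD cfZ.
rewrite linear_sum fct_sumE /= big1 => [|i /negPf ne]; rewrite ?cfZ hgr.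
  by case: ifP => _; rewrite ?linear0 ?hcf_b ?eqxx ?mulr1 ?mulr0 addr0.
by case: ifP => _; rewrite ?linear0 ?hcf_b ?ne mulr0.
Qed.

Fact bco1 i j : bco 1%g i j = (i == j)%:R.
Proof. by rewrite /bco ydact1 id_lfunE hcf_b. Qed.

Fact bcoM h k i l : bco (h * k)%g i l = \sum_j bco k i j * bco h j l.
Proof.
rewrite /bco ydactM comp_lfunE {1}[ydact U k _](hb_sum B) !linear_sum fct_sumE.
by apply: eq_bigr => j _; rewrite linearZ_LR /= linearZ_LR.
Qed.

Fact bcoD h i j : bco h i j != 0 -> dgf j = (h * dgf i * h^-1)%g.
Proof.
rewrite /bco -[b i](_ : ydgr U (dgf i) (b i) = _); last by rewrite hgr eqxx.
by rewrite ydgr_actE hcf_gr; case: (_ =P dgf j) => [->//|_]; rewrite eqxx.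
Qed.

Definition basisData : ydData K gT I := YdData bco1 bcoM bcoD colP.

Local Notation N := basisData.
Local Notation Sh := (seq I -> K^o).
Local Notation "x ** y" := (mul N x y) (at level 40, left associativity).
Local Notation word := {fmonom 'I_(\dim {:U})}.
Local Notation lt := (@letter K I).
Local Notation act := (shact N).

Definition shvec (x : U) : Sh := \sum_i cf x i *: lt i.

Fact ell_linear : linear shvec.
Proof.
move=> a x y; rewrite /shvec scaler_sumr -big_split; apply: eq_bigr => i _.
by rewrite linearP /= scalerA -scalerDl.
Qed.
HB.instance Definition _ := GRing.isLinear.Build K U Sh *:%R shvec ell_linear.

Lemma ell_b i : shvec (b i) = lt i.
Proof.
rewrite /shvec (bigD1 i) //= hcf_b eqxx scale1r big1 ?addr0 // => j /negPf ne.
by rewrite hcf_b eq_sym ne scale0r.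
Qed.

Lemma act_ell h x : act h (shvec x) = shvec (ydact U h x).
Proof.
rewrite {1}/shvec act_sum [x in RHS](hb_sum B) linear_sum /= linear_sum /=.
apply: eq_bigr => i _; rewrite actZ act_lt linearZ_LR /= linearZ_LR /= ydact_b.
congr (_ *: _); rewrite linear_sum; apply: eq_bigr => j _.
by rewrite linearZ_LR /= ell_b.
Qed.

Definition wordSh (w : seq 'I_(\dim {:U})) : Sh :=
  foldr (fun k F => shvec (ebasis k) ** F) (@shone K I) w.

Lemma wordSh_cat v w : wordSh (v ++ w) = wordSh v ** wordSh w.
Proof. by elim: v => [|k v IH] /=; rewrite ?mul1sh // IH shmulA. Qed.

(** On tensors of a fixed length this is the quantum symmetriser; [Psi_ideal] and [ker_Psi_ideal]
    identify its kernel. *)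
Definition Psi : tensalg U -> Sh := linext (fun w : word => wordSh w).
HB.instance Definition _ := GRing.Linear.on Psi.

Lemma PsiU (w : word) : Psi << w >> = wordSh w.
Proof. exact: linextU. Qed.

Lemma tensalgE (x : tensalg U) : x = \sum_(w <- msupp x) x@_w *: (<< w >> : tensalg U).
Proof.
rewrite {1}[x]monalgE; apply: eq_bigr => w _; apply/malgP => w'.
by rewrite mcoeffZ !mcoeffU mulr_natr.
Qed.

Lemma tensalg_ind (P : tensalg U -> Prop) :
  lsub P -> (forall w, P << w >>) -> forall x, P x.
Proof.
by move=> sP PU x; rewrite [x]tensalgE; apply: lsub_sum (sP) _ => w _; apply: lsubZ (sP) _.
Qed.

Lemma PsiE x : Psi x = \sum_(w <- msupp x) x@_w *: wordSh w.
Proof. by []. Qed.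

Lemma PsiUc c (w : word) : Psi << c *g w >> = c *: wordSh w.
Proof.
have -> : << c *g w >> = c *: (<< w >> : tensalg U).
  by apply/malgP => w'; rewrite mcoeffZ !mcoeffU mulr_natr.
by rewrite linearZ_LR /= PsiU.
Qed.

Lemma Psi_sum (J : Type) (r : seq J) (p : pred J) (G : J -> tensalg U) :
  Psi (\sum_(a <- r | p a) G a) = \sum_(a <- r | p a) Psi (G a).
Proof. exact: linear_sum. Qed.

Lemma PsiM x y : Psi (x * y) = Psi x ** Psi y.
Proof.
rewrite malgME Psi_sum !PsiE shmul_suml; apply: eq_bigr => v _.
rewrite Psi_sum shmul_sumr; apply: eq_bigr => w _.
rewrite PsiUc -[mmul v w]/(fmmul v w) fmmulE wordSh_cat shmulZl shmulZr scalerA.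
by [].
Qed.

End DataOfBasis.

(** * The comultiplication of T(U) as deconcatenation of words *)

Section Comultiplication.

Context {K : fieldType} {gT : finGroupType} {U : ydModule K gT} {I : finType}.
Variables (B : homBasis U I) (colf : I -> bool).
Hypothesis colP : forall h i j, bco B h i j != 0 -> colf i = colf j.

Local Notation N := (basisData colP).
Local Notation Sh := (seq I -> K^o).
Local Notation "x ** y" := (mul N x y) (at level 40, left associativity).
Local Notation word := {fmonom 'I_(\dim {:U})}.
Local Notation lt := (@letter K I).
Local Notation one := (@shone K I).
Local Notation act := (shact N).
Local Notation cf := (hcf B).
Local Notation ell := (@shvec _ _ _ _ B).
Local Notation Psi := (Psi colP).
Local Notation wordSh := (wordSh colP).

Lemma Psi_gen x : Psi (tens_gen x) = ell x.
Proof.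
rewrite /tens_gen Psi_sum [x in RHS](coord_vbasis (memvf x)) linear_sum.
apply: eq_bigr => i _; rewrite !linearZ_LR /= PsiU fmuE /=.
by rewrite shmul1.
Qed.

Lemma Psi1 : Psi 1 = one.
Proof.
by rewrite -[Psi 1]/(Psi << (mone : word) >>) PsiU fm1.
Qed.

Lemma PsiL a x y : Psi (a *: x + y) = a *: Psi x + Psi y.
Proof. exact: linearP. Qed.

Lemma Psi_0 : Psi 0 = 0.
Proof. exact: linear0. Qed.

Lemma tensactL h a (x y : tensalg U) :
  tensact h (a *: x + y) = a *: tensact h x + tensact h y.
Proof. exact: (linext_is_linear _ a x y). Qed.

Lemma tensact0 h : tensact h (0 : tensalg U) = 0.
Proof. by rewrite /tensact /linext msupp0 big_seq_fset0. Qed.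

Lemma Psi_tensact s x : Psi (tensact s x) = act s (Psi x).
Proof.
pattern x; apply: tensalg_ind => [|w].
  split=> [|a y z ey ez]; first by rewrite tensact0 Psi_0 act0.
  transitivity (a *: Psi (tensact s y) + Psi (tensact s z)).
    by rewrite tensactL; apply: PsiL.
  apply: etrans (congr2 (fun F H : Sh => a *: F + H) ey ez) _.
  by rewrite -actZ -actD; apply: (congr1 (act s)); symmetry; apply: PsiL.
rewrite /tensact linextU PsiU; elim: (w : seq _) => [|k v IH] /=.
  by rewrite big_nil Psi1 act_one.
by rewrite big_cons PsiM Psi_gen IH act_mul act_ell.
Qed.

Lemma Psi_gen_bool x (t : bool) : Psi (tens_gen x * t%:R) = t%:R *: ell x.
Proof.
case: t; first by rewrite mulr1 scale1r; apply: Psi_gen.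
by rewrite mulr0 scale0r; apply: Psi_0.
Qed.

Lemma Psi_word_gr1 s k : Psi (word_gr (U := U) s [:: k]) = ell (ydgr U s (ebasis k)).
Proof.
apply: etrans (Psi_sum _ _ _ _) _.
under eq_bigr do rewrite Psi_gen_bool.
rewrite (bigD1 s) //= mulVg eqxx scale1r big1 ?addr0 // => r ne.
by rewrite -eq_mulVg1 (negPf ne) scale0r.
Qed.

Lemma ell_gr s x : ell (ydgr U s x) = \sum_i (if s == hdg B i then cf x i else 0) *: lt i.
Proof. by apply: eq_bigr => i _; rewrite hcf_gr. Qed.

(** [Psi (x) Psi] evaluated at a pair of words, which avoids a tensor product of function spaces. *)
Definition Psi2 (w1 w2 : seq I) : tensalg2 U -> K^o :=
  linext (fun p : word * word => Psi << p.1 >> w1 * Psi << p.2 >> w2 : K^o).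

Lemma Psi2_sum w1 w2 (J : Type) (r : seq J) (p : pred J) (G : J -> tensalg2 U) :
  Psi2 w1 w2 (\sum_(a <- r | p a) G a) = \sum_(a <- r | p a) Psi2 w1 w2 (G a).
Proof. exact: (linear_sum (linext _)). Qed.

Lemma Psi2D w1 w2 x y : Psi2 w1 w2 (x + y) = Psi2 w1 w2 x + Psi2 w1 w2 y.
Proof. exact: (linearD (linext _)). Qed.

Lemma Psi2Z w1 w2 a x : Psi2 w1 w2 (a *: x) = a * Psi2 w1 w2 x.
Proof. exact: (linearZ_LR (linext _)). Qed.

Lemma Psi2U w1 w2 v w : Psi2 w1 w2 << (v, w) >> = Psi << v >> w1 * Psi << w >> w2.
Proof. exact: linextU. Qed.

Lemma Psi2_tens w1 w2 x y : Psi2 w1 w2 (tens x y) = Psi x w1 * Psi y w2.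
Proof.
rewrite /tens Psi2_sum !PsiE !fct_sumE mulr_suml; apply: eq_bigr => v _.
rewrite Psi2_sum mulr_sumr; apply: eq_bigr => w _.
by rewrite Psi2Z Psi2U !PsiU !shZ; apply: mulrACA.
Qed.

Lemma tensUU (v w : word) :
  tens (<< v >> : tensalg U) << w >> = (<< (v, w) >> : tensalg2 U).
Proof.
rewrite /tens !msuppU1 !big_seq_fset1.
by rewrite !mcoeffU1 !eqxx mulr1 scale1r.
Qed.

Lemma tens1E (w : word) : tens (1 : tensalg U) << w >> = (<< (mone, w) >> : tensalg2 U).
Proof. exact: tensUU. Qed.

Lemma tensE1 (w : word) : tens (<< w >> : tensalg U) 1 = (<< (w, mone) >> : tensalg2 U).
Proof. exact: tensUU. Qed.

Lemma Psi2_mul w1 w2 (v w : word) (z : tensalg2 U) :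
  Psi2 w1 w2 (braided_mul << (v, w) >> z) = \sum_(p <- msupp z) z@_p *
    \sum_s (Psi << v >> ** act s (Psi << p.1 >>)) w1 *
           (Psi (tensgr s << w >>) ** Psi << p.2 >>) w2.
Proof.
rewrite /braided_mul linextU /linext Psi2_sum; apply: eq_bigr => p _.
rewrite Psi2Z; congr (_ * _); rewrite Psi2_sum; apply: eq_bigr => s _.
apply: etrans (Psi2_tens _ _ _ _) _.
apply: (congr2 (fun F H : Sh => F w1 * H w2)); last exact: PsiM.
apply: etrans (PsiM _ _ _) _.
by apply: (congr1 (fun F : Sh => Psi << v >> ** F)); apply: Psi_tensact.
Qed.

Lemma Psi_tensgr1 s : Psi (tensgr s << (mone : word) >>) = (s == 1%g)%:R *: one.
Proof.
have -> : tensgr s << (mone : word) >> = (s == 1%g)%:R :> tensalg U.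
  by rewrite /tensgr linextU fm1.
case: (s == 1%g); first by rewrite scale1r; apply: Psi1.
by rewrite scale0r; apply: Psi_0.
Qed.

Lemma Psi_tensgr_fmu s k :
  Psi (tensgr s << (fmu k : word) >>) = ell (ydgr U s (ebasis k)).
Proof.
rewrite -Psi_word_gr1; apply: (congr1 Psi).
by rewrite /tensgr linextU fmuE.
Qed.

Lemma sum_tensgr1 F0 F1 F2 w1 w2 :
  \sum_s (F0 ** act s F1) w1 * (Psi (tensgr s << (mone : word) >>) ** F2) w2
  = (F0 ** F1) w1 * F2 w2.
Proof.
under eq_bigr do rewrite Psi_tensgr1 shmulZl mul1sh shZ.
rewrite (bigD1 1%g) //= eqxx mul1r act1 big1 ?addr0 // => s /negPf ->.
by rewrite mul0r mulr0.
Qed.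

Lemma sum_tensgr_fmu k F1 F2 w1 w2 :
  \sum_s (Psi << (mone : word) >> ** act s F1) w1 *
         (Psi (tensgr s << (fmu k : word) >>) ** F2) w2
  = \sum_i cf (ebasis k) i * (act (hdg B i) F1 w1 * (lt i ** F2) w2).
Proof.
under eq_bigr => s _ do rewrite (Psi1 : Psi << (mone : word) >> = one) mul1sh
  Psi_tensgr_fmu ell_gr shmul_suml fct_sumE mulr_sumr.
rewrite exchange_big; apply: eq_bigr => i _ /=.
rewrite (bigD1 (hdg B i)) //= eqxx big1 => [|s /negPf ->].
  by rewrite addr0 shmulZl shZ mulrCA.
by rewrite scale0r mul0sh mulr0.
Qed.

(** [Psi] is a coalgebra map for deconcatenation; the first tensor factor reads the tail [w1], since
    words are reversed. The step for one letter is [drw_ltmul]. *)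
Lemma Psi2_word w1 w2 (w : seq 'I_(\dim {:U})) :
  Psi2 w1 w2 (word_comul (U := U) w) = wordSh w (w2 ++ w1).
Proof.
elim: w w1 w2 => [|k w IH] w1 w2 /=.
  apply: etrans (Psi2_tens _ _ _ _) _.
  apply: etrans (congr1 (fun F : Sh => F w1 * F w2) Psi1) _.
  by case: w2 w1 => [|j w2] [|l w1]; rewrite /= ?mulr1 ?mul1r ?mul0r ?mulr0.
set z := word_comul w.
have -> : braided_mul (tens << fmu k >> 1 + tens 1 << fmu k >>) z =
    braided_mul (<< (fmu k, mone) >>) z + braided_mul (<< (mone, fmu k) >>) z.
  by rewrite tensE1 tens1E; apply: (linearD (linext _)).
apply: etrans (Psi2D _ _ _ _) _.
apply: etrans (congr2 +%R (Psi2_mul _ _ _ _ _) (Psi2_mul _ _ _ _ _)) _.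
have FE v v' : wordSh w (v ++ v') =
    \sum_(p <- msupp z) (z@_p *: Psi << p.1 >>) v' * Psi << p.2 >> v.
  rewrite -IH -/z /Psi2 /linext; apply: eq_bigr => p _; rewrite shZ.
  by rewrite -[LHS]/(_ * _) mulrA.
rewrite {1}/shvec shmul_suml fct_sumE.
under [RHS]eq_bigr do rewrite shmulZl shZ (drw_ltmul _ _ _ _ FE) mulr_sumr.
rewrite [RHS]exchange_big -big_split; apply: eq_bigr => p _ /=.
apply: etrans (congr2 (fun a b => z@_p * a + z@_p * b)
  (sum_tensgr1 _ _ _ _ _) (sum_tensgr_fmu _ _ _ _ _)) _.
move: (Psi << p.1 >>) (Psi << p.2 >>) => F1 F2.
rewrite PsiU fmuE /= shmul1 /shvec shmul_suml fct_sumE.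
rewrite mulr_suml !mulr_sumr -big_split; apply: eq_bigr => i _ /=.
rewrite shmulZl shmulZr actZ !shZ mulrDr.
by congr (_ + _); rewrite !mulrA // ?[z@_p * _]mulrC.
Qed.

Lemma Psi2_comul w1 w2 x : Psi2 w1 w2 (comul x) = Psi x (w2 ++ w1).
Proof.
rewrite PsiE fct_sumE /comul /linext Psi2_sum; apply: eq_bigr => w _.
by rewrite Psi2Z Psi2_word shZ.
Qed.

End Comultiplication.

Lemma malgUZ (K : fieldType) (J : choiceType) (c : K) (w : J) :
  << c *g w >> = c *: (<< w >> : {malg K[J]}).
Proof. by apply/malgP => w'; rewrite mcoeffZ !mcoeffU mulr_natr. Qed.

Lemma lsub_mod_span (K : fieldType) (E : lmodType K) (P : E -> Prop) (bs : seq E) :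
  lsub P -> lsub (fun x => exists c : nat -> K, P (x - \sum_(i < size bs) c i *: bs`_i)).
Proof.
move=> sP; split=> [|a y z [c cP] [d dP]].
  exists (fun=> 0); rewrite big1 ?subr0; first by case: sP.
  by move=> i _; rewrite scale0r.
exists (fun i => a * c i + d i).
rewrite (_ : _ - _ = a *: (y - \sum_(i < size bs) c i *: bs`_i)
  + (z - \sum_(i < size bs) d i *: bs`_i)); first exact: (sP.2).
rewrite scalerBr addrACA -opprD scaler_sumr -big_split; congr (_ - _).
by apply: eq_bigr => i _; rewrite scalerDl scalerA.
Qed.

(** * The defining ideal as the kernel of [Psi], finite dimension as nilpotency *)

Section NicholsBridge.

Context {K : fieldType} {gT : finGroupType} {U : ydModule K gT} {I : finType}.
Variables (B : homBasis U I) (colf : I -> bool).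
Hypothesis colP : forall h i j, bco B h i j != 0 -> colf i = colf j.

Local Notation N := (basisData colP).
Local Notation Sh := (seq I -> K^o).
Local Notation "x ** y" := (mul N x y) (at level 40, left associativity).
Local Notation word := {fmonom 'I_(\dim {:U})}.
Local Notation one := (@shone K I).
Local Notation cf := (hcf B).
Local Notation ell := (@shvec _ _ _ _ B).
Local Notation Psi := (Psi colP).
Local Notation wordSh := (wordSh colP).
Local Notation mono := (monom N).

Lemma mul_supp_size (F H : Sh) w : (F ** H) w != 0 ->
  exists u v, [/\ F u != 0, H v != 0 & size w = (size u + size v)%N].
Proof.
case/mul_supp => u [v [Fu Hv eA eC]]; exists u, v; split=> //.
by rewrite !(size_cAC N) eA eC addnACA.
Qed.

Lemma mono_size_supp v w : mono v w != 0 -> size w = size v.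
Proof. by case/mono_supp => eA eC; rewrite !(size_cAC N) eA eC. Qed.

Lemma wordSh_size w v : wordSh w v != 0 -> size v = size w.
Proof.
elim: w v => [|k w IH] v /=; first by move/one_supp ->.
case/mul_supp_size => x [y [ex /IH <- ->]]; suff -> : size x = 1%N by [].
move: ex; rewrite /shvec fct_sumE => /sum_neq0[i _].
by rewrite shZ mulf_eq0 negb_or => /andP[_ /lt_supp ->].
Qed.

Lemma wordSh1 k i : wordSh [:: k] [:: i] = cf (ebasis k) i.
Proof.
rewrite -[wordSh [:: k]]/(ell (ebasis k) ** one) shmul1 /shvec fct_sumE (bigD1 i) //= shZ /letter eqxx mulr1 big1 ?addr0 //.
by move=> j /negPf ne; rewrite shZ /letter eqseq_cons eq_sym ne mulr0.
Qed.

Lemma Psi_at x v : Psi x v =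
  \sum_(w <- msupp x | size (w : seq _) == size v) x@_w * wordSh w v.
Proof.
rewrite PsiE fct_sumE [RHS]big_mkcond; apply: eq_bigr => w _; rewrite shZ.
case: ifP => // /eqP ne; case: (eqVneq (wordSh w v) 0) => [->|/wordSh_size e].
  by rewrite mulr0.
by rewrite e in ne.
Qed.

Lemma Psi_nil x : Psi x [::] = counit x.
Proof.
rewrite Psi_at /counit.
have e (w : word) : (size (w : seq _) == size (Nil I)) = (w == mone).
  by apply/idP/eqP => [/nilP w0|->]; [apply/val_inj; rewrite /= w0 fm1|rewrite fm1].
under eq_bigl do rewrite e.
case: (boolP ((mone : word) \in msupp x)) => m0; last first.
  rewrite big_seq_cond big1 => [|w /andP[wx /eqP ew]]; last by rewrite -ew wx in m0.
  by symmetry; apply: mcoeff_outdom.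
rewrite big_mkcond (big_rem mone) //= eqxx fm1 mulr1 big_seq big1 ?addr0 // => w.
rewrite mem_rem_uniq ?fset_uniq // inE => /andP[/negPf -> //].
Qed.

Lemma Psi_deg1 x i : Psi x [:: i] = \sum_k x@_(fmu k : word) * cf (ebasis k) i.
Proof.
pattern x; apply: tensalg_ind => [|w].
  split=> [|a y z ey ez].
    by rewrite [Psi 0]linear0 big1 // => k _; rewrite mcoeff0 mul0r.
  rewrite (PsiL colP a y z) shL ey ez mulr_sumr -big_split; apply: eq_bigr => k _ /=.
  by rewrite mcoeffD mcoeffZ mulrDl mulrA.
rewrite PsiU; case ew: (w : seq _) => [|k [|l v]].
- rewrite /= /shone /= big1 // => k _; rewrite mcoeffU.
  by case: (w =P _) => [e|]; rewrite ?mul0r //; rewrite e fmuE in ew.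
- have -> : w = fmu k by apply/val_inj; rewrite /= ew fmuE.
  rewrite wordSh1 (bigD1 k) //= mcoeffU eqxx mul1r big1 ?addr0 // => l /negPf ne.
  rewrite mcoeffU; case: (fmu k =P _) => [e|]; rewrite ?mul0r //.
  by have := congr1 val e; rewrite /= !fmuE => -[e']; rewrite e' eqxx in ne.
- rewrite big1 => [|k' _]; last first.
    rewrite mcoeffU; case: (w =P _) => [e|]; rewrite ?mul0r //.
    by rewrite e fmuE in ew.
  by apply/eqP/negP => /negP/wordSh_size.
Qed.

Lemma Psi_deg2 x : deg_ge2 x -> forall v, (size v < 2)%N -> Psi x v = 0.
Proof.
move=> x2 v lt_v; rewrite Psi_at big1 // => w /eqP ew.
by rewrite x2 ?mul0r // ew.
Qed.

(** The coproduct splits off one letter. If [p.1] is in the ideal, induction applies to the shorter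
    word [v]; if [p.2] is, its value at a single letter vanishes because the ideal starts in degree
    2. *)
Lemma Psi_ideal x : nichols_ideal x -> Psi x = 0.
Proof.
have [[_ Ie Id] I2 _] := @nichols_ideal_largest K gT U.
move=> Ix; apply/funext => v; elim: v x Ix => [|i v IH] x Ix.
  by rewrite Psi_nil; apply: Ie.
have [ps [psI dx]] := Id _ Ix.
rewrite -[i :: v]/([:: i] ++ v) -(Psi2_comul colP v [:: i] x) dx.
apply: etrans (Psi2_sum _ _ _ _ _ _) _; rewrite big_seq big1 // => p /psI Ip.
apply: etrans (Psi2_tens _ _ _ _ _) _; case: Ip => Ip.
  by apply: etrans (congr1 ( *%R^~ _) (IH _ Ip)) (mul0r _).
by apply: etrans (congr1 ( *%R _) (Psi_deg2 (I2 _ Ip) _)) (mulr0 _).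
Qed.

Definition mono_tens (v : seq I) : tensalg U :=
  foldr (fun i x => tens_gen (hb B i) * x) 1 v.

Lemma Psi_mono v : Psi (mono_tens v) = mono v.
Proof.
elim: v => [|i v IH]; first exact: Psi1.
apply: etrans (PsiM _ _ _) _; congr (_ ** _); last exact: IH.
by apply: etrans (Psi_gen _ _) _; apply: ell_b.
Qed.

(** If the monomial of [v] is nonzero, so are those of its suffixes. Suffixes of different lengths
    are linearly independent, so [v] cannot be as long as the number of spanning elements. *)
Lemma findim_nil : nichols_findim U -> exists L, nil_at N L.
Proof.
have [[Isub _ _] _ _] := @nichols_ideal_largest K gT U.
case=> bs /choice[c cP]; exists (size bs) => v lt_v.
apply/eqP; apply: contraT => v_nz.
pose n := size bs; pose t (k : 'I_n.+1) := mono_tens (drop k v).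
have mnz (k : 'I_n.+1) : mono (drop k v) != 0.
  by apply: contraNneq v_nz => e; rewrite -(cat_take_drop k v) mono_cat e shmul0.
pose A : 'M[K]_(n.+1, n) := \matrix_(k, i) c (t k) i.
have [u u_nz uA] : exists2 u : 'rV[K]_n.+1, u != 0 & u *m A = 0.
  have : kermx A != 0.
    rewrite -mxrank_eq0 mxrank_ker subn_eq0 -ltnNge ltnS; exact: rank_leq_col.
  by case/rowV0Pn => u /sub_kermxP uA u_nz; exists u.
have Iu : nichols_ideal (\sum_k u 0 k *: t k).
  have -> : \sum_k u 0 k *: t k = \sum_k u 0 k *: (t k - \sum_(i < n) c (t k) i *: bs`_i).
    rewrite -[LHS]subr0 [RHS](_ : _ = \sum_k u 0 k *: t k -
      \sum_k u 0 k *: \sum_(i < n) c (t k) i *: bs`_i); last first.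
      by rewrite -sumrB; apply: eq_bigr => k _; rewrite scalerBr.
    congr (_ - _); under eq_bigr do rewrite scaler_sumr.
    rewrite exchange_big big1 // => i _ /=.
    have := congr1 (fun M : 'rV_n => M 0 i) uA; rewrite !mxE => ei.
    rewrite -[RHS](scale0r bs`_i) -ei scaler_suml; apply: eq_bigr => k _.
    by rewrite mxE scalerA.
  by apply: lsub_sum (Isub) _ => k _; apply: lsubZ (Isub) _; apply: cP.
have eu : \sum_k u 0 k *: mono (drop k v) = 0.
  rewrite -[RHS](Psi_ideal Iu); apply: esym; apply: etrans (Psi_sum _ _ _ _) _.
  apply: eq_bigr => k _; apply: etrans (linearZ_LR _ _ _) _ => /=.
  by apply: (congr1 ( *:%R _)); apply: Psi_mono.
case/negP: u_nz; apply/eqP/rowP => k; rewrite mxE.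
have [w wnz] : exists w, mono (drop k v) w != 0 by apply: nz_ex; apply/eqP.
have := congr1 (fun F : Sh => F w) eu; rewrite fct_sumE (bigD1 k) //= big1 => [|l ne].
  by rewrite addr0 shZ => /eqP; rewrite mulf_eq0 (negPf wnz) orbF => /eqP.
rewrite shZ; have [->|/mono_size_supp e] := eqVneq (mono (drop l v) w) 0; first exact: mulr0.
have := mono_size_supp wnz; rewrite e !size_drop => /eqP.
have [lk ll] : (k <= size v /\ l <= size v)%N.
  by split; apply: leq_trans lt_v; rewrite -ltnS ltn_ord.
rewrite eqn_sub2lE // => /eqP/val_inj el; by rewrite el eqxx in ne.
Qed.

Lemma tensE (x y : tensalg U) :
  tens x y = linext (fun w => linext (fun w' => << (w, w') >> : tensalg2 U) y) x.
Proof.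
rewrite /tens {1}/linext; apply: eq_bigr => w _; rewrite /linext scaler_sumr.
by apply: eq_bigr => w' _; rewrite scalerA.
Qed.

Lemma tensDZl a (x y z : tensalg U) : tens (a *: x + y) z = a *: tens x z + tens y z.
Proof. by rewrite !tensE; apply: (linext_is_linear _ a x y). Qed.

Lemma tensDZr a (x y z : tensalg U) : tens z (a *: x + y) = a *: tens z x + tens z y.
Proof.
rewrite !tensE /linext scaler_sumr -big_split; apply: eq_bigr => w _ /=.
rewrite scalerA mulrC -scalerA -scalerDr; congr (_ *: _).
exact: (linext_is_linear _ a x y).
Qed.

Lemma tens0l (z : tensalg U) : tens 0 z = 0.
Proof. by rewrite tensE /linext msupp0 big_seq_fset0. Qed.

(** Gauss elimination for the kernel of [Psi (x) Psi]: if [Psi b] is nonzero at [w0], multiples of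
    [b] are subtracted from the other second factors to make them vanish at [w0]. The first factor
    of [b] then becomes [a'], whose image must vanish. *)
Lemma tens_split (ps : seq (tensalg U * tensalg U)) :
  (forall v w, \sum_(p <- ps) Psi p.1 v * Psi p.2 w = 0) ->
  exists qs : seq (tensalg U * tensalg U),
    (forall q, q \in qs -> Psi q.1 = 0 \/ Psi q.2 = 0) /\
    \sum_(p <- ps) tens p.1 p.2 = \sum_(q <- qs) tens q.1 q.2.
Proof.
have [n] := ubnP (size ps); elim: n ps => // n IH [|[a b] ps] /= lt_ps ps0.
  by exists [::].
have [b0|/nz_ex[w0 bw0]] := pselect (Psi b = 0).
  have [|v w|qs [qsP eqs]] := IH ps; first by [].
    rewrite -[RHS](ps0 v w) big_cons /= [Psi b w](congr1 (fun F : Sh => F w) b0).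
    by rewrite mulr0 add0r.
  exists ((a, b) :: qs); rewrite !big_cons eqs; split=> // q.
  by rewrite inE => /predU1P[->|/qsP //]; right.
pose mu (p : tensalg U * tensalg U) := Psi p.2 w0 / Psi b w0.
pose sub p : tensalg U * tensalg U := (p.1, - mu p *: b + p.2).
pose a' := a + \sum_(p <- ps) mu p *: p.1.
have PsiD (x y : tensalg U) : Psi (x + y) = Psi x + Psi y by apply: linearD.
have PsiZ c (x : tensalg U) : Psi (c *: x) = c *: Psi x by apply: linearZ_LR.
have a'E v : Psi a' v = Psi a v + \sum_(p <- ps) mu p * Psi p.1 v.
  apply: etrans (congr1 (fun F : Sh => F v) (PsiD _ _)) _; rewrite shD; congr (_ + _).
  apply: etrans (congr1 (fun F : Sh => F v) (Psi_sum _ _ _ _)) _.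
  by rewrite fct_sumE; apply: eq_bigr => p _; apply: (congr1 (fun F : Sh => F v) (PsiZ _ _)).
have a'0 : Psi a' = 0.
  apply/funext => v; rewrite a'E; apply: (mulIf bw0); rewrite [0 v * _]mul0r.
  rewrite mulrDl mulr_suml -[RHS](ps0 v w0) big_cons /=; congr (_ + _).
  by apply: eq_bigr => p _; rewrite mulrAC /mu divfK // mulrC.
have [||qs [qsP eqs]] := IH (map sub ps); first by rewrite size_map.
  move=> v w; rewrite big_map /=.
  have e p : Psi (- mu p *: b + p.2) w = - mu p * Psi b w + Psi p.2 w.
    by apply: (congr1 (fun F : Sh => F w) (PsiL colP _ _ _)).
  under eq_bigr do rewrite e mulrDr; rewrite big_split /=.
  have -> : \sum_(p <- ps) Psi p.1 v * Psi p.2 w = - (Psi a v * Psi b w).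
    by have := ps0 v w; rewrite big_cons => /(canRL (addKr _)); rewrite addr0.
  have := congr1 (fun F : Sh => F v) a'0; rewrite a'E => /eqP.
  rewrite addr_eq0 => /eqP ->; rewrite mulNr opprK mulr_suml -big_split big1 // => p _ /=.
  by rewrite mulNr mulrN mulrCA mulrA addNr.
exists ((a', b) :: qs); rewrite !big_cons -eqs big_map /=; split=> [q|].
  by rewrite inE => /predU1P[->|/qsP //]; left.
have -> : tens a' b = tens a b + \sum_(p <- ps) mu p *: tens p.1 b.
  rewrite /a' addrC -[X in tens X _]addr0 -addrA.
  elim: ps {IH lt_ps ps0 a' a'E a'0 qs qsP eqs} => [|p ps IH].
    by rewrite !big_nil add0r !addr0.
  by rewrite !big_cons -addrA tensDZl IH addrCA.
rewrite -addrA -big_split; congr (_ + _); apply: eq_bigr => p _ /=.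
by rewrite tensDZr scaleNr addrA addrN add0r.
Qed.

(** The kernel is a coideal by [tens_split], and it starts in degree 2 because constant terms and
    linear parts can be read off from [Psi]. *)
Lemma ker_Psi_ideal x : Psi x = 0 -> nichols_ideal x.
Proof.
move=> x0; exists (fun y => Psi y = 0); split=> //.
  split=> [|y y0|y y0].
  - split=> [|a y z y0 z0]; first exact: linear0.
    by apply: etrans (PsiL _ _ _ _) _; rewrite y0 z0 scaler0 addr0.
  - by rewrite -Psi_nil y0.
  - have [|qs [qsP eqs]] := @tens_split
        [seq ((comul y)@_p *: (<< p.1 >> : tensalg U), (<< p.2 >> : tensalg U))
          | p <- msupp (comul y)].
      move=> v w; rewrite big_map -[RHS](congr1 (fun F : Sh => F (w ++ v)) y0).
      rewrite -Psi2_comul /Psi2 {1}/linext; apply: eq_bigr => p _ /=.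
      have -> : Psi ((comul y)@_p *: << p.1 >>) = (comul y)@_p *: Psi << p.1 >>.
        exact: linearZ_LR.
      by rewrite shZ -mulrA.
    exists qs; split=> //; rewrite -eqs big_map [LHS]monalgE; apply: eq_bigr => p _ /=.
    rewrite -[X in tens X _]addr0 tensDZl tens0l addr0 tensUU; case: p => p1 p2.
    exact: malgUZ.
move=> y y0 w lt_w; case ew: (w : seq _) lt_w => [|k [|//]] _.
  have -> : w = mone by apply/val_inj; rewrite /= ew fm1.
  by rewrite -[LHS]/(counit y) -Psi_nil y0.
have -> : w = fmu k by apply/val_inj; rewrite /= ew fmuE.
have e0 : \sum_l y@_(fmu l : word) *: ebasis l = 0.
  rewrite [LHS](hb_sum B) big1 // => i _.
  have -> : cf (\sum_l y@_(fmu l : word) *: ebasis l) i = 0; last exact: scale0r.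
  rewrite linear_sum fct_sumE; apply: etrans (congr1 (fun F : Sh => F [:: i]) y0).
  by rewrite Psi_deg1; apply: eq_bigr => l _; rewrite linearZ_LR.
have := freeP (basis_free (vbasisP {:U})) (fun l => y@_(fmu l : word)); apply.
exact: e0.
Qed.

Lemma mono_wordSh u w :
  (forall v, size v = (size u + size w)%N -> mono v = 0) -> mono u ** wordSh w = 0.
Proof.
elim: w u => [|k w IH] u mono0 /=.
  by rewrite shmul1 mono0 // addn0.
rewrite /shvec shmul_suml shmul_sumr big1 // => i _.
rewrite shmulZl shmulZr shmulA -mono_rcons IH ?scaler0 // => v ev.
by apply: mono0; rewrite ev size_rcons addnS.
Qed.

Lemma nil_findim L : nil_at N L -> nichols_findim U.
Proof.
move=> nilL; pose wds n := [seq (<< (FMonom (val t) : word) >> : tensalg U)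
  | t <- enum {: n.-tuple 'I_(\dim {:U})}].
pose bs := flatten [seq wds n | n <- iota 0 L]; exists bs => x.
have [[Isub _ _] _ _] := @nichols_ideal_largest K gT U.
pattern x; apply: tensalg_ind => [|w].
  exact: lsub_mod_span.
have [lt_w|le_w] := ltnP (size (w : seq _)) L; last first.
  exists (fun=> 0); rewrite big1 ?subr0; last by move=> i _; rewrite scale0r.
  apply: ker_Psi_ideal; rewrite PsiU -[wordSh w](mul1sh N).
  by apply: (@mono_wordSh [::]) => v ev; apply: nilL; rewrite ev.
have /(nthP 0)[m lt_m em] : << w >> \in bs.
  apply/flatten_mapP; exists (size (w : seq _)); first by rewrite mem_iota.
  apply/mapP; exists (in_tuple (w : seq _)); first by rewrite mem_enum.
  by congr << _ >>; apply/val_inj.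
exists (fun i => (i == m)%:R); rewrite (bigD1 (Ordinal lt_m)) //= eqxx scale1r big1.
  by rewrite addr0 em subrr; case: Isub.
by move=> i /negPf ne; rewrite -val_eqE /= in ne; rewrite ne scale0r.
Qed.

End NicholsBridge.

(** * Homogeneous bases of modules and of direct sums *)

Section HomogeneousBasis.

Context {K : fieldType} {gT : finGroupType} (U : ydModule K gT).

Definition hidx : finType := {s : gT & 'I_(\dim (ydcomp U s))}.
Implicit Types (i j : hidx).

Definition hvec i : U := (vbasis (ydcomp U (tag i)))`_(tagged i).

Definition hcoord (x : U) : hidx -> K^o :=
  fun i => coord (vbasis (ydcomp U (tag i))) (tagged i) (ydgr U (tag i) x).

Fact hcoord_linear : linear hcoord.
Proof. by move=> a x y; apply/funext => i; rewrite /hcoord shL !linearP. Qed.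
HB.instance Definition _ := GRing.isLinear.Build K U (hidx -> K^o) *:%R hcoord hcoord_linear.

Lemma ydgr_in s x : ydgr U s x \in ydcomp U s.
Proof. by rewrite memv_img ?memvf. Qed.

Lemma hvec_in i : hvec i \in ydcomp U (tag i).
Proof. by apply: vbasis_mem; rewrite mem_nth ?size_tuple. Qed.

Fact hvec_gr s i : ydgr U s (hvec i) = if s == tag i then hvec i else 0.
Proof.
have /ydcompP <- := hvec_in i; rewrite -comp_lfunE ydgrK.
by case: eqP => _; rewrite ?lfunE //= ; have /ydcompP -> := hvec_in i.
Qed.

Fact hvec_sum x : x = \sum_i hcoord x i *: hvec i.
Proof.
rewrite -[LHS]id_lfunE -(ydgr_sum U) sum_lfunE.
have := @sig_big_dep _ 0 +%R _ (fun s => 'I_(\dim (ydcomp U s))) xpredT (fun _ => xpredT)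
  (fun s k => coord (vbasis (ydcomp U s)) k (ydgr U s x) *: (vbasis (ydcomp U s))`_k).
move=> /= <-; apply: eq_bigr => s _; apply: coord_vbasis (ydgr_in s x).
Qed.

Fact hcoord_b i j : hcoord (hvec i) j = (i == j)%:R.
Proof.
rewrite /hcoord hvec_gr; case: (tag j =P tag i) => [e|ne]; last first.
  by rewrite linear0; case: (i =P j) => // e; rewrite e in ne.
case: i j e => s k [t l] /= e; case: s / e k => k.
rewrite /hvec /= coord_free ?(basis_free (vbasisP _)) // eq_Tagged /=.
by rewrite eq_sym.
Qed.

Definition homogeneous_basis : homBasis U hidx :=
  HomBasis hvec_sum hcoord_b hvec_gr.

End HomogeneousBasis.

Section SumBasis.

Context {K : fieldType} {gT : finGroupType} {V W : ydModule K gT} {I J : finType}.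
Variables (BV : homBasis V I) (BW : homBasis W J).

Definition sum_b (k : I + J) : ydsum V W :=
  match k with inl i => (hb BV i, 0) | inr j => (0, hb BW j) end.
Definition sum_cf (p : ydsum V W) : I + J -> K^o := fun k =>
  match k with inl i => hcf BV p.1 i | inr j => hcf BW p.2 j end.
Definition sum_dg (k : I + J) : gT :=
  match k with inl i => hdg BV i | inr j => hdg BW j end.

Fact sum_cf_linear : linear sum_cf.
Proof. by move=> a p q; apply/funext => -[i|j]; rewrite /sum_cf shL /= linearP. Qed.
HB.instance Definition _ :=
  GRing.isLinear.Build K (ydsum V W) (I + J -> K^o) *:%R sum_cf sum_cf_linear.

Fact sum_b_sum (p : ydsum V W) : p = \sum_k sum_cf p k *: sum_b k.
Proof.
have e1 (q : V * W) : q = (q.1, 0) + (0, q.2).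
  by case: q => v w; rewrite -[RHS]/(_, _) /= addr0 add0r.
rewrite big_sumType [LHS]e1; congr (_ + _).
  rewrite {1}[p.1](hb_sum BV); elim/big_rec2: _ => // i y x _ <-.
  by rewrite -[RHS]/(_, _) /= scaler0 addr0.
rewrite {1}[p.2](hb_sum BW); elim/big_rec2: _ => // i y x _ <-.
by rewrite -[RHS]/(_, _) /= scaler0 addr0.
Qed.

Fact sum_cf_b k l : sum_cf (sum_b k) l = (k == l)%:R.
Proof.
by case: k l => [i|i] [j|j]; rewrite /sum_cf /sum_b /= ?hcf_b // linear0.
Qed.

Fact sum_gr s k : ydgr (ydsum V W) s (sum_b k) = if s == sum_dg k then sum_b k else 0.
Proof.
by case: k => [i|j]; rewrite [LHS]pair_lfunE /= hgr linear0; case: ifP.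
Qed.

Definition sum_basis : homBasis (ydsum V W) (I + J)%type :=
  HomBasis sum_b_sum sum_cf_b sum_gr.

Lemma bco_sum h k l : bco sum_basis h k l =
  match k, l with
  | inl i, inl j => bco BV h i j
  | inr i, inr j => bco BW h i j
  | _, _ => 0
  end.
Proof.
rewrite /bco -[hb _ k]/(sum_b k) [ydact _ _ _](pair_lfunE (ydact V h) (ydact W h)).
by case: k l => [i|i] [j|j]; rewrite /= /sum_cf /= ?linear0.
Qed.

(** The first summand V plays the role of C, and W that of A. *)
Fact sum_colP h k l : bco sum_basis h k l != 0 ->
  (if k is inl _ then true else false) = (if l is inl _ then true else false).
Proof. by rewrite bco_sum; case: k l => [i|i] [j|j] //; rewrite eqxx. Qed.

End SumBasis.

Section Irreducibility.

Context {K : fieldType} {gT : finGroupType} {V : ydModule K gT} {I : finType}.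
Variables (B : homBasis V I).

Definition hform (f : I -> K) (y : V) : K^o := \sum_j hcf B y j * f j.

Fact hform_linear f : linear (hform f).
Proof.
move=> a x y; rewrite /hform scaler_sumr -big_split; apply: eq_bigr => j _ /=.
by rewrite linearP shL mulrDl -mulrA.
Qed.
HB.instance Definition _ f := GRing.isLinear.Build K V K^o *:%R (hform f) (hform_linear f).

(** If all these sums vanished, [f] would kill the submodule generated by [x], which is
    everything. *)
Lemma ydirr_irr (irrV : ydirr V) (u f : I -> K) :
  (exists i, u i != 0) -> (exists i, f i != 0) ->
  exists h s, \sum_i \sum_j (if hdg B i == s then u i else 0) * bco B h i j * f j != 0.
Proof.
move=> [i0 ui0] [j0 fj0]; apply: contrapT => no.
pose x : V := \sum_i u i *: hb B i.
have cfx i : hcf B x i = u i.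
  rewrite linear_sum fct_sumE (bigD1 i) //= linearZ_LR shZ hcf_b eqxx mulr1.
  by rewrite big1 ?addr0 // => j /negPf ne; rewrite linearZ_LR shZ hcf_b ne mulr0.
pose S := (\sum_h \sum_s <[ydact V h (ydgr V s x)]>)%VS.
have SP h s : ydact V h (ydgr V s x) \in S.
  by rewrite memvE (sumv_sup h) // (sumv_sup s) // -memvE.
have Sind (T : {vspace V}) : (forall h s, ydact V h (ydgr V s x) \in T) -> (S <= T)%VS.
  by move=> TP; apply/subv_sumP => h _; apply/subv_sumP => s _; rewrite -memvE.
have Ssub : ydsub S.
  have imS (F : 'End(V)) : (forall h s, F (ydact V h (ydgr V s x)) \in S) -> (F @: S <= S)%VS.
    move=> FS; rewrite !limg_sum; apply/subv_sumP => h _; rewrite limg_sum.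
    by apply/subv_sumP => s _; rewrite limg_line -memvE.
  move=> k; split; apply: imS => h s.
    by rewrite -comp_lfunE -ydactM; apply: SP.
  have -> : k = (h * (h^-1 * k * h) * h^-1)%g by rewrite !mulgA mulgV mul1g mulgK.
  rewrite -ydgr_actE -(comp_lfunE (ydgr V _)) ydgrK.
  by case: eqP => _; rewrite ?lfunE ?linear0 ?mem0v //=; apply: SP.
have xS : x \in S.
  rewrite -[x]id_lfunE -(ydgr_sum V) sum_lfunE; apply: memv_suml => s _.
  by rewrite -[ydgr V s x]id_lfunE -(ydact1 V); apply: SP.
have phiE h s : \sum_j hcf B (ydact V h (ydgr V s x)) j * f j =
    \sum_i \sum_j (if hdg B i == s then u i else 0) * bco B h i j * f j.
  have -> : ydgr V s x = \sum_i (if hdg B i == s then u i else 0) *: hb B i.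
    rewrite linear_sum; apply: eq_bigr => i _; rewrite linearZ /= hgr eq_sym.
    by case: eqP; rewrite ?scale0r ?scaler0.
  rewrite exchange_big linear_sum /=; apply: eq_bigr => j _.
  rewrite -mulr_suml linear_sum fct_sumE; congr (_ * _); apply: eq_bigr => i _.
  by rewrite linearZ /= linearZ.
have phi0 y : y \in S -> \sum_j hcf B y j * f j = 0.
  move=> yS; have /subvP/(_ y yS) : (S <= lker (linfun (hform f)))%VS.
    apply: Sind => h s; rewrite memv_ker lfunE /= /hform phiE.
    by apply: contrapT => nz; apply: no; exists h, s; apply/negP.
  by rewrite memv_ker lfunE => /eqP.
case: irrV => _ /(_ S Ssub)[S0|ST].
  by rewrite -cfx (_ : x = 0) ?linear0 ?eqxx // in ui0; apply/eqP; rewrite -memv0 -S0.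
have := phi0 (hb B j0); rewrite ST memvf => /(_ isT).
rewrite (bigD1 j0) //= hcf_b eqxx mul1r big1 => [|j /negPf ne].
  by rewrite addr0 => /eqP; rewrite (negPf fj0).
by rewrite hcf_b eq_sym ne mul0r.
Qed.

End Irreducibility.

(** * Yetter-Drinfeld modules from structure constants *)

Section Subdata.

Context {K : fieldType} {gT : finGroupType} {I J : finType}.
Variables (N : ydData K gT I) (M : ydData K gT J) (iota : J -> I).
Hypothesis iota_inj : injective iota.
Hypothesis dgM : forall j, dg M j = dg N (iota j).
Hypothesis coMN : forall h j l, co M h j l = co N h (iota j) (iota l).
Hypothesis iota_closed : forall h i l, co N h i (iota l) != 0 -> i \in [set iota j | j : J].

(** Restriction of functions to words over [J]. By [iota_closed] the letters outside [J] span a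
    submodule, so nothing from outside contributes and products restrict to products. *)
Definition pull (F : seq I -> K^o) : seq J -> K^o := fun w => F (map iota w).

Lemma pull_act h F : pull (shact N h F) = shact M h (pull F).
Proof.
apply/funext => w; elim: w F => //= l w IH F; rewrite /pull /=.
rewrite (bigID (mem [set iota j | j : J])) /= [X in _ + X]big1 => [|i ni]; last first.
  have [->|/iota_closed ci] := eqVneq (co N h i (iota l)) 0; first exact: mul0r.
  by rewrite ci in ni.
rewrite addr0 big_imset => [|? ? _ _]; last exact: iota_inj.
by apply: eq_bigr => j _; rewrite coMN; congr (_ * _); apply: (IH (dr (iota j) F)).
Qed.

Lemma pull_mul F H : pull (mul N F H) = mul M (pull F) (pull H).
Proof.
apply/funext => w; elim: w F H => //= l w IH F H; rewrite dgM.
by rewrite -pull_act; congr (_ + _); [apply: (IH F (dr _ H))|apply: (IH (dr _ F))].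
Qed.

Lemma pull_lt j : pull (@letter K I (iota j)) = @letter K J j.
Proof.
apply/funext => w; rewrite /pull /letter; congr (nat_of_bool _)%:R.
by rewrite -(inj_eq (inj_map iota_inj)).
Qed.

Lemma pull_mono v : pull (monom N (map iota v)) = monom M v.
Proof.
elim: v => [|j v IH] /=; last by rewrite pull_mul pull_lt IH.
by apply/funext => -[].
Qed.

Lemma nil_sub L : nil_at N L -> nil_at M L.
Proof. by move=> nN v lv; rewrite -pull_mono nN // size_map. Qed.

End Subdata.

Section Restriction.

Context {K : fieldType} {gT : finGroupType} {I : finType} (N : ydData K gT I).

Definition colI : finType := {i : I | col N i}.
Definition colco h (i j : colI) : K := co N h (val i) (val j).

Fact colco1 i j : colco 1%g i j = (i == j)%:R. Proof. exact: co1. Qed.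
Fact colcoM h k i l : colco (h * k)%g i l = \sum_j colco k i j * colco h j l.
Proof.
rewrite /colco coM -(big_sub (col N) (fun j => co N k (val i) j * co N h j (val l))).
rewrite [RHS]big_mkcond; apply: eq_bigr => j _; case: ifP => // nj.
have [->|/coC e] := eqVneq (co N k (val i) j) 0; first exact: mul0r.
by have := valP i; rewrite e -[col N j]/(j \in col N) nj.
Qed.
Fact colcoD h i j : colco h i j != 0 -> dg N (val j) = (h * dg N (val i) * h^-1)%g.
Proof. exact: coD. Qed.
Fact colcoC h i j : colco h i j != 0 -> true = true :> bool. Proof. by []. Qed.

Definition resData : ydData K gT colI := YdData colco1 colcoM colcoD colcoC.

Lemma nil_res L : nil_at N L -> nil_at resData L.
Proof.
apply: (nil_sub val_inj) => // h i l ne.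
apply/imsetP; have Ci : col N i by rewrite (coC ne) (valP l).
by exists (exist (fun i => col N i) i Ci).
Qed.

End Restriction.

Section DataModule.

Context {K : fieldType} {gT : finGroupType} {I : finType} (N : ydData K gT I).
Local Notation E := {ffun I -> K^o}.

Definition dact (h : gT) (u : E) : E := [ffun l => \sum_k u k * co N h k l].
Definition dgr (s : gT) (u : E) : E := [ffun l => if dg N l == s then u l else 0].

Fact dact_linear h : linear (dact h).
Proof.
move=> a x y; apply/ffunP => l; rewrite !ffunE scaler_sumr -big_split.
by apply: eq_bigr => k _; rewrite !ffunE mulrDl -mulrA.
Qed.
HB.instance Definition _ h := GRing.isLinear.Build K E E *:%R (dact h) (dact_linear h).
Fact dgr_linear s : linear (dgr s).
Proof.
move=> a x y; apply/ffunP => l; rewrite !ffunE.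
by case: ifP => _ //; rewrite scaler0 addr0.
Qed.
HB.instance Definition _ s := GRing.isLinear.Build K E E *:%R (dgr s) (dgr_linear s).

Definition lact h : 'End(E) := linfun (dact h).
Definition lgr s : 'End(E) := linfun (dgr s).

Lemma lactE h u l : lact h u l = \sum_k u k * co N h k l.
Proof. by rewrite lfunE ffunE. Qed.
Lemma lgrE s u l : lgr s u l = if dg N l == s then u l else 0.
Proof. by rewrite lfunE ffunE. Qed.

Fact lact1 : lact 1%g = \1%VF.
Proof.
apply/lfunP => u; apply/ffunP => l; rewrite lactE id_lfunE.
rewrite (bigD1 l) //= co1 eqxx mulr1 big1 ?addr0 // => k /negPf ne.
by rewrite co1 ne mulr0.
Qed.

Fact lactM h k : lact (h * k)%g = (lact h \o lact k)%VF.
Proof.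
apply/lfunP => u; apply/ffunP => l; rewrite comp_lfunE !lactE.
under eq_bigr do rewrite coM mulr_sumr; rewrite exchange_big.
apply: eq_bigr => j _ /=; rewrite lactE mulr_suml.
by apply: eq_bigr => i _; rewrite mulrA.
Qed.

Fact lgrK s t : (lgr s \o lgr t)%VF = if s == t then lgr t else 0.
Proof.
apply/lfunP => u; apply/ffunP => l; rewrite comp_lfunE !lgrE.
have [->|ne] := eqVneq s t; first by rewrite lgrE; case: (dg N l == t).
by rewrite lfunE ffunE; case: eqP => // ->; rewrite (negPf ne).
Qed.

Fact lgr_sum : \sum_s lgr s = \1%VF.
Proof.
apply/lfunP => u; apply/ffunP => l; rewrite sum_lfunE sum_ffunE id_lfunE.
rewrite (bigD1 (dg N l)) //= lgrE eqxx big1 ?addr0 // => s ne.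
by rewrite lgrE eq_sym (negPf ne).
Qed.

Lemma lact_gr h s u : lact h (lgr s u) = lgr (h * s * h^-1)%g (lact h u).
Proof.
apply/ffunP => l; rewrite lgrE !lactE.
transitivity (\sum_k if dg N l == (h * s * h^-1)%g then u k * co N h k l else 0).
  apply: eq_bigr => k _; rewrite lgrE.
  have [->|/coD ->] := eqVneq (co N h k l) 0; first by rewrite !mulr0 if_same.
  by rewrite (inj_eq (mulIg _)) (inj_eq (mulgI _)); case: ifP; rewrite ?mul0r.
by case: ifP => // _; rewrite big1.
Qed.

Fact lgr_act h s : (lact h @: limg (lgr s))%VS = limg (lgr (h * s * h^-1)%g).
Proof.
apply/eqP; rewrite eqEsubv; apply/andP; split; apply/subvP=> u.
  case/memv_imgP=> _ /memv_imgP[p _ ->] ->.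
  by rewrite lact_gr memv_img ?memvf.
case/memv_imgP=> p _ ->; apply/memv_imgP.
exists (lgr s (lact h^-1%g p)); first exact: memv_img (memvf _).
by rewrite lact_gr -(comp_lfunE (lact h)) -lactM mulgV lact1 id_lfunE.
Qed.

Definition dataModule : ydModule K gT := YDModule lact1 lactM lgrK lgr_sum lgr_act.

Definition dvec (i : I) : dataModule := [ffun j => (i == j)%:R : K^o].
Definition dcf (u : dataModule) : I -> K^o := fun i => (u : E) i.
Fact dcf_linear : linear dcf.
Proof. by move=> a x y; apply/funext => i; rewrite /dcf !ffunE. Qed.
HB.instance Definition _ := GRing.isLinear.Build K dataModule (I -> K^o) *:%R dcf dcf_linear.

Fact dvec_sum (u : dataModule) : u = \sum_i dcf u i *: dvec i.
Proof.
apply/ffunP => j; rewrite sum_ffunE (bigD1 j) //= !ffunE eqxx big1 => [|i /negPf ne].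
  by rewrite addr0 [RHS]mulr1.
by rewrite !ffunE ne [LHS]mulr0.
Qed.
Fact dcf_b i j : dcf (dvec i) j = (i == j)%:R. Proof. by rewrite /dcf ffunE. Qed.
Fact dvec_gr s i : ydgr dataModule s (dvec i) = if s == dg N i then dvec i else 0.
Proof.
apply/ffunP => j; rewrite [LHS]lgrE !ffunE.
have [<-|ne] := eqVneq i j; first by rewrite eq_sym; case: ifP; rewrite !ffunE ?eqxx.
by rewrite if_same; case: ifP; rewrite !ffunE // (negPf ne).
Qed.

Definition data_basis : homBasis dataModule I := HomBasis dvec_sum dcf_b dvec_gr.

Lemma bco_data h i j : bco data_basis h i j = co N h i j.
Proof.
rewrite /bco /= /dcf lactE (bigD1 i) //= ffunE eqxx mul1r big1 ?addr0 // => k ne.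
by rewrite ffunE eq_sym (negPf ne) mul0r.
Qed.

Lemma data_findim L : nil_at N L -> nichols_findim dataModule.
Proof.
move=> nN; have cP h i j : bco data_basis h i j != 0 -> col N i = col N j.
  by rewrite bco_data => /coC.
apply: (@nil_findim _ _ _ _ _ _ cP L); move: nN.
apply: (@nil_sub _ _ _ _ _ _ id) => // h j l *; first exact: bco_data.
by apply/imsetP; exists j.
Qed.

End DataModule.

(** * Commutators of two letters *)

Section Commutators.

Context {K : fieldType} {gT : finGroupType} {I : finType} (N : ydData K gT I).

Local Notation Sh := (seq I -> K^o).
Local Notation dg := (dg N).
Local Notation co := (co N).
Local Notation col := (col N).
Local Notation act := (shact N).
Local Notation lt := (@letter K I).
Local Notation Rc := (adC N).
Local Notation "x ** y" := (mul N x y) (at level 40, left associativity).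
Implicit Types (a c i j k l : I) (g h : gT) (x : Sh).

Definition brk c a : Sh := Rc c (lt a).

Lemma lt_at i j : lt i [:: j] = (j == i)%:R.
Proof. by rewrite /letter eqseq_cons andbT. Qed.

Lemma act_lt_at h i j : act h (lt i) [:: j] = co h i j.
Proof.
rewrite act_lt fct_sumE (bigD1 j) //= shZ lt_at eqxx mulr1 big1 ?addr0 // => k ne.
by rewrite shZ lt_at eq_sym (negPf ne) mulr0.
Qed.

Lemma ltlt_at i j k l : (lt i ** lt j) [:: k; l] =
  (k == j)%:R * (l == i)%:R + (k == i)%:R * co (dg i) j l.
Proof.
have [->|ne] := eqVneq k i.
  rewrite -[LHS]/((lt i ** dr i (lt j)) [:: l] + (dr i (lt i) ** act (dg i) (lt j)) [:: l]).
  by rewrite !dr_lt eqxx shmulZr shmul1 shZ lt_at !mul1r scale1r mul1sh act_lt_at.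
rewrite -[LHS]/((lt i ** dr k (lt j)) [:: l] + (dr k (lt i) ** act (dg k) (lt j)) [:: l]).
rewrite !dr_lt shmulZr shmul1 shZ lt_at (negPf ne) scale0r mul0sh mul0r.
by [].
Qed.

(** In tensors, [[a, c] = (t . c) (x) a - c (x) (s^-1 . a)] with [s = dg c] and [t = dg a], the head
    [k] reading the right factor: the terms [a (x) c] of the two products cancel. *)
Lemma brk_at c a k l : brk c a [:: k; l] =
  (k == a)%:R * co (dg a) c l - (l == c)%:R * co (dg c)^-1 a k.
Proof.
rewrite /brk /adC shD shN ltlt_at act_lt shmul_sumr fct_sumE.
have -> : \sum_j (lt c ** (co (dg c)^-1 a j *: lt j)) [:: k; l] =
    co (dg c)^-1 a k * (l == c)%:R + (k == c)%:R * (a == l)%:R.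
  rewrite -(coVK N (dg c)^-1 a l) invgK mulr_sumr.
  under eq_bigr do rewrite shmulZr shZ ltlt_at mulrDr.
  rewrite big_split /=; congr (_ + _).
    rewrite (bigD1 k) //= eqxx mul1r big1 ?addr0 // => j ne.
    by rewrite eq_sym (negPf ne) mul0r mulr0.
  by apply: eq_bigr => j _; rewrite mulrCA.
rewrite [a == l]eq_sym [(l == c)%:R * _]mulrC.
by rewrite [X in X - _]addrC [X in _ - X]addrC opprD addrA addrK.
Qed.

Lemma act_brk_at h c a k l : act h (brk c a) [:: k; l] =
  co h a k * co (h * dg a)%g c l - co h c l * co (h * (dg c)^-1)%g a k.
Proof.
have inner i : act h (dr i (brk c a)) [:: l] =
    (i == a)%:R * co (h * dg a)%g c l - co h c l * co (dg c)^-1 a i.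
  transitivity (\sum_j co h j l * brk c a [:: i; j]) => //.
  under eq_bigr do rewrite brk_at mulrBr; rewrite sumrB; congr (_ - _).
    by rewrite coM mulr_sumr; apply: eq_bigr => j _; rewrite mulrCA [co h j l * _]mulrC.
  rewrite (bigD1 c) //= eqxx mul1r big1 ?addr0 // => j /negPf ->.
  by rewrite mul0r mulr0.
transitivity (\sum_i co h i k * act h (dr i (brk c a)) [:: l]) => //.
under eq_bigr do rewrite inner mulrBr; rewrite sumrB; congr (_ - _).
  rewrite (bigD1 a) //= eqxx mul1r big1 ?addr0 // => i /negPf ->.
  by rewrite mul0r mulr0.
by rewrite coM mulr_sumr; apply: eq_bigr => i _; rewrite mulrCA [co h i k * _]mulrC.
Qed.

Lemma brk_homG c a : homdeg N (dg a * dg c)%g (brk c a).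
Proof. exact/homG_Rc/homG_lt. Qed.

Definition Z11 x : Prop := inK N x /\ homC N 1 1 x.

Lemma Z11_lsub : lsub Z11.
Proof. exact: lsub_and (inK_lsub N) (homC_lsub N 1 1). Qed.

Lemma Z11_brk c a : col c -> ~~ col a -> Z11 (brk c a).
Proof.
move=> Cc Aa; split; first exact/inK_Rc/inK_lt.
by apply: homC_Rc Cc _ => w /lt_supp ->; rewrite /countA /countC /= Aa (negPf Aa).
Qed.

Lemma Z11_act h x : Z11 x -> Z11 (act h x).
Proof. by case=> Kx hx; split; [apply: inK_act|apply: homC_act]. Qed.

Lemma Z11_resG g x : Z11 x -> Z11 (resG N g x).
Proof.
case=> [[Bx kx] hx]; split; [split|].
- pattern x; apply: span_sub Bx => [|_ [v ->]].
    exact: (lsub_preim (resG N g) (inB_lsub N)).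
  rewrite (resG_id _ (@mono_homG _ _ _ N v)); case: ifP => _; first exact: inB_mono.
  by case: (inB_lsub N).
- move=> c /kx cx; apply/funext => w; rewrite /dr /resG; case: ifP => // _.
  exact: (congr1 (fun F : Sh => F w) cx).
- by move=> w; rewrite /resG; case: ifP => [_ /hx//|_]; rewrite eqxx.
Qed.

Lemma Z11_good x : Z11 x -> Good N 1 1 x.
Proof.
case=> [[_ kx] hx] w xw; have [eA eC] := hx _ xw.
have := size_cAC N w; rewrite eA eC; case: w xw eA eC => [|p [|q []]] // xw.
have [Cp|Ap] := boolP (col p).
  by case/eqP: xw; apply: (congr1 (fun F : Sh => F [:: q]) (kx p Cp)).
by rewrite /countA /countC /= (negPf Ap); case: (col q).
Qed.

End Commutators.

Lemma ffun_neq0 (K : fieldType) (I : finType) (u : {ffun I -> K^o}) :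
  u != 0 -> exists i, u i != 0.
Proof.
move=> nz; apply: contrapT => no; case/eqP: nz; apply/ffunP => i; rewrite ffunE.
by apply/eqP; apply: contraT => ui; case: no; exists i.
Qed.

(** * Irreducibility and support of modules given by structure constants *)

Section DataIrreducible.

Context {K : fieldType} {gT : finGroupType}.

Lemma co_neq0 {I : finType} (N : ydData K gT I) h i : exists l, co N h i l != 0.
Proof.
apply: contrapT => no; have := coVK N h i i; rewrite eqxx big1 => [/esym/eqP|l _].
  by rewrite oner_eq0.
have [->|ne] := eqVneq (co N h i l) 0; first exact: mul0r.
by case: no; exists l.
Qed.

Lemma sum_colI {I : finType} (N : ydData K gT I) (G : I -> K) :
  (forall i, ~~ col N i -> G i = 0) -> \sum_i G i = \sum_(i : colI N) G (val i).
Proof.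
move=> G0; rewrite -(big_sub (col N) G) [RHS]big_mkcond; apply: eq_bigr => i _.
by rewrite -[i \in col N]/(col N i); case: ifP => // /negbT/G0.
Qed.

Lemma irr_res {I : finType} (N : ydData K gT I) : irr N true -> irr (resData N) true.
Proof.
move=> irrN u f _ _ [i ui] [j fj].
pose ext (v : colI N -> K) k := oapp v 0 (insub k).
have extE v (k : colI N) : ext v (val k) = v k by rewrite /ext valK.
have ext0 v k : ~~ col N k -> ext v k = 0 by move=> nk; rewrite /ext insubN.
have extC v k : ext v k != 0 -> col N k = true.
  by case: (boolP (col N k)) => // /ext0 ->; rewrite eqxx.
have [||h [s nz]] := irrN (ext u) (ext f) (extC u) (extC f).
- by exists (val i); rewrite extE.
- by exists (val j); rewrite extE.
exists h, s; move: nz; rewrite (sum_colI (N := N)) => [|k /(ext0 u) ->]; last first.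
  by rewrite big1 // => l _; rewrite if_same !mul0r.
rewrite (eq_bigr (fun k => \sum_(l : colI N)
  (if dg (resData N) k == s then u k else 0) * co (resData N) h k l * f l)) // => k _.
rewrite (sum_colI (N := N)) => [|l /(ext0 f) ->]; last exact: mulr0.
by apply: eq_bigr => l _; rewrite !extE.
Qed.

Context {I : finType} (N : ydData K gT I).
Hypotheses (colT : forall i, col N i) (irrN : irr N true).

Lemma irr_coT (u f : I -> K) : (exists i, u i != 0) -> (exists i, f i != 0) ->
  exists h s, \sum_i \sum_j (if dg N i == s then u i else 0) * co N h i j * f j != 0.
Proof. by move=> unz fnz; apply: irrN => // i _; apply: colT. Qed.

Lemma data_irr (i0 : I) : ydirr (dataModule N).
Proof.
split=> [|S subS].
  apply/eqP => e; have : dvec N i0 \in {: dataModule N}%VS by rewrite memvf.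
  rewrite e memv0 => /eqP/(congr1 (fun u : {ffun I -> K^o} => u i0)).
  by rewrite !ffunE eqxx => /eqP; rewrite oner_eq0.
have [->|Snz] := eqVneq S 0%VS; [by left|right].
apply/vspaceP => v; rewrite memvf; have Su := memv_pick S; set u := vpick S in Su.
have /ffun_neq0[i ui] : u != 0 by rewrite vpick0.
pose P (w : I -> K^o) := ([ffun i => w i] : dataModule N) \in S.
have sP : lsub P.
  split=> [|a x y Px Py]; rewrite /P.
    by rewrite (_ : [ffun i => _] = 0) ?mem0v.
  rewrite (_ : [ffun i => _] = a *: ([ffun i => x i] : dataModule N) + [ffun i => y i]).
    by rewrite memvD ?memvZ.
  by apply/ffunP => j; rewrite !ffunE.
have -> : v = [ffun i => (v : {ffun I -> K^o}) i] by apply/ffunP => j; rewrite ffunE.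
suff: P (fun i => (v : {ffun I -> K^o}) i) by [].
apply: (lsub_full sP) => f annf j.
apply/eqP; apply: contraT => fj.
have [||h [s]] := @irr_coT (fun i => (u : {ffun I -> K^o}) i) f; [by exists i|by exists j|].
case/eqP; rewrite exchange_big /=.
have Sgu : ydact (dataModule N) h (ydgr (dataModule N) s u) \in S.
  by apply: (subvP (subS h).1); apply: memv_img; apply: (subvP (subS s).2); apply: memv_img.
have Pgu : P (fun i => (ydact (dataModule N) h (ydgr (dataModule N) s u) : {ffun I -> K^o}) i).
  by rewrite /P (_ : [ffun i => _] = ydact (dataModule N) h (ydgr (dataModule N) s u)) //;
    apply/ffunP => k; rewrite ffunE.
rewrite -[RHS](annf _ Pgu).
apply: eq_bigr => k _; rewrite -mulr_suml; congr (_ * _).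
by rewrite [RHS]lactE; apply: eq_bigr => l _; rewrite lgrE.
Qed.

Lemma data_supp (i0 : I) : ydsupp (dataModule N) = (dg N i0 ^: [set: gT])%g.
Proof.
apply/setP => s; rewrite inE; apply/idP/imsetP => [|[h _ ->]].
  rewrite -vpick0 => /ffun_neq0[k].
  have /ydcompP/(congr1 (fun u : {ffun I -> K^o} => u k)) := memv_pick (ydcomp (dataModule N) s).
  rewrite [LHS]lgrE => e nz; have {e} es : dg N k = s.
    by apply/eqP; apply: contraNT nz => /negPf ns; rewrite -e ns.
  have [||h [s']] := @irr_coT (fun i => (i == i0)%:R) (fun i => (i == k)%:R).
  - by exists i0; rewrite eqxx oner_eq0.
  - by exists k; rewrite eqxx oner_eq0.
  case/sum_neq0 => i _ /sum_neq0[j _]; rewrite !mulf_eq0 !negb_or => /andP[/andP[]].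
  case: ifP => _; rewrite ?eqxx //; case: (i =P i0) => [-> _|]; rewrite ?eqxx //.
  move=> /coD ej; case: (j =P k) => [ejk _|]; rewrite ?eqxx //.
  by exists h^-1%g; rewrite ?inE // -es -ejk ej conjgE invgK mulgA.
have [l /coD el] := co_neq0 N h^-1 i0.
have -> : (dg N i0 ^ h)%g = dg N l by rewrite el conjgE invgK mulgA.
apply/eqP => e; have : dvec N l \in ydcomp (dataModule N) (dg N l).
  by apply/ydcompP; rewrite [LHS](dvec_gr N) eqxx.
rewrite e memv0 => /eqP/(congr1 (fun u : {ffun I -> K^o} => u l)).
by rewrite !ffunE eqxx => /eqP; rewrite oner_eq0.
Qed.

End DataIrreducible.

(** * The action of ts on the commutator of two letters *)

Section Values.

Context {K : fieldType} {gT : finGroupType} {I : finType} (N : ydData K gT I).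

Local Notation Sh := (seq I -> K^o).
Local Notation dg := (dg N).
Local Notation co := (co N).
Local Notation act := (shact N).
Local Notation brk := (brk N).
Section Pair.

Variables (a c : I).
Local Notation s := (dg c).
Local Notation t := (dg a).
Hypothesis neq_st : (s * t <> t * s)%g.

(** [t . c] has degree [t s t^-1], which differs from [s], so the term with left factor [c] does not
    contribute. *)
Lemma brk_val l : co t c l != 0 -> l != c /\ brk c a [:: a; l] = co t c l.
Proof.
move=> ctl; have ne : l != c.
  by apply/eqP => e; apply: neq_st; rewrite -{1}e (coD ctl) mulgKV.
by rewrite brk_at eqxx mul1r (negPf ne) mul0r subr0.
Qed.

Lemma brk_neq0 : brk c a <> 0.
Proof.
have [l ctl] := co_neq0 N t c; move/(congr1 (fun F : Sh => F [:: a; l])).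
by rewrite (brk_val ctl).2 => /eqP; rewrite (negPf ctl).
Qed.

Variables (qV qW q : K).
Hypotheses (cV : forall l, co s c l = qV * (c == l)%:R)
  (cW : forall l, co t a l = qW * (a == l)%:R).
Hypotheses (q0 : q != 0) (qE : act (t * s)%g (brk c a) = q *: brk c a).

(** The element [ts] acts on both terms of [[a, c]]. In the second one [ts s^-1 = t], and the
    scalars on [c] and [a] come out. *)
Lemma act_ts_at k l : q * brk c a [:: k; l] =
  co (t * s)%g a k * co (t * s * t)%g c l - qV * qW * (a == k)%:R * co t c l.
Proof.
have := congr1 (fun F : Sh => F [:: k; l]) qE; rewrite act_brk_at shZ mulgK cW => <-.
congr (_ - _); rewrite coM (bigD1 c) //= cV eqxx mulr1 big1 ?addr0.
  by rewrite mulrACA mulrA mulrAC.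
by move=> j /negPf ne; rewrite cV eq_sym ne mulr0 mul0r.
Qed.

(** At [[a; l]] the first term could survive only if [ts] commuted with [t]. *)
Lemma scalar_eq : q = - (qV * qW).
Proof.
have [l ctl] := co_neq0 N t c; have [_ bl] := brk_val ctl.
have := act_ts_at a l; rewrite bl eqxx mulr1 => e.
suff z0 : co (t * s)%g a a * co (t * s * t)%g c l = 0.
  by apply: (mulIf ctl); rewrite e z0 sub0r mulNr.
have [->|/coD ea] := eqVneq (co (t * s)%g a a) 0; first exact: mul0r.
case: neq_st; apply: (mulgI t).
by have := congr1 (mulg^~ (t * s)%g) ea; rewrite mulgKV -[(t * s * t)%g]mulgA => ->.
Qed.

(** At [[k; c]], with [k] occurring in [s^-1 . a], the left side is nonzero and the second term on
    the right vanishes. So [c] occurs in [tst . c], which means that [tst] commutes with [s]. *)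
Lemma square_comm : ((s * t) ^+ 2 = (t * s) ^+ 2)%g.
Proof.
have [k cak] := co_neq0 N s^-1 a.
have nk : k != a.
  apply/eqP => e; have := coD cak; rewrite e invgK => et; apply: neq_st.
  by rewrite {1}et !mulgA mulgV mul1g.
have := act_ts_at k c; rewrite brk_at (negPf nk) mul0r eqxx mul1r sub0r eq_sym (negPf nk).
rewrite mulr0 mul0r subr0 => /eqP; have [e|/coD ec _] := eqVneq (co (t * s * t)%g c c) 0.
  by rewrite e mulr0 mulf_eq0 oppr_eq0 (negPf q0) (negPf cak).
by have := congr1 (mulg^~ (t * s * t)%g) ec; rewrite mulgKV !expgS expg0 !mulg1 !mulgA.
Qed.

End Pair.

End Values.

(** * Transitivity on noncommuting pairs *)

Section LadderTop.

Context {K : fieldType} {gT : finGroupType} {I : finType} (N : ydData K gT I).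

Local Notation Sh := (seq I -> K^o).
Local Notation act := (shact N).
Local Notation brk := (brk N).
Local Notation Z := (Z11 N).
Implicit Types (x y : Sh) (g h : gT).

Context {J : finType} (M : ydData K gT J).
Variables (theta : {linear Sh -> (J -> K^o)}).
Hypothesis irrM : irr M true.
Hypothesis thP : forall x, Z x -> [/\ theta x = 0 -> x = 0,
  forall k, theta x k != 0 -> col M k,
  forall h k, theta (act h x) k = \sum_l theta x l * co M h l k
  & forall g k, homdeg N g x -> theta x k != 0 -> dg M k = g].

Lemma theta_eq x y : Z x -> Z y ->
  (forall k, col M k -> theta x k = theta y k) -> x = y.
Proof.
move=> Zx Zy e; apply/eqP; rewrite -subr_eq0; apply/eqP.
have [th0 thC _ _] := thP (lsubB (Z11_lsub N) Zx Zy); apply: th0.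
apply/funext => k; apply/eqP; apply: contraT => nz.
have := nz; rewrite linearB shD shN e ?subrr ?eqxx //; exact: thC.
Qed.

Lemma span_orbit g x y : Z x -> homdeg N g x -> x <> 0 -> Z y ->
  linspan (fun z => exists h, z = act h x) y.
Proof.
move=> Zx hx nx Zy; set X := fun z => _.
have [th0 thC tha thG] := thP Zx.
have ZX z : linspan X z -> Z z.
  by move: z; apply: span_sub => [|_ [h ->]]; [apply: Z11_lsub|apply: Z11_act].
pose P (u : J -> K^o) := exists2 z, linspan X z & forall k, col M k -> u k = theta z k.
have sP : lsub P.
  split=> [|b u v [z Xz uz] [w Xw vw]].
    by exists 0 => [|k _]; [left|rewrite linear0].
  exists (b *: z + w) => [|k Ck]; first exact: (span_lsub X).2.
  by rewrite linearP !shL uz ?vw.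
suff [z Xz yz] : P (theta y) by rewrite (theta_eq Zy (ZX z Xz) yz).
apply: (lsub_full sP) => f annf j; apply/eqP; apply: contraT => fj.
have fC k : f k != 0 -> col M k = true.
  apply: contraNT => nk.
  have Pk : P (fun i => (i == k)%:R).
    exists 0 => [|i Ci]; [by left|rewrite linear0].
    by case: eqP => // e; rewrite -e Ci in nk.
  have := annf _ Pk; rewrite (bigD1 k) //= eqxx mul1r big1 ?addr0 => [-> //|i /negPf ->].
  exact: mul0r.
have [||h [s]] := irrM (u := theta x) thC fC.
- apply: contrapT => no; apply: nx; apply: th0; apply/funext => k.
  by apply/eqP; apply: contraT => nz; case: no; exists k.
- by exists j.
case/eqP; have [<-|ne] := eqVneq g s; last first.
  apply: big1 => i _; apply: big1 => k _; case: eqP => [e|_]; rewrite ?mul0r //.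
  have [->|/(thG _ _ hx) ei] := eqVneq (theta x i) 0; rewrite ?mul0r //.
  by rewrite -ei e eqxx in ne.
have Ph : P (theta (act h x)).
  by exists (act h x) => //; apply: span_gen; exists h.
rewrite -[RHS](annf _ Ph) exchange_big; apply: eq_bigr => k _ /=.
rewrite -mulr_suml tha; congr (_ * _); apply: eq_bigr => i _; congr (_ * _).
case: eqP => // ne; apply/esym/eqP; apply: contraT => nz; case: ne.
exact: thG hx nz.
Qed.

(** Some translate of [[a, c1]] is nonzero at a word [[a; l]] where [[a, c2]] is. Either term of
    [act_brk_at] then yields an element centralising [dg a], and the degree of [l] gives the
    conjugation. *)
Lemma conj_pairs a c1 c2 : ~~ col N a -> col N c1 -> col N c2 ->
  (dg N c1 * dg N a <> dg N a * dg N c1)%g -> (dg N c2 * dg N a <> dg N a * dg N c2)%g ->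
  exists2 k, commute k (dg N a) & dg N c2 = (k * dg N c1 * k^-1)%g.
Proof.
move=> Aa C1 C2 n1 n2; have Z1 := Z11_brk C1 Aa; have Z2 := Z11_brk C2 Aa.
have sp := span_orbit Z1 (@brk_homG _ _ _ N c1 a) (brk_neq0 n1) Z2.
have [l cl] := co_neq0 N (dg N a) c2; have [_ bl] := brk_val n2 cl.
have [_ [h ->]] : exists2 H, exists h, H = act h (brk c1 a) & H [:: a; l] != 0.
  by apply: (span_nz sp); rewrite bl.
have es2 : dg N c2 = ((dg N a)^-1 * dg N l * dg N a)%g.
  by rewrite (coD cl) !mulgA mulVg mul1g mulgKV.
have comm k : dg N a = (k * dg N a * k^-1)%g -> commute k (dg N a).
  by rewrite /commute => {2}->; rewrite mulgKV.
rewrite act_brk_at => /add_neq0[|]; last rewrite oppr_eq0;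
  rewrite mulf_eq0 negb_or => /andP[/coD e1 /coD e2].
  exists h; first exact: comm.
  rewrite es2 e2 (comm _ e1) !invMg !mulgA mulVg mul1g.
  by rewrite mulgKV.
have ck := comm _ e2.
(* Here [h (dg c1)^-1] centralises [dg a], and the factor [(dg a)^-1] undoes the passage from the
   degree of [c2] to that of [l]. *)
exists ((dg N a)^-1 * (h * (dg N c1)^-1))%g.
  by rewrite /commute -mulgA ck mulKg mulKVg.
by rewrite es2 e1 !invMg !invgK !mulgA !mulgKV.
Qed.

End LadderTop.

(** * Consequences for two letters of noncommuting degrees *)

Section TwoColoured.

Context {K : closedFieldType} {gT : finGroupType} {I : finType} (N : ydData K gT I).
Variable L : nat.
Hypotheses (nilN : nil_at N L) (irrA : irr N false) (irrC : irr N true).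
Variables (a c : I).
Hypotheses (Aa : ~~ col N a) (Cc : col N c).
Hypothesis neq : (dg N c * dg N a <> dg N a * dg N c)%g.

Lemma ladder11 : exists (J : finType) (M : ydData K gT J) (L' : nat)
    (theta : {linear (seq I -> K^o) -> (J -> K^o)}),
  [/\ nil_at M L', irr M true
    & forall x, Z11 N x -> [/\ theta x = 0 -> x = 0,
        forall k, theta x k != 0 -> col M k,
        forall h k, theta (shact N h x) k = \sum_l theta x l * co M h l k
      & forall g k, homdeg N g x -> theta x k != 0 -> dg M k = g]].
Proof.
apply: (ladder (D := L) (i := 1) (j := 1) nilN irrA irrC) => //.
- by exists a.
- by exists c.
(* For [i = j = 1] any bound on the length of nonzero monomials can serve as [D]. *)
- move=> v nv; rewrite !mul1n; apply: leq_trans (leq_addl _ _).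
  apply: leq_trans (count_size _ _) _; rewrite leqNgt; apply/negP => lt_v.
  by case: nv; apply: nilN; apply: ltnW.
- exact: Z11_lsub.
- by move=> x Zx; split; [case: Zx => [[]]|case: Zx|apply: Z11_good].
- exact: Z11_act.
- exact: Z11_resG.
- by exists (brk N c a); [apply: Z11_brk|apply: brk_neq0].
Qed.

Variables (qV qW : K).
Hypotheses (cV : forall l, co N (dg N c) c l = qV * (c == l)%:R)
  (cW : forall l, co N (dg N a) a l = qW * (a == l)%:R).

Lemma two_coloured_pair :
  ((dg N c * dg N a) ^+ 2 = (dg N a * dg N c) ^+ 2)%g /\
  exists U : ydModule K gT,
    [/\ ydirr U, ydsupp U = ((dg N c * dg N a) ^: [set: gT])%g,
        ydscalar U (- (qV * qW)) & nichols_findim U].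
Proof.
have [J [M [L' [theta [nilM irrM thP]]]]] := ladder11.
have Zb := Z11_brk Cc Aa; have [th0 thC tha thG] := thP _ Zb.
have /existsP[k0 nz0] : [exists k, theta (brk N c a) k != 0].
  apply: contraT; rewrite negb_exists => /forallP e; case: (brk_neq0 neq); apply: th0.
  by apply/funext => k; apply/eqP/negPn/e.
have dk0 := thG _ _ (@brk_homG _ _ _ N c a) nz0.
pose i0 : colI M := exist (fun k => col M k) k0 (thC _ nz0).
have colT (i : colI M) : col (resData M) i by [].
have irrR := irr_res irrM.
pose U := dataModule (resData M).
have irrU : ydirr U := data_irr colT irrR i0.
have [q [q0 qU _]] := ydscalar_irr irrU.
pose z := (dg N a * dg N c)%g; pose b := brk N c a.
(* [theta b] is a vector of degree [z] in [U], so [z] acts on it by the scalar [q]; injectivity of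
   [theta] transfers this to [b]. *)
have qE : shact N z b = q *: b.
  apply: (theta_eq thP) (Z11_act z Zb) (lsubZ _ (Z11_lsub N) Zb) _ => k Ck.
  pose u : U := [ffun i : colI M => theta b (val i)].
  have uz : u \in ydcomp U z.
    apply/ydcompP/ffunP => i; rewrite [LHS]lgrE !ffunE.
    have [->|nz] := eqVneq (theta b (val i)) 0; first by rewrite if_same.
    by rewrite [dg _ i](thG _ _ (@brk_homG _ _ _ N c a) nz) eqxx.
  pose i : colI M := exist (fun k => col M k) k Ck.
  have := congr1 (fun v : {ffun colI M -> K^o} => v i) (qU z u uz).
  rewrite [LHS]lactE [RHS]ffunE ffunE => e.
  apply: (etrans (y := q *: theta b (val i))); last by rewrite linearZ_LR.
  rewrite -e tha (sum_colI (N := M)) => [|l nl]; first by apply: eq_bigr => l _; rewrite ffunE.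
  have [->|/thC] := eqVneq (theta (brk N c a) l) 0; first exact: mul0r.
  by rewrite (negPf nl).
split; first exact: (square_comm neq cV cW q0 qE).
exists U; split=> //.
- rewrite (data_supp colT irrR i0) [dg _ i0]dk0.
  (* The commutator has degree [ts], which is conjugate to [st]. *)
  have -> : (dg N a * dg N c = (dg N c * dg N a) ^ dg N c)%g.
    by rewrite conjgE !mulgA mulVg mul1g.
  by rewrite (classGidl (G := [set: gT]%G)) ?inE.
- by rewrite -(scalar_eq neq cV cW qE).
- exact: data_findim (nil_res nilM).
Qed.

Lemma two_coloured_conj c' : col N c' -> (dg N c' * dg N a <> dg N a * dg N c')%g ->
  exists2 k, commute k (dg N a) & dg N c' = (k * dg N c * k^-1)%g.
Proof.
have [J [M [L' [theta [_ irrM thP]]]]] := ladder11.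
by move=> Cc' neq'; apply: (conj_pairs irrM thP Aa Cc Cc' neq neq').
Qed.

End TwoColoured.

Section SumData.

Context {K : fieldType} {gT : finGroupType} {V W : ydModule K gT}.

Local Notation BV := (homogeneous_basis V).
Local Notation BW := (homogeneous_basis W).
Local Notation N := (basisData (@sum_colP _ _ _ _ _ _ BV BW)).

Lemma hidx_ex (U : ydModule K gT) s : s \in ydsupp U -> exists i : hidx U, tag i = s.
Proof.
rewrite inE -dimv_eq0 -lt0n => lt_0.
by exists (Tagged (fun s => 'I_(\dim (ydcomp U s))) (Ordinal lt_0)).
Qed.

Lemma irr_sum_true : ydirr V -> irr N true.
Proof.
move=> irrV u f uC fC [[i|i] ui]; last by have := uC _ ui.
case=> [[j|j] fj]; last by have := fC _ fj.
have u0 k : u (inr k) = 0 by apply/eqP; apply: contraT => /uC.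
have [||h [s nz]] := ydirr_irr BV irrV (u := u \o inl) (f := f \o inl).
- by exists i.
- by exists j.
exists h, s; move: nz; rewrite big_sumType /= [X in _ -> _ + X != 0]big1 => [|k _]; last first.
  by rewrite u0 big1 // => l _; rewrite if_same !mul0r.
rewrite addr0; apply: etrans; congr (_ != 0); apply: eq_bigr => k _; rewrite big_sumType /=.
rewrite [X in _ + X]big1 ?addr0 => [|l _]; last by rewrite bco_sum mulr0 mul0r.
by apply: eq_bigr => l _; rewrite bco_sum.
Qed.

Lemma irr_sum_false : ydirr W -> irr N false.
Proof.
move=> irrW u f uC fC [[i|i] ui]; first by have := uC _ ui.
case=> [[j|j] fj]; first by have := fC _ fj.
have u0 k : u (inl k) = 0 by apply/eqP; apply: contraT => /uC.
have [||h [s nz]] := ydirr_irr BW irrW (u := u \o inr) (f := f \o inr).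
- by exists i.
- by exists j.
exists h, s; move: nz; rewrite big_sumType /= [X in _ -> X + _ != 0]big1 => [|k _]; last first.
  by rewrite u0 big1 // => l _; rewrite if_same !mul0r.
rewrite add0r; apply: etrans; congr (_ != 0); apply: eq_bigr => k _; rewrite big_sumType /=.
rewrite [X in X + _]big1 ?add0r => [|l _]; last by rewrite bco_sum mulr0 mul0r.
by apply: eq_bigr => l _; rewrite bco_sum.
Qed.

Lemma bco_scalar (U : ydModule K gT) q (i j : hidx U) : ydscalar U q ->
  bco (homogeneous_basis U) (tag i) i j = q * (i == j)%:R.
Proof.
move=> qU; have e : ydact U (tag i) (hvec i) = q *: hvec i by apply: qU; apply: hvec_in.
by rewrite /bco [ydact _ _ _]e linearZ_LR shZ; congr (_ * _); apply: hcoord_b.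
Qed.

Lemma sum_scalar_inl q (i : hidx V) k : ydscalar V q ->
  co N (tag i) (inl i) k = q * (inl i == k)%:R.
Proof.
move=> qS; rewrite [LHS](bco_sum BV BW); case: k => j; last by rewrite mulr0.
exact: bco_scalar.
Qed.

Lemma sum_scalar_inr q (i : hidx W) k : ydscalar W q ->
  co N (tag i) (inr i) k = q * (inr i == k)%:R.
Proof.
move=> qS; rewrite [LHS](bco_sum BV BW); case: k => j; first by rewrite mulr0.
exact: bco_scalar.
Qed.

End SumData.

Theorem theorem8p6 (K : closedFieldType) (charK : [pchar K] =i pred0)
    (gT : finGroupType) (g h : gT) (V W : ydModule K gT)
    (irrV : ydirr V) (suppV : ydsupp V = (g ^: [set: gT])%g)
    (irrW : ydirr W) (suppW : ydsupp W = (h ^: [set: gT])%g)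
    (findimVW : nichols_findim (ydsum V W)) :
  [/\ forall s t : gT,
        s \in (g ^: [set: gT])%g -> t \in (h ^: [set: gT])%g ->
        ((s * t) ^+ 2 = (t * s) ^+ 2)%g,
      forall x y : gT,
        ((x * g * x^-1) * h <> h * (x * g * x^-1))%g ->
        ((y * g * y^-1) * h <> h * (y * g * y^-1))%g ->
        ('C[h] * [set x] * 'C[g] = 'C[h] * [set y] * 'C[g])%g
    & forall (qV qW : K), ydscalar V qV -> ydscalar W qW ->
      forall s t : gT,
        s \in (g ^: [set: gT])%g -> t \in (h ^: [set: gT])%g ->
        (s * t <> t * s)%g ->
        exists U : ydModule K gT,
          [/\ ydirr U, ydsupp U = ((s * t) ^: [set: gT])%g,
              ydscalar U (- (qV * qW)) & nichols_findim U]].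
Proof.
have [L nilN] := findim_nil (@sum_colP _ _ _ _ _ _ (homogeneous_basis V) (homogeneous_basis W)) findimVW.
have irrA := irr_sum_false (V := V) irrW; have irrC := irr_sum_true (W := W) irrV.
have inV s : s \in (g ^: [set: gT])%g -> exists i : hidx V, tag i = s.
  by rewrite -suppV; apply: hidx_ex.
have inW t : t \in (h ^: [set: gT])%g -> exists i : hidx W, tag i = t.
  by rewrite -suppW; apply: hidx_ex.
have pair qV qW s t : ydscalar V qV -> ydscalar W qW ->
    s \in (g ^: [set: gT])%g -> t \in (h ^: [set: gT])%g -> (s * t <> t * s)%g ->
    ((s * t) ^+ 2 = (t * s) ^+ 2)%g /\ exists U : ydModule K gT,
      [/\ ydirr U, ydsupp U = ((s * t) ^: [set: gT])%g,
          ydscalar U (- (qV * qW)) & nichols_findim U].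
  move=> qVS qWS /inV[i <-] /inW[j <-] neq.
  exact: (two_coloured_pair nilN irrA irrC (a := inr j) (c := inl i) isT isT neq
    (fun k => sum_scalar_inl i k qVS) (fun k => sum_scalar_inr j k qWS)).
split=> [s t gs ht|x y nx ny|qV qW qVS qWS s t gs ht neq]; last first.
- by have [] := pair qV qW s t qVS qWS gs ht neq.
- have cl z : (z * g * z^-1)%g \in (g ^: [set: gT])%g.
    by apply/imsetP; exists z^-1%g; rewrite ?inE // conjgE invgK mulgA.
  have [i ei] := inV _ (cl x); have [k ek] := inV _ (cl y).
  have [j ej] := inW h (class_refl [set: gT]%G h).
  rewrite -ei -ej in nx; rewrite -ek -ej in ny.
  have [m mh] := two_coloured_conj nilN irrA irrC (a := inr j) (c := inl i) isT isT nx
    (c' := inl k) isT ny.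
  rewrite /= ei ek => e; rewrite [dg _ _]ej in mh.
  have mC : m \in 'C[h] by apply/cent1P; symmetry.
  (* Since [y g y^-1 = m (x g x^-1) m^-1], the element [(m x)^-1 y] centralises [g], and [y] is
     [m x] times this element. *)
  have countC : ((m * x)^-1 * y)%g \in 'C[g].
    apply/cent1P; rewrite /commute.
    have -> : ((m * x)^-1 * y * g = (m * x)^-1 * (y * g * y^-1) * y)%g.
      by rewrite -!mulgA mulVg mulg1.
    by rewrite e invMg !mulgA mulgKV mulVg mul1g.
  rewrite -[y in RHS](mulKVg (m * x)%g); move: (_^-1 * y)%g countC => d dC.
  by rewrite -!mulg_set1 !mulgA (rcoset_id mC) -[RHS]mulgA (lcoset_id dC).
(* The relation between [s] and [t] does not mention scalars, but its proof does; irreducibility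
   over an algebraically closed field provides them. *)
have [qV [_ qVS _]] := ydscalar_irr irrV; have [qW [_ qWS _]] := ydscalar_irr irrW.
have [e|/eqP neq] := eqVneq (s * t)%g (t * s)%g; first by rewrite e.
by have [] := pair qV qW s t qVS qWS gs ht neq.
Qed.
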